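(* Let $0<\alpha<n$ and $1<p<q<\infty$, and suppose that $(u,\sigma)$ is a pair of weights on $\mathbb{R}^n$ with $(u,\sigma)\in A^\alpha_{p,q}$ and $u,\sigma\in A_\infty$. Then $$\|I_\alpha(\,\cdot\,\sigma)\|_{L^p(\sigma)\to L^{q}(u)}\lesssim \sup_Q A^\alpha_{p,q}(u,\sigma,Q)\,A^{\exp}_\infty(\sigma,Q)^{\frac1q}+\sup_Q A^\alpha_{q',p'}(\sigma,u,Q)\,A^{\exp}_\infty(u,Q)^{\frac1{p'}}$$ and $$\|I_\alpha(\,\cdot\,\sigma)\|_{L^p(\sigma)\to L^{q}(u)}\lesssim [u,\sigma]_{A^\alpha_{p,q}}\Big([u]_{A^M_\infty}^{\frac1{p'}}+[\sigma]_{A^M_\infty}^{\frac1q}\Big).$$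
   Context: A weight is a non-negative locally integrable function on $\mathbb{R}^n$; $r'=r/(r-1)$. All cubes have sides parallel to the axes, and all suprema $\sup_Q$ are over all cubes $Q$. The Riesz potential is $I_\alpha f(x)=\int_{\mathbb{R}^n}\frac{f(y)}{|x-y|^{n-\alpha}}\,dy$, and $M f(x)=\sup_{Q\ni x}\frac1{|Q|}\int_Q|f|\,dy$ is the Hardy–Littlewood maximal operator. For exponents $1<p\le q<\infty$ and weights $(u,\sigma)$, $A^\alpha_{p,q}(u,\sigma,Q)=|Q|^{\frac{\alpha}{n}+\frac1q-\frac1p}\left(\frac1{|Q|}\int_Q u\,dx\right)^{1/q}\left(\frac1{|Q|}\int_Q\sigma\,dx\right)^{1/p'}$, $[u,\sigma]_{A^\alpha_{p,q}}=\sup_Q A^\alpha_{p,q}(u,\sigma,Q)$, and $(u,\sigma)\in A^\alpha_{p,q}$ means $[u,\sigma]_{A^\alpha_{p,q}}<\infty$. (One has $A^\alpha_{p,q}(u,\sigma,Q)=A^\alpha_{q',p'}(\sigma,u,Q)$.) For a weight $w$, $A^{\exp}_\infty(w,Q)=\left(\frac1{|Q|}\int_Q w\,dx\right)\exp\left(-\frac1{|Q|}\int_Q\log w\,dx\right)$, $[w]_{A^{\exp}_\infty}=\sup_Q A^{\exp}_\infty(w,Q)$; $[w]_{A^M_\infty}=\sup_Q\frac{1}{w(Q)}\int_Q M(w\chi_Q)\,dx$, where $w(Q)=\int_Q w\,dx$. A (not identically zero) weight $w$ is in $A_\infty$ if $[w]_{A^{\exp}_\infty}<\infty$; equivalently,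 if $[w]_{A^M_\infty}<\infty$. $\|g\|_{L^{q}(u)}=(\int|g|^q u\,dx)^{1/q}$, and $\|I_\alpha(\,\cdot\,\sigma)\|_{L^p(\sigma)\to L^{q}(u)}$ is the smallest $C\in[0,\infty]$ such that $\|I_\alpha(f\sigma)\|_{L^{q}(u)}\le C\|f\|_{L^p(\sigma)}$ for all (non-negative, by positivity) $f\in L^p(\sigma)$. $A\lesssim B$ means $A\le cB$ with $c$ depending only on $n,\alpha,p,q$. *)

(* Defs.v *)
From HB Require Import structures.
From mathcomp Require Import all_boot all_order all_algebra.
From mathcomp Require Import all_classical all_reals all_analysis.
Set Implicit Arguments.
Unset Strict Implicit.
Unset Printing Implicit Defensive.
Import Order.TTheory GRing.Theory Num.Theory.
Import numFieldNormedType.Exports.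
Local Open Scope classical_set_scope.
Local Open Scope ring_scope.
Local Open Scope ereal_scope.

Section borel_lebesgue_measure.
Context {R : realType}.

Definition cons_pair n (x : measurableTypeR R * n.-tuple R) : n.+1.-tuple R :=
  [the n.+1.-tuple R of x.1 :: x.2].

Definition uncons n (t : n.+1.-tuple R) : measurableTypeR R * n.-tuple R :=
  (thead t, [tuple of behead t]).

Lemma cons_pairK n : cancel (@cons_pair n) (@uncons n).
Proof. by move=> [a t]; congr pair; apply/val_inj. Qed.

Lemma measurable_cons_pair n : measurable_fun setT (@cons_pair n).
Proof. exact: measurable_cons. Qed.

Lemma measurable_uncons n : measurable_fun setT (@uncons n).
Proof.
apply/measurable_fun_pair; first exact: measurable_tnth.
exact: measurable_behead.
Qed.

Section step.
Variables (n : nat) (mu : {sigma_finite_measure set (n.-tuple R) -> \bar R}).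

Definition leb_step : set (n.+1.-tuple R) -> \bar R :=
  pushforward (@lebesgue_measure R \x mu) (@cons_pair n).

Let leb_step0 : leb_step set0 = 0.
Proof. by rewrite /leb_step /pushforward preimage_set0 measure0. Qed.

Let leb_step_ge0 A : 0 <= leb_step A.
Proof. by rewrite /leb_step /pushforward measure_ge0. Qed.

Let leb_step_sigma_additive : semi_sigma_additive leb_step.
Proof.
move=> F mF tF mUF; rewrite /leb_step /pushforward preimage_bigcup.
have mP A : measurable A -> measurable (@cons_pair n @^-1` A).
  by move=> mA; rewrite -[X in measurable X]setTI; exact: measurable_cons_pair.
apply: measure_semi_sigma_additive.
- move=> k; apply: mP; apply: mF.
- apply/trivIsetP => /= i j _ _ ij; rewrite -preimage_setI.
  by move/trivIsetP : tF => /(_ _ _ _ _ ij) ->//; rewrite preimage_set0.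
- by rewrite -preimage_bigcup; exact: mP.
Qed.

HB.instance Definition _ := isMeasure.Build _ _ _ leb_step
  leb_step0 leb_step_ge0 leb_step_sigma_additive.

Lemma leb_stepE (A : set R) (B : set (n.-tuple R)) :
  measurable A -> measurable B ->
  leb_step [set t | A (thead t) /\ B [tuple of behead t]] =
  lebesgue_measure A * mu B.
Proof.
move=> mA mB; rewrite /leb_step /pushforward -product_measure1E//.
congr (_ _); apply/seteqP; split => -[a t] /=.
  case=> Aa Bt; split => //=.
  by rewrite (_ : t = [tuple of behead (a :: t)])//; apply/val_inj.
case=> Aa Bt; split => //=.
by rewrite (_ : [tuple of behead (a :: t)] = t)//; apply/val_inj.
Qed.

Let leb_step_sigma_finite : sigma_finite setT leb_step.
Proof.
have /sigma_finiteP[F [TF ndF Foo]] := sigma_finiteT (@lebesgue_measure R).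
have /sigma_finiteP[G [TG ndG Goo]] := sigma_finiteT mu.
exists (fun k => @uncons n @^-1` (F k `*` G k)).
  rewrite -preimage_bigcup (_ : \bigcup_k _ = setT) ?preimage_setT//.
  rewrite -setXTT TF TG predeqE => -[x y]; split.
    by move=> [k _ []/= ? ?]; split; exists k.
  move=> [/= [k _ Fkx] [l _ Gly]]; exists (maxn k l) => //; split.
  - by move: x Fkx; exact/subsetPset/ndF/leq_maxl.
  - by move: y Gly; exact/subsetPset/ndG/leq_maxr.
move=> k; have [mF Fk] := Foo k; have [mG Gk] := Goo k; split.
  rewrite -[X in measurable X]setTI; apply: measurable_uncons => //.
  exact: measurableX.
rewrite (_ : _ @^-1` _ = [set t | F k (thead t) /\ G k [tuple of behead t]])//.
by rewrite leb_stepE// lte_mul_pinfty// ge0_fin_numE.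
Qed.

HB.instance Definition _ := Measure_isSigmaFinite.Build _ _ _ leb_step
  leb_step_sigma_finite.

End step.

Fixpoint borel_leb n : {sigma_finite_measure set (n.-tuple R) -> \bar R} :=
  match n with
  | 0%N => \d_[tuple]
  | m.+1 => leb_step (borel_leb m)
  end.

Lemma measurable_box n (A : 'I_n -> set R) : (forall i, measurable (A i)) ->
  measurable [set t : n.-tuple R | forall i, A i (tnth t i)].
Proof.
move=> mA.
rewrite (_ : [set _ | _] = \bigcap_(i in [set: 'I_n]) ((tnth (T:=R))^~ i @^-1` A i)).
  apply: fin_bigcap_measurable => // i _.
  by rewrite -[X in measurable X]setTI; apply: measurable_tnth.
by apply/seteqP; split => t /= h i; [move=> _|]; exact: h.
Qed.

Lemma borel_leb_box n (a b : 'I_n -> R) : (forall i, a i <= b i)%R ->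
  borel_leb n [set t | forall i, (a i <= tnth t i <= b i)%R] =
  (\prod_(i < n) (b i - a i))%:E.
Proof.
elim: n a b => [|n IH] a b ab.
  rewrite big_ord0 /= diracE mem_set//= => -[]//.
rewrite big_ord_recl EFinM -(IH (a \o lift ord0) (b \o lift ord0))//=.
have -> : (b ord0 - a ord0)%:E = lebesgue_measure `[a ord0, b ord0]%classic.
  rewrite lebesgue_measure_itv/= lte_fin; case: ltgtP (ab ord0) => // -> _.
  by rewrite subrr.
rewrite -leb_stepE //=; last first.
  have mA (i : 'I_n) : measurable `[a (lift ord0 i), b (lift ord0 i)]%classic by [].
  rewrite (_ : [set _ | _] = [set t | forall i : 'I_n,
      `[a (lift ord0 i), b (lift ord0 i)]%classic (tnth t i)]).
    exact: (measurable_box mA).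
  by apply/seteqP; split => t /= h i; have := h i; rewrite in_itv.
congr (_ _); apply/seteqP; split => t /=; rewrite in_itv /=.
  move=> h; split => [|i]; first exact: h ord0.
  by have := h (lift ord0 i); rewrite [in tnth t _](tuple_eta t) tnthS.
move=> [h0 h] i; case: (unliftP ord0 i) => [j|] -> //.
by rewrite (tuple_eta t) tnthS; exact: h.
Qed.

End borel_lebesgue_measure.

(* R^n with the sigma-algebra of its Lebesgue measurable sets. Like the
   library's completed_lebesgue_measure on R, leb is the completion of the
   Borel measure borel_leb, so that measurable_fun on Rn R n is Lebesgue
   measurability. *)
Definition Rn (R : realType) (n : nat) : measurableType _ :=
  caratheodory_type (borel_leb (R := R) n)^*%mu.

Section completed_lebesgue_measure.
Context {R : realType} {n : nat}.

Definition leb : set (Rn R n) -> \bar R :=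
  @completed_measure_extension _ _ _ (borel_leb (R := R) n).

HB.instance Definition _ := Measure.on leb.

Let leb_sigma_finite : sigma_finite setT leb.
Proof.
apply: completed_measure_extension_sigma_finite.
exact: (sigma_finiteT
  (borel_leb n : {sigma_finite_measure set (n.-tuple R) -> \bar R})).
Qed.

HB.instance Definition _ := Measure_isSigmaFinite.Build _ _ _ leb
  leb_sigma_finite.

Lemma leb_borelE (A : set (n.-tuple R)) : measurable A ->
  leb A = borel_leb n A.
Proof. exact: measurable_mu_extE. Qed.

Lemma borel_measurable_Rn (A : set (n.-tuple R)) : measurable A ->
  @measurable _ (Rn R n) A.
Proof. by move=> mA; apply: sub_caratheodory; exact: sub_sigma_algebra. Qed.

End completed_lebesgue_measure.

Section cubes.
Context {R : realType} {n : nat}.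

Definition cube (a : Rn R n) (l : R) : set (Rn R n) :=
  [set x | forall i, (tnth a i <= tnth x i <= tnth a i + l)%R].

Definition is_cube (Q : set (Rn R n)) : Prop :=
  exists a l, (0 < l)%R /\ Q = cube a l.

Lemma borel_measurable_cube (a : Rn R n) (l : R) :
  @measurable _ (n.-tuple R) (cube a l).
Proof.
have mA (i : 'I_n) : measurable `[tnth a i, (tnth a i + l)%R]%classic by [].
rewrite (_ : cube a l = [set t : n.-tuple R | forall i : 'I_n,
    `[tnth a i, (tnth a i + l)%R]%classic (tnth t i)]).
  exact: (measurable_box mA).
by apply/seteqP; split => t /= h i; have := h i; rewrite in_itv.
Qed.

Lemma measurable_cube (a : Rn R n) (l : R) : measurable (cube a l).
Proof. by apply: borel_measurable_Rn; exact: borel_measurable_cube. Qed.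

Lemma leb_cube (a : Rn R n) (l : R) : (0 < l)%R -> leb (cube a l) = (l ^+ n)%:E.
Proof.
move=> l0; rewrite leb_borelE; last exact: borel_measurable_cube.
rewrite (borel_leb_box (a := tnth a) (b := fun i => tnth a i + l)%R); last first.
  by move=> i; rewrite lerDl ltW.
rewrite (eq_bigr (fun=> l)); last by move=> i _; rewrite addrC addKr.
by rewrite prodr_const card_ord.
Qed.

Definition sup_cube (F : set (Rn R n) -> \bar R) : \bar R :=
  ereal_sup [set F Q | Q in is_cube].

Definition avg (Q : set (Rn R n)) (f : Rn R n -> \bar R) : \bar R :=
  (leb Q)^-1 * \int[leb]_(x in Q) f x.

Definition euclidean_dist (x y : Rn R n) : R :=
  Num.sqrt (\sum_(i < n) (tnth x i - tnth y i) ^+ 2)%R.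

End cubes.

Section weights.
Context {R : realType} {n : nat}.
Implicit Types (u sigma w f : Rn R n -> R) (Q : set (Rn R n)).
Implicit Types (alpha p q : R).

Definition conj_exp p : R := (p / (p - 1))%R.

(* Every bounded subset of R^n lies in a cube, so integrability over all cubes
   is local integrability. *)
Definition is_weight w : Prop :=
  [/\ measurable_fun setT w, (forall x, 0 <= w x)%R &
      forall Q, is_cube Q -> \int[leb]_(x in Q) (w x)%:E < +oo].

Definition Apq alpha p q u sigma Q : \bar R :=
  leb Q `^ (alpha / n%:R + q^-1 - p^-1)
    * avg Q (EFin \o u) `^ q^-1
    * avg Q (EFin \o sigma) `^ (conj_exp p)^-1.

Definition Apq_const alpha p q u sigma : \bar R :=
  sup_cube (Apq alpha p q u sigma).

(* lne 0 = -oo; as w is locally integrable, log w has a well-defined integral in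
   [-oo, +oo[, and the exponential is +oo when that integral is -oo. *)
Definition Aexp w Q : \bar R :=
  avg Q (EFin \o w) * expeR (- avg Q (fun x => lne (w x)%:E)).

Definition Aexp_const w : \bar R := sup_cube (Aexp w).

Definition maximal f (x : Rn R n) : \bar R :=
  ereal_sup [set avg Q (fun y => `|f y|%:E) | Q in [set Q | is_cube Q /\ Q x]].

Definition AM_const w : \bar R :=
  sup_cube (fun Q => (\int[leb]_(x in Q) (w x)%:E)^-1
    * \int[leb]_(x in Q) maximal (fun y => w y * \1_Q y)%R x).

(* "Not identically zero" is read up to null sets, as weights are identified
   when they agree almost everywhere. *)
Definition Ainfty w : Prop :=
  ~ {ae leb, forall x, w x = 0%R} /\ Aexp_const w < +oo.

(* The junk value of the quotient at y = x is harmless: [set x] is null, as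
   0 < n in the only case of interest 0 < alpha < n. *)
Definition riesz alpha f (x : Rn R n) : \bar R :=
  \int[leb]_y (f y / euclidean_dist x y `^ (n%:R - alpha))%:E.

Definition Lnorm_weight p w (g : Rn R n -> \bar R) : \bar R :=
  (\int[leb]_x (`|g x| `^ p * (w x)%:E)) `^ p^-1.

(* Positivity of T allows testing on non-negative f only. *)
Definition opnorm p sigma q u (T : (Rn R n -> R) -> Rn R n -> \bar R) : \bar R :=
  ereal_inf [set C | 0 <= C /\
    forall f, measurable_fun setT f -> (forall x, 0 <= f x)%R ->
      Lnorm_weight p sigma (EFin \o f) < +oo ->
      Lnorm_weight q u (T f) <= C * Lnorm_weight p sigma (EFin \o f)].

End weights.

(* Main.v *)
From HB Require Import structures.
Require Import Defs.
From mathcomp Require Import all_boot all_order all_algebra.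
From mathcomp Require Import all_classical all_reals all_analysis.
From mathcomp Require Import measurable_realfun ring lra.
Import Order.TTheory GRing.Theory Num.Theory.
Import numFieldNormedType.Exports.

(** Write theta = 1 - alpha/n. The kernel |x - y|^(alpha - n) is bounded by
    6^(n - alpha) times the sum, over 2^n shifted dyadic grids and all their
    cells Q containing both x and y, of |Q|^(-theta): each coordinate has two
    grids, shifted by a third of a side from each other, and points at
    distance d share a cell of side at most 6d in one combination of them
    ([kernel_cover], [riesz_le]). By monotone convergence it is enough to treat
    finitely many cells of one grid ([pow_series_bound]). Such a family cuts
    space into finitely many atoms, the sets of points lying in exactly the
    same cells; replacing f by its sigma-averages over the atoms can only
    decrease its norm, by Jensen's inequality, so what is left is an inequality
    on a finite laminar family of subsets of a finite set, in which strict
    inclusion at least doubles the mass m ([family_bound], [operator_le]).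

    The finite inequality rests on the cubes where the running maximum (the
    largest value over the cubes above) enters a new dyadic level. Through one
    point they carry distinct powers of two, so every sum over those containing
    a given point is geometric. This gives the Carleson embedding
    ([carleson_embedding]) and the maximal inequality, and it controls the sums
    that the two A_infinity constants are to pay for: over the principal cubes
    S of the density sigma/m inside T,

      sum A(S)^q sigma(S) <= B^q sigma(T),   A(S) = A_{p,q}^alpha(u, sigma, S),

    called [packed] below. For the Fujii-Wilson constant, sum sigma(S) is at
    most a multiple of the integral over T of M(sigma 1_T)
    ([sum_principal_mass]). For the exponential constant, put h = sqrt sigma:
    exp of the mean of log sigma is at most (mean of h)^2 ([avg_lne_le]), so
    A(S)^q sigma(S) <= B^q |S| (mean_S h)^2 with B the first supremum of the
    theorem, and the sum of the right-hand sides is controlled because the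
    principal cubes are sparse ([principal_sparse],
    [sum_principal_mean_sqr]).

    Packing implies Sawyer's testing condition on T ([testing]). The sum of
    |Q|^(-theta) sigma(Q) over the cubes Q containing a point is dominated by
    the principal ones, as theta < 1. The q-th power of that sum is, up to a
    constant, at most a sum of q-th powers, and this uses p < q: principal cubes
    with comparable values of |S|^(-theta) sigma(S) lie in chains, and the S at
    depth k of its chain has sigma(S) <= 2 2^(-theta k) sigma(T), which provides
    a geometric factor in k through the surplus power sigma(S)^(q/p - 1).

    Testing for (u, sigma) and for the dual pair implies the norm inequality
    ([stopping_bound], [form_le]). Dualise with g and split the cubes according
    to which of (mean f)^p sigma(Q) and (mean g)^q' u(Q) is larger. On the
    first half, stop when the mean of f doubles; between P and its stopping
    children, g may be averaged over the children, and Young's inequality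
    balanced by the mean of f on P bounds the contribution of P by the testing
    condition plus the q'-norm of the averaged g. Both sum up by the Carleson
    embedding, since on this half means of g are dominated by means of f. The
    other half is the same statement for the dual pair. *)

Set Implicit Arguments.
Unset Strict Implicit.
Unset Printing Implicit Defensive.
Local Open Scope ring_scope.

(** * Rounding to powers of two, and geometric sums *)

Section dyadic_rounding.
Variable R : realType.
Implicit Types x y : R.

(** The largest power of two that is at most x. *)
Definition dyad x : R :=
  if 0 < x then 2 `^ (Num.floor (ln x / ln 2))%:~R else 0.

Let ln2_gt0 : 0 < ln (2 : R).
Proof. by rewrite ln_gt0// ltr1n. Qed.

Let powR2_log x : 0 < x -> x = 2 `^ (ln x / ln 2).
Proof.
move=> x0; rewrite /powR pnatr_eq0/= -mulrA mulVf ?gt_eqF// mulr1.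
by rewrite lnK// posrE.
Qed.

Lemma dyad_gt0 x : 0 < x -> 0 < dyad x.
Proof. by move=> x0; rewrite /dyad x0 powR_gt0. Qed.

Lemma dyad_ge0 x : 0 <= dyad x.
Proof. by rewrite /dyad; case: ifP => // _; rewrite powR_ge0. Qed.

Lemma dyad_le x : 0 < x -> dyad x <= x.
Proof.
move=> x0; rewrite /dyad x0 [leRHS]powR2_log// ler_powR ?ler1n//.
exact: floor_le_tmp.
Qed.

Lemma dyad_gt x : 0 < x -> x < 2 * dyad x.
Proof.
move=> x0; rewrite /dyad x0.
have -> : 2 * 2 `^ (Num.floor (ln x / ln 2))%:~R =
    2 `^ (Num.floor (ln x / ln 2) + 1)%:~R :> R.
  by rewrite intrD powRD ?pnatr_eq0 ?implybT// powRr1// mulrC.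
rewrite [ltLHS]powR2_log// /powR pnatr_eq0/= ltr_expR ltr_pM2r//.
exact: floorD1_gt.
Qed.

Lemma le_dyad x y : 0 < x -> x <= y -> dyad x <= dyad y.
Proof.
move=> x0 xy; have y0 := lt_le_trans x0 xy; rewrite /dyad x0 y0.
rewrite ler_powR ?ler1n// ler_int le_floor// ler_pM2r ?invr_gt0//.
by rewrite ler_ln ?posrE.
Qed.

Lemma dyad_sep x y : 0 < x -> 0 < y -> dyad x != dyad y ->
  2 * dyad x <= dyad y \/ 2 * dyad y <= dyad x.
Proof.
move=> x0 y0; rewrite /dyad x0 y0.
set k := Num.floor _; set l := Num.floor _ => kl.
have mul2 (i : int) : 2 * 2 `^ i%:~R = 2 `^ (i + 1)%:~R :> R.
  by rewrite intrD powRD ?pnatr_eq0 ?implybT// powRr1// mulrC.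
have {kl} : k != l by apply: contra kl => /eqP ->.
rewrite !mul2 neq_lt => /orP[kl|lk]; [left|right].
  by rewrite ler_powR ?ler1n// ler_int lezD1.
by rewrite ler_powR ?ler1n// ler_int lezD1.
Qed.

End dyadic_rounding.

Section geometric_sums.
Variable R : realType.

(** Removing the largest value halves the admissible bound V for the rest, so
    the sum S(V) satisfies S(V) <= V^s + S(V / 2). *)
Lemma sum_geometric (I : finType) (C : {set I}) (v : I -> R) (s V : R) :
  0 < s ->
  (forall i, i \in C -> 0 < v i <= V) ->
  (forall i j, i \in C -> j \in C -> i != j ->
    2 * v i <= v j \/ 2 * v j <= v i) ->
  \sum_(i in C) v i `^ s <= V `^ s / (1 - 2 `^ (- s)).
Proof.
move=> s0.
have r1 : 2 `^ (- s) < 1 :> R.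
  by rewrite powRN invf_lt1 ?powR_gt0// -[X in X < _](powRr0 2) /powR pnatr_eq0/=
    ltr_expR ltr_pM2r// ln_gt0// ltr1n.
have d0 : 0 < 1 - 2 `^ (- s) :> R by rewrite subr_gt0.
move: {2}#|C| (erefl #|C|) => k; elim: k C V => [|k IH] C V.
  move=> /eqP; rewrite cards_eq0 => /eqP -> _ _.
  by rewrite big_set0 divr_ge0// ?powR_ge0// ltW.
move=> Ck vV sep.
have [i0 i0C] : exists i, i \in C by apply/set0Pn; rewrite -cards_eq0 Ck.
pose i1 := [arg max_(i > i0 in C) v i]%O.
have [i1C i1max] : i1 \in C /\ forall j, j \in C -> v j <= v i1.
  by rewrite /i1; case: arg_maxP => // i iC h.
have /andP[v0 v1] := vV _ i1C; have V0 := lt_le_trans v0 v1.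
rewrite (big_setD1 i1)//=.
have := IH (C :\ i1) (V / 2).
move: (Ck); rewrite (cardsD1 i1) i1C add1n => -[->].
move=> /(_ erefl) IH'.
have {IH'} le2 : \sum_(i in C :\ i1) v i `^ s <= (V / 2) `^ s / (1 - 2 `^ (- s)).
  apply: IH' => [i|i j].
    rewrite in_setD1 => /andP[ii1 iC]; have /andP[vi0 viV] := vV _ iC.
    rewrite vi0/= ler_pdivlMr// mulrC.
    have [h|h] := sep _ _ iC i1C ii1; first exact: le_trans h v1.
    have := i1max _ iC; lra.
  by rewrite !in_setD1 => /andP[_ iC] /andP[_ jC]; exact: sep.
apply: (le_trans (lerD (_ : _ <= V `^ s) le2)).
  by rewrite ge0_ler_powR// ?nnegrE ltW.
have -> : (V / 2) `^ s = V `^ s * 2 `^ (- s).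
  rewrite powRM ?invr_ge0//; last exact: ltW.
  by rewrite -powR_inv1// -powRrM mulN1r.
rewrite le_eqVlt; apply/orP; left; apply/eqP; field.
by rewrite gt_eqF.
Qed.

End geometric_sums.

(** * Principal sets of a laminar family *)

Section laminar_families.
Variables (R : realType) (X : finType).
Implicit Types (Qs : {set {set X}}) (P Q S : {set X}) (phi : {set X} -> R).
Implicit Types (w f : X -> R) (a : X).

Definition laminar Qs := forall P Q, P \in Qs -> Q \in Qs ->
  [|| P \subset Q, Q \subset P | [disjoint P & Q]].

Lemma laminarS Qs Qs' : Qs' \subset Qs -> laminar Qs -> laminar Qs'.
Proof. by move=> /fintype.subsetP h L P Q /h PQ /h QQ; exact: L. Qed.

Lemma laminar_meet Qs a P Q : laminar Qs -> P \in Qs -> Q \in Qs ->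
  a \in P -> a \in Q -> P \subset Q \/ Q \subset P.
Proof.
move=> L PQs QQs aP aQ; have := L _ _ PQs QQs.
case/or3P => [|| /disjointFr /(_ aP)]; [by left|by right|by rewrite aQ].
Qed.

(** The running maximum of phi down the tree, as a function on the tree. At a
    singleton it is the maximal function, whether or not the singleton belongs
    to Qs. *)
Definition sup_above Qs phi Q := \big[Order.max/0]_(P in Qs | Q \subset P) phi P.

(** Stopping cubes without recursion: P is principal when the running maximum
    enters at P a dyadic level that it has not reached at any larger cube. *)
Definition principal Qs phi := [set P in Qs | (0 < sup_above Qs phi P) &&
  [forall S in Qs, (P \proper S) ==>
    (dyad (sup_above Qs phi S) != dyad (sup_above Qs phi P))]].

Lemma sup_above_ge0 Qs phi Q : 0 <= sup_above Qs phi Q.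
Proof. exact: bigmax_ge_id. Qed.

Lemma le_sup_above Qs phi P Q : P \in Qs -> Q \subset P -> phi P <= sup_above Qs phi Q.
Proof. by move=> PQs QP; apply: le_bigmax_cond; rewrite PQs. Qed.

Lemma sup_above_anti Qs phi P Q : P \subset Q -> sup_above Qs phi Q <= sup_above Qs phi P.
Proof.
move=> PQ; apply/bigmax_leP; split=> [|S /andP[SQs QS]]; first exact: sup_above_ge0.
by apply: le_sup_above => //; exact: fintype.subset_trans PQ QS.
Qed.

Lemma sup_above_attained Qs phi Q : 0 < sup_above Qs phi Q ->
  exists P, [/\ P \in Qs, Q \subset P & phi P = sup_above Qs phi Q].
Proof.
move=> h; apply/not_existsP => H.
suff : sup_above Qs phi Q < sup_above Qs phi Q by rewrite ltxx.
rewrite [X in X < _]/sup_above; apply/bigmax_ltP; split=> // P /andP[PQs QP].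
rewrite lt_neqAle le_sup_above// andbT; apply/eqP => E; exact: (H P).
Qed.

Lemma principal_sub Qs phi P : P \in principal Qs phi -> P \in Qs.
Proof. by rewrite inE => /andP[]. Qed.

(** At a principal cube the running maximum is attained by the cube itself: an
    attaining cube strictly above would already have been on that level. *)
Lemma principal_sup_above Qs phi P : P \in principal Qs phi -> sup_above Qs phi P = phi P.
Proof.
rewrite inE => /and3P[PQs P0 /forallP h].
have [S [SQs PS E]] := sup_above_attained P0.
have [PE|PS'] := eqVproper PS; first by rewrite -E PE.
have := h S; rewrite SQs PS'/= => /negP[]; apply/eqP; congr dyad.
apply/eqP; rewrite eq_le (sup_above_anti Qs phi PS)/= -E.
exact: le_sup_above.
Qed.

Lemma principal_gt0 Qs phi P : P \in principal Qs phi -> 0 < phi P.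
Proof.
by move=> PS; rewrite -(principal_sup_above PS); move: PS; rewrite inE => /and3P[].
Qed.

(** The largest cube above Q on the dyadic level of Q. *)
Lemma principal_above Qs phi Q : Q \in Qs -> 0 < sup_above Qs phi Q ->
  exists P, [/\ P \in principal Qs phi, Q \subset P &
    dyad (phi P) = dyad (sup_above Qs phi Q)].
Proof.
move=> QQs Q0.
pose good P := [&& P \in Qs, Q \subset P &
  dyad (sup_above Qs phi P) == dyad (sup_above Qs phi Q)].
have gQ : good Q by rewrite /good QQs subxx eqxx.
pose P := [arg max_(P > Q | good P) #|P|].
have [gP Pmax] : good P /\ forall S, good S -> (#|S| <= #|P|)%N.
  by rewrite /P; case: arg_maxnP.
have /and3P[PQs QP /eqP EP] := gP.
have PP : P \in principal Qs phi.
  rewrite inE PQs/=; apply/andP; split.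
    have : 0 < dyad (sup_above Qs phi P) by rewrite EP dyad_gt0.
    by rewrite /dyad; case: ifP => //; rewrite ltxx.
  apply/forallP => S; apply/implyP => SQs; apply/implyP => PS; apply/eqP => E.
  have := Pmax S; rewrite leqNgt proper_card// => /(_ _)/negP[]//.
  rewrite /good SQs E EP eqxx andbT/=.
  exact: fintype.subset_trans QP (proper_sub PS).
by exists P; rewrite -(principal_sup_above PP).
Qed.

Lemma principal_proper Qs phi P S : P \in principal Qs phi -> S \in Qs -> P \proper S ->
  dyad (sup_above Qs phi S) < dyad (phi P).
Proof.
move=> PP SQs PS; rewrite -(principal_sup_above PP).
move: (PP); rewrite inE => /and3P[PQs P0 /forallP/(_ S)].
rewrite SQs PS/= lt_neqAle => -> /=.
have [S0|S0] := ltP 0 (sup_above Qs phi S); last first.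
  by rewrite {1}/dyad ltNge S0 dyad_ge0.
by apply: le_dyad => //; apply: sup_above_anti; exact: proper_sub.
Qed.

Lemma principal_inj Qs phi a P S : laminar Qs ->
  P \in principal Qs phi -> S \in principal Qs phi -> a \in P -> a \in S ->
  dyad (phi P) = dyad (phi S) -> P = S.
Proof.
move=> L PP SS aP aS E.
wlog PS : P S PP SS aP aS E / P \subset S.
  move=> W; have [h|h] := laminar_meet L (principal_sub PP) (principal_sub SS) aP aS.
    exact: W.
  by apply/esym; exact: W.
have [//|PS'] := eqVproper PS.
have := principal_proper PP (principal_sub SS) PS'.
by rewrite (principal_sup_above SS) E ltxx.
Qed.

Lemma principal_sep Qs phi a P S : laminar Qs ->
  P \in principal Qs phi -> S \in principal Qs phi -> a \in P -> a \in S -> P != S ->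
  2 * dyad (phi P) <= dyad (phi S) \/ 2 * dyad (phi S) <= dyad (phi P).
Proof.
move=> L PP SS aP aS PS; apply: dyad_sep; [exact: principal_gt0 PP|exact: principal_gt0 SS|].
by apply: contra PS => /eqP E; apply/eqP; exact: (principal_inj L PP SS aP aS E).
Qed.

(** The principal cubes through a point are on distinct dyadic levels, so a sum
    of powers of these levels is a geometric series. *)
Lemma sum_principal_dyad Qs phi a (V s : R) : laminar Qs -> 0 < s ->
  \sum_(P in principal Qs phi | (a \in P) && (dyad (phi P) <= V)) dyad (phi P) `^ s
    <= V `^ s / (1 - 2 `^ (- s)).
Proof.
move=> L s0.
rewrite (eq_bigl (fun P => P \in [set P in principal Qs phi |
  (a \in P) && (dyad (phi P) <= V)])); last by move=> P; rewrite !inE.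
apply: sum_geometric => // [P|P S].
  by rewrite inE => /and3P[PP aP ->]; rewrite dyad_gt0// (principal_gt0 PP).
rewrite inE => /and3P[PP aP _]; rewrite inE => /and3P[SS aS _].
exact: principal_sep PP SS aP aS.
Qed.

Definition mass w Q := \sum_(a in Q) w a.

Definition mean w f Q := mass (fun a => f a * w a) Q / mass w Q.

Lemma mass_ge0 w Q : (forall a, 0 <= w a) -> 0 <= mass w Q.
Proof. by move=> w0; apply: sumr_ge0. Qed.

Lemma massS w P Q : (forall a, 0 <= w a) -> P \subset Q -> mass w P <= mass w Q.
Proof.
move=> w0 PQ; rewrite /mass [leRHS](big_setID P)/= (finset.setIidPr PQ) lerDl.
exact: mass_ge0.
Qed.

Lemma mean_ge0 w f Q : (forall a, 0 <= w a) -> (forall a, 0 <= f a) ->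
  0 <= mean w f Q.
Proof. by move=> w0 f0; rewrite divr_ge0 ?mass_ge0// => a; rewrite mulr_ge0. Qed.

(** When w has no mass on Q the mean is a quotient by zero, but then both sides
    vanish. *)
Lemma mean_mass w f Q : (forall a, 0 <= w a) -> (forall a, 0 <= f a) ->
  mean w f Q * mass w Q = mass (fun a => f a * w a) Q.
Proof.
move=> w0 f0; have [E|/eqP N] := eqVneq (mass w Q) 0; last by rewrite divfK//; exact/eqP.
rewrite E mulr0; apply/esym; rewrite /mass big1// => a aQ.
move/eqP: E; rewrite /mass psumr_eq0// => /allP /(_ a (mem_index_enum _)).
by rewrite aQ/= => /eqP ->; rewrite mulr0.
Qed.

(** One factor 2 comes from discarding the part of P where f is small, the
    power of 4 = 2 * 2 from rounding the mean down to a power of two and from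
    f > phi / 2, the denominator from the geometric series. *)
Definition carleson_const (p : R) := 2 * 4 `^ (p - 1) / (1 - 2 `^ (- (p - 1))).

Lemma carleson_const_ge0 (p : R) : 1 < p -> 0 <= carleson_const p.
Proof.
move=> p1; rewrite divr_ge0 ?mulr_ge0 ?powR_ge0// subr_ge0.
by rewrite -[leRHS](powRr0 2) ler_powR ?ler1n// oppr_le0 subr_ge0 ltW.
Qed.

(** At least half of the integral of f over P comes from the points where
    f > (mean of f over P) / 2. Hence at a point a only the P with mean below
    2 f(a) count, and their contributions form a geometric series whose sum is
    a multiple of f(a)^(p-1). *)
Lemma carleson_embedding Qs w f (p : R) : laminar Qs -> 1 < p ->
  (forall a, 0 <= w a) -> (forall a, 0 <= f a) ->
  \sum_(P in principal Qs (mean w f)) mean w f P `^ p * mass w P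
    <= carleson_const p * \sum_a f a `^ p * w a.
Proof.
move=> L p1 w0 f0; set phi := mean w f.
have p0 : 0 < p by apply: lt_trans p1.
have p10 : 0 < p - 1 by rewrite subr_gt0.
have step P : P \in principal Qs phi -> phi P `^ p * mass w P <=
    \sum_(a in P | phi P < 2 * f a)
      (2 * 2 `^ (p - 1) * dyad (phi P) `^ (p - 1)) * (f a * w a).
  move=> PP; have phi0 := principal_gt0 PP.
  have E1 : phi P `^ p * mass w P =
      phi P `^ (p - 1) * mass (fun a => f a * w a) P.
    rewrite -(@mulr_powRB1 _ _ p) ?(ltW phi0)//.
    by rewrite [phi P * _]mulrC -mulrA mean_mass.
  rewrite E1 -big_distrr/=.
  set Z := \sum_(i in P | _) _.
  have h : mass (fun a => f a * w a) P <= 2 * Z.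
    have E : phi P * mass w P = mass (fun a => f a * w a) P by rewrite mean_mass.
    suff : mass (fun a => f a * w a) P <= Z + (phi P / 2) * mass w P.
      by move: E; lra.
    rewrite {1}/mass (bigID (fun a => phi P < 2 * f a))/= lerD2l.
    rewrite [mass w P](bigID (fun a => phi P < 2 * f a))/= mulrDr.
    rewrite ler_wpDl//.
      by rewrite mulr_ge0 ?sumr_ge0// divr_ge0// ltW.
    rewrite big_distrr/= ler_sum// => a /andP[aP]; rewrite -leNgt => fa.
    by rewrite ler_wpM2r// ler_pdivlMr// mulrC.
  rewrite [leRHS](_ : _ = 2 * Z * (2 `^ (p - 1) * dyad (phi P) `^ (p - 1))); last by ring.
  rewrite mulrC.
  rewrite -powRM ?dyad_ge0//.
  rewrite ler_pM ?powR_ge0//; first by apply: mass_ge0 => a; rewrite mulr_ge0.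
  apply: ge0_ler_powR; rewrite ?(ltW p10)// ?nnegrE ?(ltW phi0)//.
    by rewrite mulr_ge0// dyad_ge0.
  by apply/ltW/dyad_gt.
apply: (le_trans (ler_sum _ step)).
rewrite (exchange_big_dep xpredT)//= big_distrr/= ler_sum// => a _.
rewrite -big_distrl/= -big_distrr/=.
have le2 : \sum_(i in principal Qs phi | (a \in i) && (phi i < 2 * f a))
    dyad (phi i) `^ (p - 1) <= (2 * f a) `^ (p - 1) / (1 - 2 `^ (- (p - 1))).
  apply: le_trans (sum_principal_dyad phi a (2 * f a) L p10).
  rewrite [leLHS]big_mkcond [leRHS]big_mkcond/= ler_sum// => P _.
  case: ifP => [/and3P[PP aP h]|_].
    by rewrite PP aP (le_trans (dyad_le _) (ltW h))// (principal_gt0 PP).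
  by case: ifP => // _; rewrite powR_ge0.
rewrite -(@mulr_powRB1 _ _ p)// mulrA mulrA.
rewrite ler_wpM2r//.
rewrite (le_trans (ler_wpM2r (f0 a) (ler_wpM2l _ le2)))//.
rewrite /carleson_const powRM// (_ : 4 = 2 * 2 :> R); last by ring.
rewrite powRM// le_eqVlt; apply/orP; left; apply/eqP.
by rewrite !mulrA; ring.
Qed.

End laminar_families.

(** * Maximal functions and packing on a finite tree *)

Section maximal_functions.
Variables (R : realType) (X : finType).
Implicit Types (Qs : {set {set X}}) (P Q S : {set X}).
Implicit Types (w f h m s : X -> R).

(** The maximal function at a is at most twice the mean over one of the principal
    cubes containing a, so the Carleson embedding bounds its p-norm. *)
Lemma maximal_inequality Qs w f (p : R) : laminar Qs -> 1 < p ->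
  (forall a, 0 <= w a) -> (forall a, 0 <= f a) ->
  \sum_a sup_above Qs (mean w f) [set a] `^ p * w a
    <= 2 `^ p * carleson_const p * \sum_a f a `^ p * w a.
Proof.
move=> L p1 w0 f0; set phi := mean w f.
have p0 : 0 < p by apply: lt_trans p1.
rewrite -mulrA (le_trans _ (ler_wpM2l _ (carleson_embedding L p1 w0 f0))) ?powR_ge0//.
rewrite big_distrr/=.
under [leRHS]eq_bigr => P _ do rewrite /mass !big_distrr/=.
rewrite (exchange_big_dep xpredT)//= ler_sum// => a _.
have [r0|r0] := ltP 0 (sup_above Qs phi [set a]); last first.
  have -> : sup_above Qs phi [set a] = 0 by apply/eqP; rewrite eq_le r0 sup_above_ge0.
  rewrite powR0 ?gt_eqF// mul0r sumr_ge0// => P _.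
  by rewrite !mulr_ge0 ?powR_ge0.
have [Q [QQs aQ EQ]] := sup_above_attained r0.
have EQ' : sup_above Qs phi Q = sup_above Qs phi [set a].
  by apply/eqP; rewrite eq_le (sup_above_anti Qs phi aQ)/= -EQ le_sup_above.
have [|P [PP QP EP]] := @principal_above _ _ Qs phi Q QQs; first by rewrite EQ'.
have aP : a \in P by rewrite -finset.sub1set (fintype.subset_trans aQ QP).
rewrite (bigD1 P)/= ?PP//.
rewrite ler_wpDr//.
  by rewrite sumr_ge0// => S _; rewrite !mulr_ge0 ?powR_ge0.
rewrite mulrA ler_wpM2r//.
have phi0 := principal_gt0 PP.
rewrite -powRM// ?(ltW phi0)//.
apply: ge0_ler_powR; rewrite ?nnegrE ?sup_above_ge0 ?(ltW p0)//.
  by rewrite mulr_ge0// ltW.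
rewrite (le_trans (ltW (dyad_gt r0)))// ler_pM2l// -EQ' -EP.
exact: dyad_le.
Qed.

(** The maximal members of Qs are disjoint and cover the same set. *)
Lemma weak_type Qs m s (l : R) : laminar Qs ->
  (forall Q, Q \in Qs -> l * mass m Q <= mass s Q) ->
  l * mass m (finset.cover Qs) <= mass s (finset.cover Qs).
Proof.
move=> L H.
pose Ms := [set Q in Qs | [forall S in Qs, (Q \subset S) ==> (S == Q)]].
have MsQs Q : Q \in Ms -> Q \in Qs by rewrite inE => /andP[].
have Mmax P Q : P \in Ms -> Q \in Qs -> P \subset Q -> Q = P.
  by rewrite inE => /andP[_ /forallP/(_ Q)] /implyP h /h /implyP h' /h' /eqP.
have covE : finset.cover Qs = finset.cover Ms.
  apply/finset.setP => a; apply/finset.bigcupP/finset.bigcupP => -[Q QQs aQ]; last first.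
    by exists Q => //; exact: MsQs.
  pose g S := (S \in Qs) && (Q \subset S).
  have gQ : g Q by rewrite /g QQs subxx.
  pose P := [arg max_(S > Q | g S) #|S|].
  have [/andP[PQs QP] Pm] : g P /\ forall S, g S -> (#|S| <= #|P|)%N.
    by rewrite /P; case: arg_maxnP.
  exists P; last exact: (fintype.subsetP QP).
  rewrite inE PQs/=; apply/forallP => S; apply/implyP => SQs; apply/implyP => PS.
  rewrite eq_sym eqEcard PS/=; apply: Pm.
  by rewrite /g SQs (fintype.subset_trans QP PS).
have tM : finset.trivIset Ms.
  apply/finset.trivIsetP => P Q PM QM PQ.
  have := L _ _ (MsQs _ PM) (MsQs _ QM).
  case/or3P => // h; exfalso; move/eqP: PQ; apply.
    by apply/esym; exact: Mmax (MsQs _ QM) h.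
  exact: Mmax (MsQs _ PM) h.
rewrite covE /mass !finset.big_trivIset//= big_distrr/= ler_sum// => Q /MsQs /H.
by [].
Qed.

Definition density m s Q := mass s Q / mass m Q.

Lemma density_mass m s Q : 0 < mass m Q -> density m s Q * mass m Q = mass s Q.
Proof. by move=> ?; rewrite /density divfK// gt_eqF. Qed.

Lemma sum_principal_dyad1 Qs (phi : {set X} -> R) (a : X) : laminar Qs ->
  \sum_(S in principal Qs phi | a \in S) dyad (phi S) <= 2 * sup_above Qs phi [set a].
Proof.
move=> L; have := @sum_principal_dyad _ _ Qs phi a (sup_above Qs phi [set a]) 1 L ltr01.
rewrite powRN !powRr1 ?sup_above_ge0//.
have -> : sup_above Qs phi [set a] / (1 - 2^-1) = 2 * sup_above Qs phi [set a].
  by rewrite (_ : 1 - 2^-1 = 2^-1); [rewrite invrK mulrC|lra].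
apply: le_trans; rewrite [leLHS]big_mkcond [leRHS]big_mkcond/= ler_sum// => S _.
case: ifP => [/andP[SP aS]|_]; last by case: ifP => // _; rewrite powR_ge0.
rewrite SP aS/= powRr1 ?dyad_ge0//.
rewrite (le_trans (dyad_le (principal_gt0 SP)))// le_sup_above ?(principal_sub SP)//.
by rewrite finset.sub1set.
Qed.

(** sigma(S) is about dyad(density S) m(S), and at a fixed point the sum of the
    dyadic densities of the principal cubes is geometric, hence comparable to
    its largest term: the sum of the sigma(S) is at most a multiple of the
    integral of the maximal function. *)
Lemma sum_principal_mass Qs m s : laminar Qs -> (forall a, 0 <= m a) ->
  (forall Q, Q \in Qs -> 0 < mass m Q) ->
  \sum_(S in principal Qs (density m s)) mass s S
    <= 4 * \sum_a sup_above Qs (density m s) [set a] * m a.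
Proof.
move=> L m0 mQ.
have h S : S \in principal Qs (density m s) ->
    mass s S <= \sum_(a in S) 2 * dyad (density m s S) * m a.
  move=> SP; rewrite -big_distrr/= -(density_mass s (mQ _ (principal_sub SP))).
  rewrite ler_wpM2r ?mass_ge0//.
  by apply/ltW/dyad_gt; exact: principal_gt0 SP.
rewrite (le_trans (ler_sum _ h))// (exchange_big_dep xpredT)//= big_distrr/=.
rewrite ler_sum// => a _; rewrite -big_distrl/= -big_distrr/= mulrA ler_wpM2r//.
by have := sum_principal_dyad1 (density m s) a L; lra.
Qed.

(** The cubes inside S whose density is at least 4 dyad(density S) cover, by
    the weak type inequality, at most half of S. *)
Lemma principal_sparse Qs m s S : laminar Qs -> (forall a, 0 <= m a) ->
  (forall a, 0 <= s a) -> (forall Q, Q \in Qs -> 0 < mass m Q) ->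
  S \in principal Qs (density m s) ->
  mass m S <= 2 * mass m [set a in S | sup_above Qs (density m s) [set a]
                                        < 4 * dyad (density m s S)].
Proof.
move=> L m0 s0 mQ SP; set v := dyad _; set E := [set a in S | _].
have v0 : 0 < v by rewrite dyad_gt0// (principal_gt0 SP).
have SQs := principal_sub SP.
pose Cs := [set Q in Qs | (Q \subset S) && (4 * v <= density m s Q)].
have CQ : Cs \subset Qs by apply/fintype.subsetP => Q; rewrite inE => /andP[].
have CS : finset.cover Cs \subset S.
  by apply/finset.bigcupsP => Q; rewrite inE => /and3P[].
have SE : S \subset E :|: finset.cover Cs.
  apply/fintype.subsetP => a aS; rewrite !inE aS/=.
  have [//|h] := ltP; apply/finset.bigcupP.
  have r0 : 0 < sup_above Qs (density m s) [set a].
    by apply: lt_le_trans h; rewrite mulr_gt0.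
  have [Q [QQs aQ EQ]] := sup_above_attained r0.
  rewrite finset.sub1set in aQ; exists Q => //; rewrite inE QQs EQ h andbT/=.
  have [//|SQ] := laminar_meet L QQs SQs aQ aS.
  have : sup_above Qs (density m s) S < 2 * v.
    by rewrite (principal_sup_above SP); exact/dyad_gt/(principal_gt0 SP).
  have := le_sup_above (density m s) QQs SQ; rewrite EQ; lra.
have weak : 4 * v * mass m (finset.cover Cs) <= mass s (finset.cover Cs).
  apply: weak_type; first exact: laminarS CQ L.
  move=> Q; rewrite inE => /and3P[QQs _ h].
  by rewrite -(density_mass s (mQ _ QQs)) ler_wpM2r// mass_ge0.
have sS : mass s (finset.cover Cs) <= 2 * v * mass m S.
  rewrite (le_trans (massS s0 CS))// -(density_mass s (mQ _ SQs)).
  by rewrite ler_wpM2r ?mass_ge0//; apply/ltW/dyad_gt/(principal_gt0 SP).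
have half : 2 * mass m (finset.cover Cs) <= mass m S.
  by have := le_trans weak sS; rewrite -(ler_pM2l v0); nra.
have : mass m S <= mass m E + mass m (finset.cover Cs).
  rewrite (le_trans (massS m0 SE))// /mass -[leRHS]addr0.
  rewrite [leLHS](big_setID E)/= addr0 finset.setIUl finset.setIid.
  rewrite (_ : E :|: _ = E) ?lerD2l; last first.
    by apply/finset.setUidPl; exact: finset.subsetIr.
  apply: massS => //; apply/fintype.subsetP => a; rewrite !inE => /andP[/negPf h].
  by rewrite h.
lra.
Qed.

Definition sparse_const : R := 16 * (2 `^ 2 * carleson_const 2).

Lemma sparse_const_ge0 : 0 <= sparse_const.
Proof.
apply: mulr_ge0 => //; apply: mulr_ge0; first exact: powR_ge0.
by apply: carleson_const_ge0; rewrite ltr1n.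
Qed.

(** On at least half of S the maximal density r is below 4v, where v is the
    dyadic density of S; so m(S) is at most a multiple of the sum over a in S
    of (v / r(a)) m(a), and the mean of h over S is at most its maximal
    function. Summing v over the principal S containing a gives at most 2 r(a),
    which leaves the square norm of the maximal function of h, and this is
    bounded by that of h. *)
Lemma sum_principal_mean_sqr Qs m s h (T : {set X}) : laminar Qs ->
  (forall a, 0 <= m a) -> (forall a, 0 <= s a) -> (forall a, 0 <= h a) ->
  (forall Q, Q \in Qs -> 0 < mass m Q) ->
  (forall Q, Q \in Qs -> Q \subset T) ->
  (forall a, h a `^ 2 * m a <= s a) ->
  \sum_(S in principal Qs (density m s)) mass m S * mean m h S `^ 2
    <= sparse_const * mass s T.
Proof.
move=> L m0 s0 h0 mQ QT hs.
(* Localising h to T makes the global norm in the maximal inequality at most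
   the mass of s on T. *)
pose h1 a := if a \in T then h a else 0.
have h10 a : 0 <= h1 a by rewrite /h1; case: ifP.
have mh1 S : S \in principal Qs (density m s) -> mean m h1 S = mean m h S.
  move=> /principal_sub /QT /fintype.subsetP ST.
  rewrite /mean /mass; congr (_ / _); apply: eq_bigr => a /ST aT.
  by rewrite /h1 aT.
have fin : \sum_a h1 a `^ 2 * m a <= mass s T.
  rewrite /mass [leRHS]big_mkcond/= ler_sum// => a _; rewrite /h1.
  by case: ifP => // _; rewrite powR0 ?mul0r// pnatr_eq0.
have C0 : 0 <= 2 `^ 2 * carleson_const 2 :> R.
  apply: mulr_ge0; first exact: powR_ge0.
  by apply: carleson_const_ge0; rewrite ltr1n.
rewrite /sparse_const -mulrA.
apply: (le_trans _ (ler_wpM2l _ (ler_wpM2l C0 fin))) => //.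
apply: (le_trans _ (ler_wpM2l _ (maximal_inequality L _ m0 h10))) => //;
  last by rewrite ltr1n.
rewrite big_distrr/=.
set r := fun a => sup_above Qs (density m s) [set a].
have step S : S \in principal Qs (density m s) -> mass m S * mean m h S `^ 2 <=
    \sum_(a in S) 8 * dyad (density m s S) * ((r a)^-1 *
      (sup_above Qs (mean m h1) [set a] `^ 2 * m a)).
  move=> SP; rewrite -(mh1 _ SP).
  rewrite (le_trans (ler_wpM2r _ (principal_sparse L m0 s0 mQ SP))) ?powR_ge0//.
  rewrite -/(r _) mulrAC /mass big_distrr/=.
  rewrite (eq_bigl (fun a => (a \in S) && (r a < 4 * dyad (density m s S)))); last first.
    by move=> a; rewrite inE.
  rewrite [leRHS](bigID (fun a => r a < 4 * dyad (density m s S)))/=.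
  have r0 a : a \in S -> 0 < r a.
    move=> aS; apply: (lt_le_trans (principal_gt0 SP)).
    by apply: le_sup_above; [exact: principal_sub SP|rewrite finset.sub1set].
  rewrite ler_wpDr//.
    apply: sumr_ge0 => a /andP[aS _]; rewrite !mulr_ge0 ?dyad_ge0// ?powR_ge0//.
    by rewrite invr_ge0 ltW// r0.
  apply: ler_sum => a /andP[aS ra]; rewrite !mulrA ler_wpM2r//.
  apply: ler_pM; rewrite ?mulr_ge0 ?powR_ge0//.
    by rewrite ler_pdivlMr ?r0//; lra.
  apply: ge0_ler_powR => //; rewrite ?nnegrE ?sup_above_ge0 ?mean_ge0//.
  by apply: le_sup_above; [exact: principal_sub SP|rewrite finset.sub1set].
rewrite (le_trans (ler_sum _ step))// (exchange_big_dep xpredT)//= ler_sum// => a _.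
rewrite -big_distrl/= -big_distrr/= mulrA ler_wpM2r ?mulr_ge0 ?powR_ge0//.
have := sum_principal_dyad1 (density m s) a L; rewrite -/(r a).
have : 0 <= r a by exact: sup_above_ge0.
rewrite le_eqVlt => /orP[/eqP <-|r0 ra]; first by rewrite invr0 !mulr0 ler0n.
rewrite ler_pdivrMr//; lra.
Qed.

End maximal_functions.

(** * From packing to testing *)

Lemma sum_expr_le (R : realType) (r : R) (N : nat) : 0 <= r -> r < 1 ->
  \sum_(j < N) r ^+ j <= (1 - r)^-1.
Proof.
move=> r0 r1; have d0 : 0 < 1 - r by rewrite subr_gt0.
rewrite -[leRHS]mul1r ler_pdivlMr// mulrC.
have -> : (1 - r) * (\sum_(j < N) r ^+ j) = 1 - r ^+ N.
  by have := subrX1 r N; lra.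
by rewrite lerBlDr lerDl exprn_ge0.
Qed.

Section testing.
Variables (R : realType) (X : finType).
Variables (m u s : X -> R) (Qs : {set {set X}}) (theta p q : R).
Hypotheses (m0 : forall a, 0 <= m a) (u0 : forall a, 0 <= u a)
  (s0 : forall a, 0 <= s a).
Hypotheses (lam : laminar Qs) (mQ : forall Q, Q \in Qs -> 0 < mass m Q).
Hypothesis m2 : forall P Q, P \in Qs -> Q \in Qs -> P \proper Q ->
  2 * mass m P <= mass m Q.
Hypotheses (theta0 : 0 < theta) (theta1 : theta < 1) (p1 : 1 < p) (pq : p < q).
Implicit Types (P Q S T : {set X}).

Let p0 : 0 < p. Proof. exact: lt_trans p1. Qed.
Let q0 : 0 < q. Proof. exact: lt_trans pq. Qed.

Definition below T := [set Q in Qs | Q \subset T].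

(** The fractional average |S|^(-theta) sigma(S): with theta = 1 - alpha/n this
    is the size of I_alpha(sigma 1_S) on S. *)
Definition frac_avg S := mass m S `^ (- theta) * mass s S.

(** The powers of |S| hidden in the averages of A_{p,q}^alpha collect to
    |S|^(-theta), so only the total masses of u and s remain. *)
Definition tree_Apq S :=
  mass m S `^ (- theta) * mass u S `^ q^-1 * mass s S `^ (1 - p^-1).

Lemma below_sub T : below T \subset Qs.
Proof. by apply/fintype.subsetP => Q; rewrite inE => /andP[]. Qed.

Lemma lam_below T : laminar (below T).
Proof. exact: laminarS (below_sub T) lam. Qed.

Lemma mass_sep a P Q : P \in Qs -> Q \in Qs -> a \in P -> a \in Q -> P != Q ->
  2 * mass m P <= mass m Q \/ 2 * mass m Q <= mass m P.
Proof.
move=> PQs QQs aP aQ PQ.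
have [h|h] := laminar_meet lam PQs QQs aP aQ; [left|right]; apply: m2 => //.
  by rewrite finset.properEneq PQ.
by rewrite finset.properEneq eq_sym PQ.
Qed.

Variable T : {set X}.
Hypothesis TQs : T \in Qs.

Let Ss := principal (below T) (density m s).

Let SsQs S : S \in Ss -> S \in Qs.
Proof. by move=> /principal_sub; rewrite inE => /andP[]. Qed.

Let SsT S : S \in Ss -> S \subset T.
Proof. by move=> /principal_sub; rewrite inE => /andP[]. Qed.

Let frac_gt0 S : S \in Ss -> 0 < frac_avg S.
Proof.
move=> SP; have mS := mQ (SsQs SP).
rewrite /frac_avg mulr_gt0 ?powR_gt0// -(density_mass s mS) mulr_gt0//.
exact: principal_gt0 SP.
Qed.

Let fracE S : 0 < mass m S -> frac_avg S = density m s S * mass m S `^ (1 - theta).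
Proof.
move=> mS; rewrite /frac_avg -{1}(density_mass s mS) addrC.
rewrite (@powRD _ (mass m S) (- theta) 1); last by rewrite (gt_eqF mS) implybT.
by rewrite powRr1 ?(ltW mS)//; ring.
Qed.

Definition principal_const := 2 / (1 - 2 `^ (- (1 - theta))).

(** Charge Q to the principal cube S above it on the same dyadic level of density.
    Then frac_avg Q is at most 2 density(S) m(Q)^(1 - theta), and since
    1 - theta > 0 and masses double, these decay geometrically below S. *)
Lemma sum_below_le_principal a :
  \sum_(Q in below T | a \in Q) frac_avg Q <=
  principal_const * \sum_(S in Ss | a \in S) frac_avg S.
Proof.
have t1 : 0 < 1 - theta by rewrite subr_gt0.
have step Q : (Q \in below T) && (a \in Q) -> frac_avg Q <=
    \sum_(S in Ss | (a \in S) && (Q \subset S))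
       2 * density m s S * mass m Q `^ (1 - theta).
  move=> /andP[QT aQ]; have QQs := fintype.subsetP (below_sub T) _ QT.
  have mQ0 := mQ QQs; rewrite fracE//.
  have [d0|d0] := ltP 0 (density m s Q); last first.
    rewrite (@le_trans _ _ 0)//.
      by rewrite mulr_le0_ge0// powR_ge0.
    apply: sumr_ge0 => S /andP[SP _]; rewrite mulr_ge0 ?powR_ge0//.
    by rewrite mulr_ge0// ltW// (principal_gt0 SP).
  have r0 := lt_le_trans d0 (le_sup_above (density m s) QT (subxx Q)).
  have [S [SP QS ES]] := principal_above QT r0.
  rewrite (bigD1 S)/=; last by rewrite SP QS (fintype.subsetP QS).
  rewrite ler_wpDr//.
    apply: sumr_ge0 => S' /andP[/andP[SP' _] _].
    by rewrite mulr_ge0 ?powR_ge0// mulr_ge0// ltW// (principal_gt0 SP').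
  rewrite ler_wpM2r ?powR_ge0//.
  rewrite (le_trans (le_sup_above (density m s) QT (subxx Q)))//.
  rewrite (le_trans (ltW (dyad_gt r0)))// -ES ler_pM2l//.
  exact: dyad_le (principal_gt0 SP).
rewrite (le_trans (ler_sum _ step))//.
rewrite (exchange_big_dep (fun S => (S \in Ss) && (a \in S)))/=; last first.
  by move=> Q S _ /and3P[-> ->].
rewrite big_distrr/= ler_sum// => S /andP[SP aS].
rewrite -big_distrr/= fracE; last exact/mQ/SsQs.
rewrite [leRHS](_ : _ = 2 * density m s S *
  (mass m S `^ (1 - theta) / (1 - 2 `^ (- (1 - theta))))); last first.
  by rewrite /principal_const; ring.
rewrite ler_pM2l; last by rewrite pmulr_rgt0 // (principal_gt0 SP).
rewrite (eq_bigl (fun Q => Q \in [set Q in below T | (a \in Q) && (Q \subset S)])).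
  apply: sum_geometric => // [Q|Q Q'].
    rewrite !inE => /and3P[/andP[QQs _] aQ QS].
    by rewrite mQ//= massS.
  rewrite !inE => /and3P[/andP[QQs _] aQ QS] /and3P[/andP[QQs' _] aQ' QS'].
  exact: mass_sep aQ aQ'.
move=> Q; rewrite SP aS !inE.
by case: (Q \in Qs); case: (Q \subset T); case: (a \in Q); case: (Q \subset S).
Qed.

(** Principal cubes through one point can share the dyadic value of their
    fractional average; [depth] counts how many such cubes lie above S and
    restores uniqueness, see [depth_lt]. *)
Let anc S := [set P in Ss | (S \proper P) && (dyad (frac_avg P) == dyad (frac_avg S))].

Let depth S := #|anc S|.

(** Cubes above S form a chain, along which m doubles at each step. *)
Lemma chain_mass S (C : {set {set X}}) : S \in Qs -> S != finset.set0 ->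
  (forall P, P \in C -> P \in Qs /\ S \proper P) ->
  exists P, P \in S |: C /\ 2 ^+ #|C| * mass m S <= mass m P.
Proof.
move=> SQs /finset.set0Pn[a aS].
move: {2}#|C| (erefl #|C|) => k; elim: k C => [|k IH] C Ck CS.
  by exists S; rewrite finset.setU11 Ck expr0 mul1r.
have [P0 P0C] : exists P, P \in C.
  by apply/finset.set0Pn; rewrite -cards_eq0 Ck.
pose P := [arg max_(P > P0 in C) #|P|].
have [PC Pm] : P \in C /\ forall Q, Q \in C -> (#|Q| <= #|P|)%N.
  by rewrite /P; case: arg_maxnP.
have [PQs SP] := CS _ PC.
have aP : a \in P by rewrite (fintype.subsetP (proper_sub SP)).
have Ck' : #|C :\ P| = k by move: Ck; rewrite (cardsD1 P) PC add1n => -[].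
have [|Q [QC hQ]] := IH _ Ck'.
  by move=> Q; rewrite in_setD1 => /andP[_]; exact: CS.
exists P; split; first by rewrite !inE PC orbT.
have QP : Q \proper P.
  move: QC; rewrite !inE => /orP[/eqP ->//|/andP[QP QC]].
  have [QQs SQ] := CS _ QC.
  have aQ : a \in Q by rewrite (fintype.subsetP (proper_sub SQ)).
  rewrite finset.properEneq QP/=.
  have [//|PQ] := laminar_meet lam QQs PQs aQ aP.
  by move: QP; rewrite eq_sym eqEcard PQ Pm.
have QQs : Q \in Qs.
  by move: QC; rewrite !inE => /orP[/eqP ->//|/andP[_ /CS[]]].
rewrite Ck exprS -mulrA (le_trans _ (m2 QQs PQs QP))// ler_pM2l//.
by rewrite -Ck'.
Qed.

Let nonempty S : S \in Ss -> S != finset.set0.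
Proof.
move=> /SsQs /mQ; apply: contraTN => /eqP ->.
by rewrite /mass big_set0 ltxx.
Qed.

Let depth_lt a P S : P \in Ss -> S \in Ss -> a \in P -> a \in S -> P != S ->
  dyad (frac_avg P) = dyad (frac_avg S) -> depth P != depth S.
Proof.
wlog PS : P S / P \subset S.
  move=> W PP SS aP aS PS E.
  have [h|h] := laminar_meet lam (SsQs PP) (SsQs SS) aP aS; first exact: W.
  by rewrite eq_sym; apply: W => //; rewrite eq_sym.
move=> PP SS aP aS PS' E.
rewrite gtn_eqF//; apply: proper_card; apply/properP.
have PpS : P \proper S by rewrite finset.properEneq PS'.
split; last first.
  exists S; first by rewrite inE SS PpS E eqxx.
  by rewrite inE fintype.properxx andbF.
apply/fintype.subsetP => Q; rewrite !inE => /and3P[-> SQ /eqP ->].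
by rewrite E eqxx (fintype.proper_trans PpS SQ).
Qed.

(** The exponential rate gained at depth k: the loss 2^(-theta k) in sigma(S)
    enters with the surplus exponent q/p - 1. *)
Let eta := theta * (q / p - 1).

Let eps_gt0 : 0 < q / p - 1.
Proof. by rewrite subr_gt0 ltr_pdivlMr// mul1r. Qed.

Let eta_gt0 : 0 < eta. Proof. exact: mulr_gt0. Qed.

Let ratio := 2 `^ (- (eta / q)) : R.

Let ratio_lt1 : ratio < 1.
Proof.
rewrite /ratio /powR pnatr_eq0/= -[ltRHS]expR0 ltr_expR mulNr oppr_lt0.
by rewrite mulr_gt0 ?divr_gt0// ln_gt0// ltr1n.
Qed.

Definition depth_const := 4 / (1 - 2 `^ (- (theta * (q / p - 1) / q))) : R.

(** Let V^q be the weighted sum on the right. Each of its terms alone gives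
    frac_avg S <= V ratio^(depth S). For a fixed depth the dyadic values are
    distinct, so their sum is at most a multiple of the largest one; the sum
    over depths is then geometric, with ratio < 1 because p < q. *)
Lemma sum_principal_le_depth a :
  (\sum_(S in Ss | a \in S) frac_avg S) `^ q <=
  depth_const `^ q *
    \sum_(S in Ss | a \in S) 2 `^ (eta * (depth S)%:R) * frac_avg S `^ q.
Proof.
set W := \sum_(S in Ss | _) 2 `^ _ * _.
have ratio0 : 0 < ratio by exact: powR_gt0.
have W0 : 0 <= W by apply: sumr_ge0 => S _; rewrite mulr_ge0 ?powR_ge0.
have c0 : 0 <= depth_const by rewrite divr_ge0// subr_ge0 ltW.
have f0 : 0 <= \sum_(S in Ss | a \in S) frac_avg S.
  by apply: sumr_ge0 => S /andP[SP _]; exact/ltW/frac_gt0.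
have -> : W = (W `^ q^-1) `^ q by rewrite -powRrM mulVf ?gt_eqF// powRr1.
rewrite -powRM ?powR_ge0//.
apply: ge0_ler_powR; rewrite ?nnegrE ?(ltW q0)//.
  exact: mulr_ge0 c0 (powR_ge0 _ _).
set V := W `^ q^-1; have V0 : 0 <= V by rewrite powR_ge0.
have dV S : S \in Ss -> a \in S -> dyad (frac_avg S) <= V * ratio ^+ depth S.
  move=> SP aS; rewrite (le_trans (dyad_le (frac_gt0 SP)))//.
  have h : 2 `^ (eta * (depth S)%:R) * frac_avg S `^ q <= W.
    rewrite /W (bigD1 S)/= ?SP// lerDl sumr_ge0// => P _.
    by rewrite mulr_ge0 ?powR_ge0.
  have e1 : ratio ^+ depth S = (2 `^ (eta * (depth S)%:R) `^ q^-1)^-1.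
    rewrite -powR_mulrn ?(ltW ratio0)// /ratio -powRrM -powRN -powRrM.
    by congr (_ `^ _); field; rewrite gt_eqF.
  rewrite e1 ler_pdivlMr ?powR_gt0// mulrC.
  have -> : frac_avg S = (frac_avg S `^ q) `^ q^-1.
    by rewrite -powRrM mulfV ?gt_eqF// powRr1// ltW// frac_gt0.
  rewrite -powRM ?powR_ge0//; apply: ge0_ler_powR => //.
    by rewrite invr_ge0 ltW.
  by rewrite nnegrE mulr_ge0 ?powR_ge0.
have leD S : (depth S < #|Ss|.+1)%N.
  by rewrite ltnS subset_leq_card//; apply/fintype.subsetP => P; rewrite inE => /andP[].
rewrite (partition_big (fun S => Ordinal (leD S)) xpredT)//=.
have le_j (j : 'I_(#|Ss|.+1)) :
    \sum_(S in Ss | (a \in S) && (Ordinal (leD S) == j)) frac_avg S <=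
    4 * V * ratio ^+ j.
  have vE : (V * ratio ^+ j) `^ 1 / (1 - 2 `^ (-1)) = 2 * (V * ratio ^+ j).
    rewrite powRN !powRr1 ?mulr_ge0 ?exprn_ge0 ?(ltW ratio0)//.
    by rewrite (_ : 1 - 2^-1 = 2^-1); [rewrite invrK mulrC|lra].
  have H : \sum_(S in [set S in Ss | (a \in S) && (Ordinal (leD S) == j)])
      dyad (frac_avg S) `^ 1 <= 2 * (V * ratio ^+ j).
    rewrite -vE; apply: sum_geometric => // [S|S P].
      rewrite inE => /and3P[SP aS /eqP/(congr1 val)/= <-].
      by rewrite dyad_gt0 ?frac_gt0//= dV.
    rewrite inE => /and3P[SP aS /eqP/(congr1 val)/= E1].
    rewrite inE => /and3P[PP aP /eqP/(congr1 val)/= E2] SnP.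
    apply: dyad_sep; rewrite ?frac_gt0//; apply/eqP => E.
    by have := depth_lt SP PP aS aP SnP E; rewrite E1 E2 eqxx.
  rewrite (@le_trans _ _ (2 * (2 * (V * ratio ^+ j))))//; last first.
    by rewrite !mulrA -natrM.
  rewrite (le_trans _ (ler_wpM2l _ H))// big_distrr/=.
  rewrite (eq_bigl (fun S => S \in [set S in Ss | (a \in S) && (Ordinal (leD S) == j)])).
    apply: ler_sum => S; rewrite inE => /and3P[SP _ _].
    by rewrite powRr1 ?dyad_ge0//; apply/ltW/dyad_gt/frac_gt0.
  by move=> S; rewrite [RHS]inE.
under eq_bigr => j _.
  under eq_bigl => S do rewrite -andbA.
  over.
rewrite (le_trans (ler_sum _ (fun j _ => le_j j)))//.
rewrite -big_distrr/= (le_trans (ler_wpM2l _ (sum_expr_le _ (ltW ratio0) ratio_lt1)))//.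
  by rewrite mulr_ge0.
by rewrite /depth_const -/eta -/ratio mulrAC.
Qed.

(** Let P be the top of the chain of S. Both have the same dyadic fractional
    average, whereas m(P) >= 2^depth m(S); since
    sigma(S) = frac_avg(S) m(S)^theta, the factor 2^(-theta depth) appears. *)
Lemma depth_mass S : S \in Ss ->
  mass s S <= 2 * 2 `^ (- (theta * (depth S)%:R)) * mass s T.
Proof.
move=> SP; have SQs := SsQs SP.
have [P|P [PA hP]] := @chain_mass S (anc S) SQs (nonempty SP).
  by rewrite inE => /and3P[/SsQs PQs SP' _].
have [PP EP] : P \in Ss /\ dyad (frac_avg P) = dyad (frac_avg S).
  by case/finset.setU1P: PA => [->//|]; rewrite inE => /and3P[? _ /eqP].
have mS := mQ SQs; have mP := mQ (SsQs PP).
have fr Q : Q \in Ss -> mass s Q = frac_avg Q * mass m Q `^ theta.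
  move=> QP; have mQ0 := mQ (SsQs QP).
  rewrite /frac_avg powRN mulrAC mulVf ?mul1r// gt_eqF//.
  exact: powR_gt0.
have step : 2 `^ (theta * (depth S)%:R) * mass m S `^ theta <= mass m P `^ theta.
  rewrite mulrC mulrC [theta * _]mulrC powRrM -powRM ?powR_ge0 ?(ltW mS)//.
  apply: ge0_ler_powR; rewrite ?nnegrE ?(ltW theta0) ?(ltW mP)//.
    by rewrite mulr_ge0 ?powR_ge0// ltW.
  by rewrite powR_mulrn.
rewrite powRN mulrAC ler_pdivlMr ?powR_gt0//.
apply: (@le_trans _ _ (2 * mass s P)); last first.
  by rewrite ler_pM2l// massS// SsT.
rewrite (fr _ SP) (fr _ PP) -mulrA [X in frac_avg S * X]mulrC [leRHS]mulrA.
apply: ler_pM => //; first exact/ltW/frac_gt0.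
  by rewrite mulr_ge0 ?powR_ge0.
rewrite (le_trans (ltW (dyad_gt (frac_gt0 SP))))// ler_pM2l// -EP.
exact/dyad_le/frac_gt0.
Qed.

Definition testing_const :=
  principal_const * depth_const * 2 `^ ((q / p - 1) / q).

(** In the bound of [sum_principal_le_depth], integration against u produces
    frac_avg(S)^q u(S) = A(S)^q sigma(S) sigma(S)^(q/p - 1). By [depth_mass]
    the last factor is at most (2 sigma(T))^(q/p - 1) times the factor that
    compensates the weight 2^(eta depth), and the packing hypothesis sums the
    rest. *)
Lemma testing (B : R) : 0 <= B ->
  \sum_(S in Ss) tree_Apq S `^ q * mass s S <= B `^ q * mass s T ->
  \sum_a (\sum_(Q in below T | a \in Q) frac_avg Q) `^ q * u a <=
    (testing_const * B) `^ q * mass s T `^ (q / p).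
Proof.
move=> B0 carl.
have k1 : 0 <= principal_const.
  rewrite divr_ge0// subr_ge0 powRN invf_le1 ?powR_gt0//.
  by rewrite -[leLHS](powRr0 2) ler_powR ?ler1n// subr_ge0 ltW.
have k2 : 0 <= depth_const by rewrite divr_ge0// subr_ge0 ltW.
have sT0 : 0 <= mass s T by rewrite mass_ge0.
have point a : (\sum_(Q in below T | a \in Q) frac_avg Q) `^ q * u a <=
    (principal_const * depth_const) `^ q *
     \sum_(S in Ss | a \in S) 2 `^ (eta * (depth S)%:R) * frac_avg S `^ q * u a.
  rewrite -big_distrl/= mulrA ler_wpM2r//.
  rewrite powRM// -mulrA (le_trans _ (ler_wpM2l _ (sum_principal_le_depth a))) ?powR_ge0//.
  have fr0 : 0 <= \sum_(S in Ss | a \in S) frac_avg S.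
    by apply: sumr_ge0 => S /andP[SP _]; exact/ltW/frac_gt0.
  rewrite -powRM//; apply: ge0_ler_powR; rewrite ?nnegrE ?(ltW q0)//.
  - by apply: sumr_ge0 => S _; rewrite mulr_ge0 ?powR_ge0 ?mass_ge0.
  - by rewrite mulr_ge0.
  - exact: sum_below_le_principal.
rewrite (le_trans (ler_sum _ (fun a _ => point a)))// -big_distrr/=.
rewrite (exchange_big_dep (fun S => S \in Ss))/=; last by move=> ? ? _ /andP[].
have term S : S \in Ss ->
    \sum_(a | (S \in Ss) && (a \in S)) 2 `^ (eta * (depth S)%:R) * frac_avg S `^ q * u a <=
    2 `^ (q / p - 1) * mass s T `^ (q / p - 1) * (tree_Apq S `^ q * mass s S).
  move=> SP; rewrite SP/= -big_distrr/= -/(mass u S).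
  have ms : 0 < mass s S.
    by rewrite -(density_mass s (mQ (SsQs SP))) mulr_gt0 ?mQ ?SsQs// (principal_gt0 SP).
  have mS := mQ (SsQs SP).
  have uS : 0 <= mass u S by rewrite mass_ge0.
  have E : frac_avg S `^ q * mass u S =
      tree_Apq S `^ q * mass s S * mass s S `^ (q / p - 1).
    have e1 : (mass u S `^ q^-1) `^ q = mass u S.
      by rewrite -powRrM mulVf ?gt_eqF// powRr1.
    have e2 : (mass s S `^ (1 - p^-1)) `^ q * mass s S * mass s S `^ (q / p - 1) =
        mass s S `^ q.
      rewrite -{2}[mass s S]powRr1 ?(ltW ms)// -powRrM.
      rewrite -!powRD ?(gt_eqF ms) ?implybT//; congr (_ `^ _).
      by field; rewrite gt_eqF.
    rewrite /frac_avg /tree_Apq !powRM ?mulr_ge0 ?powR_ge0 ?(ltW ms)// e1 -e2.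
    by rewrite [LHS]mulrAC !mulrA.
  rewrite -mulrA E mulrCA mulrC ler_wpM2r//.
    by rewrite mulr_ge0 ?powR_ge0// ltW.
  have H : mass s S `^ (q / p - 1) <=
      (2 * 2 `^ (- (theta * (depth S)%:R)) * mass s T) `^ (q / p - 1).
    apply: ge0_ler_powR (depth_mass SP); rewrite ?nnegrE ?(ltW eps_gt0) ?(ltW ms)//.
    by rewrite !mulr_ge0 ?powR_ge0.
  rewrite (le_trans (ler_wpM2l _ H)) ?powR_ge0//.
  rewrite !powRM ?mulr_ge0 ?powR_ge0// -powRrM.
  rewrite [leLHS](_ : _ = 2 `^ (eta * (depth S)%:R) *
     2 `^ (- (theta * (depth S)%:R) * (q / p - 1)) *
     (2 `^ (q / p - 1) * mass s T `^ (q / p - 1))); last by ring.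
  rewrite -powRD ?pnatr_eq0 ?implybT// /eta.
  rewrite [X in 2 `^ X * _](_ : _ = 0) ?powRr0 ?mul1r//; first by ring.
rewrite (le_trans (ler_wpM2l _ (ler_sum _ term))) ?powR_ge0//.
rewrite -big_distrr/= (le_trans (ler_wpM2l _ (ler_wpM2l _ carl)))
  ?mulr_ge0 ?powR_ge0//.
have -> : (testing_const * B) `^ q =
    (principal_const * depth_const) `^ q * 2 `^ (q / p - 1) * B `^ q.
  have k12 := mulr_ge0 k1 k2; have k3 := powR_ge0 2 ((q / p - 1) / q) : 0 <= _ :> R.
  rewrite /testing_const powRM//; last exact: mulr_ge0.
  by rewrite powRM// -powRrM divfK// gt_eqF.
have [->|sT] := eqVneq (mass s T) 0.
  by rewrite !mulr0 mulr_ge0 ?powR_ge0// !mulr_ge0 ?powR_ge0.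
have -> : mass s T `^ (q / p) = mass s T `^ (q / p - 1) * mass s T.
  by rewrite -[X in _ = _ * X]powRr1// -powRD ?sT ?implybT// subrK.
by rewrite le_eqVlt; apply/orP; left; apply/eqP; ring.
Qed.

End testing.

(** * From testing to the bilinear estimate *)

Lemma sum_unique_le (R : realType) (I : finType) (C : pred I) (c : R) :
  0 <= c -> (forall i j, C i -> C j -> i = j) -> \sum_(i | C i) c <= c.
Proof.
move=> c0 H; case: (pickP C) => [i Ci|C0]; last by rewrite big_pred0.
rewrite (bigD1 i)//= big_pred0 ?addr0// => j.
by apply/negP => /andP[Cj /eqP]; apply; exact: H.
Qed.

Lemma young (R : realType) (p q x y t : R) : 1 < p -> 1 < q ->
  p^-1 + q^-1 = 1 -> 0 <= x -> 0 <= y -> 0 < t ->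
  x * y <= t `^ p * x `^ p + (t `^ q)^-1 * y `^ q.
Proof.
move=> p1 q1 pq x0 y0 t0.
have p0 := lt_trans ltr01 p1; have q0 := lt_trans ltr01 q1.
have := @conjugate_powR _ (t * x) (t^-1 * y) p q.
rewrite !mulr_ge0 ?invr_ge0 ?(ltW t0)//.
rewrite [t * x]mulrC mulrA -(mulrA x) mulfV ?gt_eqF// mulr1.
move=> /(_ erefl erefl p0 q0 pq) h; apply: (le_trans h).
rewrite !powRM ?invr_ge0 ?(ltW t0)// -(powR_inv1 (ltW t0)) -powRrM mulN1r powRN.
have le_div (r z : R) : 1 < r -> 0 <= z -> z / r <= z.
  by move=> r1 z0; rewrite ler_pdivrMr ?(lt_trans ltr01)// ler_peMr// ltW.
rewrite [_ `^ p * _]mulrC lerD// le_div//.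
  by rewrite mulr_ge0 ?powR_ge0.
by rewrite mulr_ge0 ?powR_ge0// invr_ge0 powR_ge0.
Qed.

(** With t^q' = x / D, the two halves of Young's inequality for the parameter t
    become proportional to D. *)
Lemma young_balance (R : realType) (x D q q1 : R) : 0 < x -> 0 < D -> 1 < q ->
  q^-1 + q1^-1 = 1 ->
  x * (((x / D) `^ q1^-1) `^ q * D `^ q) = D * x `^ q.
Proof.
move=> x0 D0 q_gt1 qq1; have q0 := lt_trans ltr01 q_gt1.
have e : q1^-1 * q = q - 1.
  rewrite (_ : q1^-1 = 1 - q^-1); first by field; rewrite gt_eqF.
  by rewrite -qq1 addrAC subrr add0r.
rewrite -powRrM e powRM ?invr_ge0 ?(ltW D0) ?(ltW x0)//.
have -> : D `^ q = D * D `^ (q - 1) by rewrite mulr_powRB1 ?ltW.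
rewrite -[D^-1](powR_inv1 (ltW D0)) -powRrM mulN1r powRN.
rewrite -(mulr_powRB1 (ltW x0) q0); field.
by rewrite gt_eqF// powR_gt0.
Qed.

Section stopping_argument.
Variables (R : realType) (X : finType).
Variables (m u s f g : X -> R) (Qs Qs1 : {set {set X}}) (theta p q q1 D : R).
Hypotheses (m0 : forall a, 0 <= m a) (u0 : forall a, 0 <= u a)
  (s0 : forall a, 0 <= s a).
Hypotheses (f0 : forall a, 0 <= f a) (g0 : forall a, 0 <= g a).
Hypotheses (lam : laminar Qs) (sub1 : Qs1 \subset Qs).
Hypotheses (p1 : 1 < p) (pq : p < q) (q11 : 1 < q1) (qq1 : q^-1 + q1^-1 = 1).
Hypotheses (D0 : 0 < D).
Hypothesis test : forall T, T \in Qs ->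
  \sum_a (\sum_(Q in below Qs T | a \in Q) frac_avg m s theta Q) `^ q * u a <=
    D `^ q * mass s T `^ (q / p).
Hypothesis dom : forall Q, Q \in Qs1 ->
  mean u g Q `^ q1 * mass u Q <= mean s f Q `^ p * mass s Q.
Hypotheses (f1 : \sum_a f a `^ p * s a <= 1) (g1 : \sum_a g a `^ q1 * u a <= 1).
Implicit Types (P Q S T : {set X}).

Let p0 : 0 < p. Proof. exact: lt_trans p1. Qed.
Let q0 : 0 < q. Proof. exact: lt_trans pq. Qed.
Let q_gt1 : 1 < q. Proof. exact: lt_trans pq. Qed.
Let lam1 : laminar Qs1. Proof. exact: laminarS sub1 lam. Qed.

Let phi := mean s f.
Let Ss := principal Qs1 phi.

Let phi_ge0 Q : 0 <= phi Q. Proof. exact: mean_ge0. Qed.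

Let SQs1 S : S \in Ss -> S \in Qs1. Proof. exact: principal_sub. Qed.

(** The cubes of Qs1 lying between P and its stopping children. *)
Let layer P := [set Q in Qs1 | (Q \subset P) && (dyad (sup_above Qs1 phi Q) == dyad (phi P))].

Let children P := [set S in Ss | (S \proper P) &&
  [forall S' in Ss, (S \proper S') ==> ~~ (S' \proper P)]].

Let localT P a := \sum_(Q in layer P | a \in Q) frac_avg m s theta Q.

Let frac_ge0 Q : 0 <= frac_avg m s theta Q.
Proof. by rewrite mulr_ge0 ?powR_ge0 ?mass_ge0. Qed.

Let localT_ge0 P a : 0 <= localT P a. Proof. exact: sumr_ge0. Qed.

Let children_sub P S : S \in children P -> S \in Ss /\ S \proper P.
Proof. by rewrite inE => /and3P[]. Qed.

Let children_max P S S' : S \in children P -> S' \in Ss ->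
  S \proper S' -> S' \proper P -> False.
Proof.
rewrite inE => /and3P[SS SP /forallP/(_ S')] + S'S SS' S'P.
by rewrite S'S SS' S'P.
Qed.

Let children_triv P : finset.trivIset (children P).
Proof.
apply/finset.trivIsetP => S S' SC SC' SS'.
have [SS SP] := children_sub SC; have [SS2 SP'] := children_sub SC'.
case/or3P: (lam1 (SQs1 SS) (SQs1 SS2)) => // h; exfalso.
  by apply: (children_max SC SS2 _ SP'); rewrite finset.properEneq SS'.
by apply: (children_max SC' SS _ SP); rewrite finset.properEneq eq_sym SS'.
Qed.

Let children_cover P : finset.cover (children P) \subset P.
Proof. by apply/finset.bigcupsP => S /children_sub[_ /proper_sub]. Qed.

Let sum_split P (h : X -> R) : \sum_(a in P) h a =
  \sum_(a in P :\: finset.cover (children P)) h a +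
  \sum_(S in children P) \sum_(a in S) h a.
Proof.
rewrite (big_setID (finset.cover (children P)))/= addrC; congr (_ + _).
rewrite finset.setIC (finset.setIidPl (children_cover P)).
by rewrite finset.big_trivIset.
Qed.

Let child_above P S a : P \in Ss -> S \in Ss -> S \proper P -> a \in S ->
  a \in finset.cover (children P).
Proof.
move=> PS SS SP aS.
pose g' S' := [&& S' \in Ss, S' \proper P & a \in S'].
have gS : g' S by rewrite /g' SS SP.
pose M := [arg max_(S' > S | g' S') #|S'|].
have [/and3P[MS MP aM] Mm] : g' M /\ forall S', g' S' -> (#|S'| <= #|M|)%N.
  by rewrite /M; case: arg_maxnP.
apply/finset.bigcupP; exists M => //; rewrite inE MS MP/=.
apply/forallP => S'; apply/implyP => SS'; apply/implyP => MS'; apply/negP => SP'.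
have := proper_card MS'; rewrite ltnNge Mm// /g' SS' SP'/=.
exact: (fintype.subsetP (proper_sub MS')).
Qed.

Let core_uniq a P S : P \in Ss -> S \in Ss ->
  a \in P :\: finset.cover (children P) ->
  a \in S :\: finset.cover (children S) -> P = S.
Proof.
move=> PS SS /setDP[aP aPn] /setDP[aS aSn]; apply/eqP/negPn/negP => PnS.
have [h|h] := laminar_meet lam1 (SQs1 PS) (SQs1 SS) aP aS.
  by move/negP: aSn; apply; apply: (child_above SS PS) => //; rewrite finset.properEneq PnS.
by move/negP: aPn; apply; apply: (child_above PS SS) => //; rewrite finset.properEneq eq_sym PnS.
Qed.

Let parent_uniq S P P' : P \in Ss -> P' \in Ss ->
  S \in children P -> S \in children P' -> P = P'.
Proof.
move=> PS PS' SP SP'; apply/eqP/negPn/negP => PnP.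
have [SS SpP] := children_sub SP; have [_ SpP'] := children_sub SP'.
have [a aS] : exists a, a \in S.
  apply/finset.set0Pn; apply/negP => /eqP E.
  by have := principal_gt0 SS; rewrite E /phi /mean /mass !big_set0 mul0r ltxx.
have aP := fintype.subsetP (proper_sub SpP) _ aS.
have aP' := fintype.subsetP (proper_sub SpP') _ aS.
have [h|h] := laminar_meet lam1 (SQs1 PS) (SQs1 PS') aP aP'.
  by apply: (children_max SP' PS SpP); rewrite finset.properEneq PnP.
by apply: (children_max SP PS' SpP'); rewrite finset.properEneq eq_sym PnP.
Qed.

(** No cube of the layer of P is contained in a child S, as the running maximum
    has changed level there; so the local operator does not see the points of S
    separately, and g may be replaced by its mean on S. *)
Let localT_const P S a : P \in Ss -> S \in children P -> a \in S ->
  localT P a = \sum_(Q in layer P | S \subset Q) frac_avg m s theta Q.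
Proof.
move=> PS SC aS; have [SS SP] := children_sub SC.
apply: eq_bigl => Q; apply: andb_id2l => QL.
have [QQs QP EQ] : [/\ Q \in Qs1, Q \subset P &
    dyad (sup_above Qs1 phi Q) = dyad (phi P)].
  by move: QL; rewrite inE => /and3P[? ? /eqP].
apply/idP/idP => [aQ|/fintype.subsetP]; last exact.
have [//|QS] := laminar_meet lam1 (SQs1 SS) QQs aS aQ.
have := principal_proper SS (SQs1 PS) SP; rewrite (principal_sup_above PS) -EQ ltNge.
have S0 : 0 < sup_above Qs1 phi S by rewrite (principal_sup_above SS) (principal_gt0 SS).
by rewrite -(principal_sup_above SS) le_dyad// sup_above_anti.
Qed.

(** The q'-norm to the power q' of g restricted to P, with g averaged over
    each child of P. *)
Let budget P := \sum_(a in P :\: finset.cover (children P)) g a `^ q1 * u a +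
  \sum_(S in children P) mean u g S `^ q1 * mass u S.

Let local_young P t : P \in Ss -> 0 < t ->
  \sum_(a in P) localT P a * (g a * u a) <=
  t `^ q * (\sum_a localT P a `^ q * u a) + (t `^ q1)^-1 * budget P.
Proof.
move=> PS t0.
have -> : \sum_(a in P) localT P a * (g a * u a) =
    \sum_(a in P :\: finset.cover (children P)) localT P a * g a * u a +
    \sum_(S in children P) (\sum_(Q in layer P | S \subset Q) frac_avg m s theta Q)
       * mean u g S * mass u S.
  rewrite (sum_split P); congr (_ + _); first by apply: eq_bigr => a _; rewrite mulrA.
  apply: eq_bigr => S SC; rewrite -mulrA mean_mass// /mass big_distrr/=.
  by apply: eq_bigr => a aS; rewrite (localT_const PS SC aS).
have le1 : \sum_(a in P) localT P a `^ q * u a <= \sum_a localT P a `^ q * u a.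
  rewrite big_mkcond/= ler_sum// => a _; case: ifP => // _.
  by rewrite mulr_ge0 ?powR_ge0.
apply: (le_trans _ (lerD (ler_wpM2l (powR_ge0 t q) le1) (lexx _))).
rewrite (sum_split P) /budget !mulrDr addrACA lerD//.
  rewrite !big_distrr/= -big_split/= ler_sum// => a _.
  by rewrite !mulrA -mulrDl ler_wpM2r// young.
rewrite !big_distrr/= -big_split/= ler_sum// => S SC.
set c := \sum_(Q in _ | _) _.
have -> : \sum_(a in S) localT P a `^ q * u a = c `^ q * mass u S.
  rewrite /mass big_distrr/=; apply: eq_bigr => a aS.
  by rewrite (localT_const PS SC aS).
have c0 : 0 <= c by exact: sumr_ge0.
have e0 := mean_ge0 S u0 g0.
move: (mean u g S) e0 c c0 => e e0 c c0.
by rewrite !mulrA -mulrDl ler_wpM2r ?mass_ge0// young.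
Qed.

Let localT_test P : P \in Ss ->
  \sum_a localT P a `^ q * u a <= D `^ q * mass s P `^ (q / p).
Proof.
move=> PS; have PQs := fintype.subsetP sub1 _ (SQs1 PS).
apply: le_trans (test PQs); apply: ler_sum => a _; rewrite ler_wpM2r//.
apply: ge0_ler_powR; rewrite ?nnegrE ?(ltW q0)//; first exact: sumr_ge0.
rewrite [leLHS]big_mkcond [leRHS]big_mkcond/= ler_sum// => Q _.
case: ifP => [/andP[QL aQ]|_]; last by case: ifP.
move: QL; rewrite inE => /and3P[QQs QP _].
by rewrite inE (fintype.subsetP sub1 _ QQs) QP aQ.
Qed.

(** Young's inequality with t^q' = phi(P) / D: testing turns its first half
    into D (phi(P)^p sigma(P))^(q/p), and the second half is D budget(P). *)
Let local_bound P : P \in Ss ->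
  2 * phi P * (\sum_(a in P) localT P a * (g a * u a)) <=
  2 * D * ((phi P `^ p * mass s P) `^ (q / p) + budget P).
Proof.
move=> PS; have phi0 : 0 < phi P := principal_gt0 PS.
pose t := (phi P / D) `^ q1^-1.
have t0 : 0 < t by rewrite powR_gt0// divr_gt0.
have q10 : 0 < q1 by exact: lt_trans q11.
have tq1 : t `^ q1 = phi P / D.
  by rewrite /t -powRrM mulVf ?gt_eqF// powRr1// ltW// divr_gt0.
have tq : phi P * (t `^ q * D `^ q) = D * phi P `^ q by exact: young_balance.
move: (local_young PS t0) (localT_test PS) (mass_ge0 P s0).
move: (\sum_(a in P) _) (\sum_a _) (budget P) (mass s P) => S0 W b M Y Z M0.
clearbody t; move: (phi P) phi0 tq1 tq => x x0 tq1 tq.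
have Y' : x * S0 <= x * (t `^ q * (D `^ q * M `^ (q / p)) + (t `^ q1)^-1 * b).
  rewrite ler_wpM2l ?(ltW x0)// (le_trans Y)// lerD2r ler_wpM2l ?powR_ge0//.
rewrite -[leLHS]mulrA -[leRHS]mulrA ler_pM2l// (le_trans Y')//.
rewrite powRM ?powR_ge0// -powRrM.
rewrite (_ : p * (q / p) = q); last by field; rewrite gt_eqF.
rewrite tq1 mulrDr (mulrA (t `^ q)) (mulrA x) tq.
rewrite le_eqVlt; apply/orP; left; apply/eqP.
by field; rewrite !gt_eqF.
Qed.

Let term_bound Q : Q \in Qs1 ->
  mass m Q `^ (- theta) * mass (fun a => f a * s a) Q *
    mass (fun a => g a * u a) Q <=
  \sum_(P in Ss | Q \in layer P)
    2 * phi P * (frac_avg m s theta Q * mass (fun a => g a * u a) Q).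
Proof.
move=> QQs; have G0 : 0 <= mass (fun a => g a * u a) Q.
  by apply: mass_ge0 => a; rewrite mulr_ge0.
rewrite -mean_mass// -/phi.
have [h|h] := ltP 0 (phi Q); last first.
  have -> : phi Q = 0 by apply/eqP; rewrite eq_le h phi_ge0.
  rewrite mul0r mulr0 mul0r; apply: sumr_ge0 => P _.
  exact: mulr_ge0 (mulr_ge0 (ler0n _ 2) (phi_ge0 P)) (mulr_ge0 (frac_ge0 Q) G0).
have r0 := lt_le_trans h (le_sup_above phi QQs (subxx Q)).
have [P [PS QP EP]] := principal_above QQs r0.
rewrite (bigD1 P)/=; last by rewrite PS inE QQs QP EP/= eqxx.
rewrite ler_wpDr//.
  apply: sumr_ge0 => P' _.
  exact: mulr_ge0 (mulr_ge0 (ler0n _ 2) (phi_ge0 P')) (mulr_ge0 (frac_ge0 Q) G0).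
rewrite [leRHS]mulrA ler_wpM2r// /frac_avg mulrCA ler_wpM2r ?frac_ge0//.
rewrite (le_trans (le_sup_above phi QQs (subxx Q)))//.
rewrite (le_trans (ltW (dyad_gt r0)))// ler_pM2l// -EP.
exact: dyad_le (principal_gt0 PS).
Qed.

Definition half_const :=
  2 * (carleson_const p `^ (q / p) + (1 + carleson_const p)) : R.

(** Summing [local_bound]: the powers q/p >= 1 are reduced to the Carleson
    embedding, the cores P minus children are disjoint and give the norm of g,
    and a child S occurs under one parent only, where the hypothesis [dom]
    turns its term into that of the Carleson embedding for f. *)
Lemma stopping_bound :
  \sum_(Q in Qs1) mass m Q `^ (- theta) * mass (fun a => f a * s a) Q *
    mass (fun a => g a * u a) Q <= half_const * D.
Proof.
apply: (le_trans (ler_sum _ term_bound)).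
rewrite (exchange_big_dep (fun P => P \in Ss))/=; last by move=> Q P _ /andP[].
have C0 := carleson_const_ge0 p1.
have car : \sum_(P in Ss) phi P `^ p * mass s P <= carleson_const p.
  rewrite (le_trans (carleson_embedding lam1 p1 s0 f0))//.
  by rewrite -[leRHS]mulr1 ler_wpM2l.
have ps0 P : 0 <= phi P `^ p * mass s P.
  by rewrite mulr_ge0 ?powR_ge0 ?mass_ge0.
have step P : P \in Ss -> \sum_(Q in Qs1 | (P \in Ss) && (Q \in layer P))
      2 * phi P * (frac_avg m s theta Q * mass (fun a => g a * u a) Q) <=
    2 * D * ((phi P `^ p * mass s P) `^ (q / p) + budget P).
  move=> PS; apply: le_trans (local_bound PS); rewrite -big_distrr/=.
  apply: ler_wpM2l; first exact: mulr_ge0 (ler0n _ 2) (phi_ge0 P).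
  rewrite /localT; under [leRHS]eq_bigr => a _ do rewrite big_distrl/=.
  rewrite [leRHS](exchange_big_dep (fun Q => Q \in layer P))/=; last first.
    by move=> a Q _ /andP[].
  rewrite (eq_bigl (fun Q => Q \in layer P)); last first.
    move=> Q; rewrite PS/=; case QL: (Q \in layer P); last by rewrite andbF.
    by move: QL; rewrite inE => /andP[->].
  apply: ler_sum => Q QL; rewrite -big_distrr/= ler_wpM2l ?frac_ge0//.
  rewrite /mass le_eqVlt; apply/orP; left; apply/eqP; apply: eq_bigl => a.
  rewrite QL/=; move: QL; rewrite inE => /and3P[_ /fintype.subsetP QP _].
  by apply/idP/andP => [aQ|[]//]; rewrite QP.
apply: (le_trans (ler_sum _ step)); rewrite -big_distrr/= big_split/=.
rewrite /half_const [leRHS]mulrAC ler_pM2l ?mulr_gt0// lerD//.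
  have le1 P : P \in Ss -> (phi P `^ p * mass s P) `^ (q / p) <=
      carleson_const p `^ (q / p - 1) * (phi P `^ p * mass s P).
    move=> PS; rewrite -(@mulr_powRB1 _ (_ * _) (q / p)) ?divr_gt0// mulrC.
    rewrite ler_wpM2r//; apply: ge0_ler_powR; rewrite ?nnegrE//.
      by rewrite subr_ge0 ler_pdivlMr// mul1r ltW.
    apply: le_trans car; rewrite (bigD1 P)//= lerDl; exact: sumr_ge0.
  rewrite (le_trans (ler_sum _ le1))// -big_distrr/=.
  rewrite (le_trans (ler_wpM2l (powR_ge0 _ _) car))//.
  by rewrite mulrC mulr_powRB1 ?divr_gt0.
rewrite /budget big_split/= lerD//.
  apply: le_trans g1; rewrite (exchange_big_dep xpredT)//= ler_sum// => a _.
  apply: sum_unique_le; first by rewrite mulr_ge0 ?powR_ge0.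
  by move=> P S /andP[PS aP] /andP[SS aS]; exact: core_uniq aP aS.
apply: le_trans car; rewrite (exchange_big_dep (fun S => S \in Ss))/=; last first.
  by move=> P S _ /children_sub[].
apply: ler_sum => S SS; apply: le_trans (dom (SQs1 SS)).
apply: sum_unique_le.
  by rewrite mulr_ge0 ?powR_ge0 ?mass_ge0.
by move=> P P' /andP[PS SP] /andP[PS' SP']; exact: parent_uniq SP SP'.
Qed.

End stopping_argument.

(** * The norm inequality on a finite tree *)

Section discrete_theorem.
Variables (R : realType) (X : finType).
Implicit Types (m u s f g h : X -> R) (Qs : {set {set X}}) (theta p q : R).

Definition tree m Qs := [/\ laminar Qs, (forall a, 0 <= m a),
  (forall Q, Q \in Qs -> 0 < mass m Q) &
  (forall P Q, P \in Qs -> Q \in Qs -> P \proper Q ->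
    2 * mass m P <= mass m Q)].

(** The Carleson packing that an A-infinity condition on s has to provide. *)
Definition packed m u s Qs theta p q (B : R) := forall T, T \in Qs ->
  \sum_(S in principal (below Qs T) (density m s))
    tree_Apq m u s theta p q S `^ q * mass s S <= B `^ q * mass s T.

Lemma packed_maximal m u s Qs theta p q (A K : R) : tree m Qs ->
  (forall a, 0 <= s a) -> 0 < q -> 0 <= A -> 0 <= K ->
  (forall S, S \in Qs -> tree_Apq m u s theta p q S <= A) ->
  (forall T, T \in Qs ->
    \sum_a sup_above (below Qs T) (density m s) [set a] * m a <= K * mass s T) ->
  packed m u s Qs theta p q (A * (4 * K) `^ q^-1).
Proof.
move=> [lam m0 mQ _] s0 q0 A0 K0 hA hK T TQs.
rewrite powRM ?powR_ge0// -powRrM mulVf ?gt_eqF// powRr1 ?mulr_ge0//.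
have sub S : S \in principal (below Qs T) (density m s) -> S \in Qs.
  by move=> /principal_sub/(fintype.subsetP (below_sub Qs T)).
have step S : S \in principal (below Qs T) (density m s) ->
    tree_Apq m u s theta p q S `^ q * mass s S <= A `^ q * mass s S.
  move=> SP; rewrite ler_wpM2r ?mass_ge0//.
  have Af0 : 0 <= tree_Apq m u s theta p q S.
    by rewrite /tree_Apq !mulr_ge0 ?powR_ge0.
  by apply: ge0_ler_powR; rewrite ?nnegrE ?(ltW q0)// hA// sub.
rewrite (le_trans (ler_sum _ step))// -big_distrr/= -mulrA ler_wpM2l ?powR_ge0//.
have mB Q : Q \in below Qs T -> 0 < mass m Q.
  by move=> /(fintype.subsetP (below_sub Qs T)); exact: mQ.
rewrite (le_trans (sum_principal_mass s (lam_below lam (T := T)) m0 mB))//.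
by rewrite -mulrA ler_pM2l// hK.
Qed.

Lemma packed_sqrt m u s h Qs theta p q (B : R) : tree m Qs ->
  (forall a, 0 <= s a) -> (forall a, 0 <= h a) -> 0 < q -> 0 <= B ->
  (forall a, h a `^ 2 * m a <= s a) ->
  (forall S, S \in Qs -> tree_Apq m u s theta p q S `^ q * mass s S <=
    B `^ q * (mass m S * mean m h S `^ 2)) ->
  packed m u s Qs theta p q (B * sparse_const R `^ q^-1).
Proof.
move=> [lam m0 mQ _] s0 h0 q0 B0 hs hA T TQs.
have c0 := sparse_const_ge0 R.
rewrite powRM ?powR_ge0// -powRrM mulVf ?gt_eqF// powRr1//.
have sub S : S \in principal (below Qs T) (density m s) -> S \in Qs.
  by move=> /principal_sub/(fintype.subsetP (below_sub Qs T)).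
rewrite (le_trans (ler_sum _ (fun S SP => hA S (sub S SP))))//.
rewrite -big_distrr/= -mulrA ler_wpM2l ?powR_ge0//.
apply: sum_principal_mean_sqr => //; first exact: lam_below.
- by move=> Q /(fintype.subsetP (below_sub Qs T)); exact: mQ.
- by move=> Q; rewrite inE => /andP[].
Qed.

Lemma testing_const_gt0 theta p q : 0 < theta -> theta < 1 -> 1 < p -> p < q ->
  0 < testing_const theta p q.
Proof.
move=> t0 t1 p1 pq; have p0 := lt_trans ltr01 p1; have q0 := lt_trans p0 pq.
have pow_lt1 (x : R) : 0 < x -> 2 `^ (- x) < 1 :> R.
  by move=> x0; rewrite powRN invf_lt1 ?powR_gt0// /powR pnatr_eq0/=
    -[ltLHS]expR0 ltr_expR mulr_gt0// ln_gt0// ltr1n.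
rewrite !mulr_gt0 ?powR_gt0//.
  by rewrite invr_gt0 subr_gt0 pow_lt1// subr_gt0.
rewrite invr_gt0 subr_gt0 pow_lt1// divr_gt0// mulr_gt0//.
by rewrite subr_gt0 ltr_pdivlMr// mul1r.
Qed.

Lemma half_const_gt0 p q : 1 < p -> 0 < half_const p q.
Proof.
move=> p1; have C0 := carleson_const_ge0 p1.
by rewrite mulr_gt0// ltr_wpDl ?powR_ge0// ltr_pwDl.
Qed.

Definition form_const theta p q p1 q1 : R :=
  half_const p q * testing_const theta p q +
  half_const q1 p1 * testing_const theta q1 p1.

Definition tree_form m u s f g Qs theta := \sum_(Q in Qs) mass m Q `^ (- theta) *
  mass (fun a => f a * s a) Q * mass (fun a => g a * u a) Q.

(** Each cube belongs to the half where the f-term dominates or to the half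
    where the g-term does. The second half is the first one for the dual pair,
    with (s, p) and (u, q') exchanged. *)
Lemma form_le_normalized m u s f g Qs theta p q p1 q1 (B1 B2 : R) : tree m Qs ->
  (forall a, 0 <= u a) -> (forall a, 0 <= s a) ->
  (forall a, 0 <= f a) -> (forall a, 0 <= g a) ->
  0 < theta -> theta < 1 -> 1 < p -> p < q -> 1 < q1 -> q1 < p1 ->
  p^-1 + p1^-1 = 1 -> q^-1 + q1^-1 = 1 -> 0 < B1 -> 0 < B2 ->
  packed m u s Qs theta p q B1 -> packed m s u Qs theta q1 p1 B2 ->
  \sum_a f a `^ p * s a <= 1 -> \sum_a g a `^ q1 * u a <= 1 ->
  tree_form m u s f g Qs theta <= form_const theta p q p1 q1 * (B1 + B2).
Proof.
move=> [lam m0 mQ m2] u0 s0 f0 g0 t0 t1 p_gt1 pq q1_gt1 qp1 pp1 qq1 B10 B20 pk1 pk2 f1 g1.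
have k1 := testing_const_gt0 t0 t1 p_gt1 pq.
have k2 := testing_const_gt0 t0 t1 q1_gt1 qp1.
have h1 := half_const_gt0 q p_gt1; have h2 := half_const_gt0 p1 q1_gt1.
pose c Q := mean u g Q `^ q1 * mass u Q <= mean s f Q `^ p * mass s Q.
rewrite /tree_form (bigID c)/=.
apply: (@le_trans _ _ (half_const p q * (testing_const theta p q * B1) +
   half_const q1 p1 * (testing_const theta q1 p1 * B2))); last first.
  rewrite /form_const; move: k1 k2 h1 h2.
  move: (half_const p q) (half_const q1 p1) (testing_const _ _ _)
    (testing_const _ q1 _) => a b c1 c2 *.
  rewrite [leRHS](_ : _ = a * (c1 * B1) + b * (c2 * B2) +
    (a * c1 * B2 + b * c2 * B1)); last by ring.
  by rewrite lerDl addr_ge0// !mulr_ge0// ltW.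
apply: lerD.
  rewrite (eq_bigl (fun Q => Q \in [set Q in Qs | c Q])); last by move=> Q; rewrite inE.
  apply: (stopping_bound (Qs := Qs) u0 s0 f0 g0 lam _ p_gt1 pq q1_gt1 qq1) => //.
  - by apply/fintype.subsetP => Q; rewrite inE => /andP[].
  - exact: mulr_gt0.
  - move=> T TQs; apply: testing => //; [exact: ltW|exact: pk1].
  - by move=> Q; rewrite inE => /andP[].
rewrite (eq_bigl (fun Q => Q \in [set Q in Qs | ~~ c Q])); last by move=> Q; rewrite inE.
under eq_bigr => Q _ do rewrite mulrAC.
apply: (stopping_bound (Qs := Qs) s0 u0 g0 f0 lam _ q1_gt1 qp1 p_gt1) => //.
- by apply/fintype.subsetP => Q; rewrite inE => /andP[].
- by rewrite addrC.
- exact: mulr_gt0.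
- by move=> T TQs; apply: testing => //; [exact: ltW|exact: pk2].
- by move=> Q; rewrite inE /c -ltNge => /andP[_ /ltW].
Qed.

Lemma form_eq0 m u s f g Qs theta p : (forall a, 0 <= s a) ->
  (forall a, 0 <= f a) -> 0 < p -> \sum_a f a `^ p * s a = 0 ->
  tree_form m u s f g Qs theta = 0.
Proof.
move=> s0 f0 p0 /eqP; rewrite psumr_eq0; last by move=> a _; rewrite mulr_ge0 ?powR_ge0.
move=> /allP H; rewrite /tree_form big1// => Q _.
rewrite [mass (fun a => f a * s a) Q]big1 ?mulr0 ?mul0r// => a _.
have := H a (mem_index_enum _); rewrite mulf_eq0 powR_eq0.
by case/orP => [/andP[/eqP -> _]|/eqP ->]; rewrite ?mul0r ?mulr0.
Qed.

Lemma formC m u s f g Qs theta : tree_form m u s f g Qs theta = tree_form m s u g f Qs theta.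
Proof. by apply: eq_bigr => Q _; rewrite mulrAC. Qed.

Lemma form_scale m u s f g Qs theta (x y : R) :
  tree_form m u s (fun a => x * f a) (fun a => y * g a) Qs theta =
  x * y * tree_form m u s f g Qs theta.
Proof.
have massZ (z : R) h w Q : mass (fun a => z * h a * w a) Q =
    z * mass (fun a => h a * w a) Q.
  by rewrite /mass big_distrr/=; apply: eq_bigr => a _; rewrite mulrA.
by rewrite /tree_form big_distrr/=; apply: eq_bigr => Q _; rewrite !massZ; ring.
Qed.

Lemma packedW m u s Qs theta p q (B B' : R) : (forall a, 0 <= s a) -> 0 < q ->
  0 <= B -> B <= B' -> packed m u s Qs theta p q B -> packed m u s Qs theta p q B'.
Proof.
move=> s0 q0 B0 BB' H T TQs; apply: (le_trans (H _ TQs)).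
rewrite ler_wpM2r ?mass_ge0//; apply: ge0_ler_powR; rewrite ?nnegrE ?(ltW q0)//.
exact: le_trans BB'.
Qed.

(** By homogeneity f and g are normalised; the bounds B1 and B2, which have to
    be positive for balancing Young's inequality, are approached from above. *)
Theorem form_le m u s f g Qs theta p q p1 q1 (B1 B2 : R) : tree m Qs ->
  (forall a, 0 <= u a) -> (forall a, 0 <= s a) ->
  (forall a, 0 <= f a) -> (forall a, 0 <= g a) ->
  0 < theta -> theta < 1 -> 1 < p -> p < q -> 1 < q1 -> q1 < p1 ->
  p^-1 + p1^-1 = 1 -> q^-1 + q1^-1 = 1 -> 0 <= B1 -> 0 <= B2 ->
  packed m u s Qs theta p q B1 -> packed m s u Qs theta q1 p1 B2 ->
  tree_form m u s f g Qs theta <= form_const theta p q p1 q1 * (B1 + B2) *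
    (\sum_a f a `^ p * s a) `^ p^-1 * (\sum_a g a `^ q1 * u a) `^ q1^-1.
Proof.
move=> tr u0 s0 f0 g0 t0 t1 p_gt1 pq q1_gt1 qp1 pp1 qq1 B10 B20 pk1 pk2.
have p0 := lt_trans ltr01 p_gt1; have q10 := lt_trans ltr01 q1_gt1.
have q0 := lt_trans p0 pq; have p10 := lt_trans q10 qp1.
set F := \sum_a f a `^ p * s a; set G := \sum_a g a `^ q1 * u a.
have F0 : 0 <= F by apply: sumr_ge0 => a _; rewrite mulr_ge0 ?powR_ge0.
have G0 : 0 <= G by apply: sumr_ge0 => a _; rewrite mulr_ge0 ?powR_ge0.
have K0 : 0 < form_const theta p q p1 q1.
  by rewrite addr_gt0// mulr_gt0 ?half_const_gt0 ?testing_const_gt0.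
have rhs0 : 0 <= form_const theta p q p1 q1 * (B1 + B2) * F `^ p^-1 * G `^ q1^-1.
  do 2 apply: mulr_ge0 (powR_ge0 _ _); apply: mulr_ge0; first exact: ltW.
  exact: addr_ge0.
have [FE|FN] := eqVneq F 0; first by rewrite (form_eq0 _ _ _ _ _ s0 f0 p0 FE).
have [GE|GN] := eqVneq G 0; first by rewrite formC (form_eq0 _ _ _ _ _ u0 g0 q10 GE).
have Fgt : 0 < F by rewrite lt_neqAle eq_sym FN.
have Ggt : 0 < G by rewrite lt_neqAle eq_sym GN.
have Fp : 0 < F `^ p^-1 by rewrite powR_gt0.
have Gp : 0 < G `^ q1^-1 by rewrite powR_gt0.
have nrm (r N : R) (w v : X -> R) : 0 < r -> 0 < N -> (forall a, 0 <= w a) ->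
    N = \sum_a w a `^ r * v a -> \sum_a ((N `^ r^-1)^-1 * w a) `^ r * v a <= 1.
  move=> r0 N0 w0 NE.
  rewrite (eq_bigr (fun a => N^-1 * (w a `^ r * v a))).
    by rewrite -big_distrr/= -NE mulVf// gt_eqF.
  move=> a _; rewrite powRM ?invr_ge0 ?powR_ge0// mulrA; congr (_ * _ * _).
  by rewrite -powRN -powRrM mulNr mulVf ?gt_eqF// powR_inv1// ltW.
have base (e : R) : 0 < e -> (F `^ p^-1)^-1 * (G `^ q1^-1)^-1 *
    tree_form m u s f g Qs theta <=
    form_const theta p q p1 q1 * ((B1 + e) + (B2 + e)).
  move=> e0; rewrite -form_scale; apply: form_le_normalized => //.
  - by move=> a; rewrite mulr_ge0// invr_ge0 ltW.
  - by move=> a; rewrite mulr_ge0// invr_ge0 ltW.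
  - by rewrite ltr_wpDl.
  - by rewrite ltr_wpDl.
  - by apply: packedW pk1 => //; rewrite lerDl ltW.
  - by apply: packedW pk2 => //; rewrite lerDl ltW.
  - exact: nrm.
  - exact: nrm.
have : (F `^ p^-1)^-1 * (G `^ q1^-1)^-1 * tree_form m u s f g Qs theta <=
    form_const theta p q p1 q1 * (B1 + B2).
  apply/ler_addgt0Pr => e e0.
  have e' : 0 < e / (2 * form_const theta p q p1 q1) by rewrite divr_gt0// mulr_gt0.
  apply: le_trans (base _ e') _; rewrite le_eqVlt; apply/orP; left; apply/eqP.
  by field; rewrite gt_eqF.
rewrite mulrC -invfM ler_pdivrMr ?mulr_gt0//.
by rewrite [F `^ _ * _]mulrC !mulrA mulrAC.
Qed.

(** Duality with the extremal g = S^(q - 1), S being the operator applied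
    to f. *)
Theorem operator_le m u s f Qs theta p q p1 q1 (B1 B2 : R) : tree m Qs ->
  (forall a, 0 <= u a) -> (forall a, 0 <= s a) -> (forall a, 0 <= f a) ->
  0 < theta -> theta < 1 -> 1 < p -> p < q -> 1 < q1 -> q1 < p1 ->
  p^-1 + p1^-1 = 1 -> q^-1 + q1^-1 = 1 -> 0 <= B1 -> 0 <= B2 ->
  packed m u s Qs theta p q B1 -> packed m s u Qs theta q1 p1 B2 ->
  \sum_a (\sum_(Q in Qs | a \in Q) mass m Q `^ (- theta) *
    mass (fun a => f a * s a) Q) `^ q * u a <=
  (form_const theta p q p1 q1 * (B1 + B2)) `^ q *
    (\sum_a f a `^ p * s a) `^ (q / p).
Proof.
move=> tr u0 s0 f0 t0 t1 p_gt1 pq q1_gt1 qp1 pp1 qq1 B10 B20 pk1 pk2.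
have p0 := lt_trans ltr01 p_gt1; have q10 := lt_trans ltr01 q1_gt1.
have q0 := lt_trans p0 pq; have q_gt1 := lt_trans p_gt1 pq.
pose S a := \sum_(Q in Qs | a \in Q) mass m Q `^ (- theta) *
    mass (fun b => f b * s b) Q.
have S0 a : 0 <= S a.
  apply: sumr_ge0 => Q _; apply: mulr_ge0; first exact: powR_ge0.
  by apply: mass_ge0 => b; rewrite mulr_ge0.
pose g a := S a `^ (q - 1); have g0 a : 0 <= g a by exact: powR_ge0.
set Y := \sum_a _; set W := \sum_a _.
have Y0 : 0 <= Y by apply: sumr_ge0 => a _; rewrite mulr_ge0 ?powR_ge0.
have W0 : 0 <= W by apply: sumr_ge0 => a _; rewrite mulr_ge0 ?powR_ge0.
have formE : tree_form m u s f g Qs theta = Y.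
  rewrite /tree_form; under eq_bigr => Q _ do rewrite [X in _ * X]/mass big_distrr/=.
  rewrite (exchange_big_dep xpredT)//=; apply: eq_bigr => a _.
  by rewrite -big_distrl/= -/(S a) mulrA mulr_powRB1.
have gE : \sum_a g a `^ q1 * u a = Y.
  apply: eq_bigr => a _; rewrite /g -powRrM; congr (_ `^ _ * _).
  have -> : q1 = q / (q - 1).
    rewrite -[q1]invrK (_ : q1^-1 = 1 - q^-1); last by rewrite -qq1 addrAC subrr add0r.
    by field; rewrite subr_eq0 !gt_eqF.
  by field; rewrite subr_eq0 gt_eqF.
have := form_le tr u0 s0 f0 g0 t0 t1 p_gt1 pq q1_gt1 qp1 pp1 qq1 B10 B20 pk1 pk2.
rewrite formE gE -/W; set C := form_const _ _ _ _ _ * _ => main.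
have C0 : 0 <= C.
  apply: mulr_ge0; last exact: addr_ge0.
  by rewrite ltW// addr_gt0// mulr_gt0 ?half_const_gt0 ?testing_const_gt0.
have [->|YN] := eqVneq Y 0; first by rewrite mulr_ge0 ?powR_ge0.
have Ygt : 0 < Y by rewrite lt_neqAle eq_sym YN.
have Yq : Y = Y `^ q^-1 * Y `^ q1^-1.
  by rewrite -powRD ?YN ?implybT// qq1 powRr1.
have le1 : Y `^ q^-1 <= C * W `^ p^-1.
  by move: main; rewrite {1}Yq ler_pM2r// powR_gt0.
have -> : Y = (Y `^ q^-1) `^ q by rewrite -powRrM mulVf ?gt_eqF// powRr1.
rewrite mulrC [q / p]mulrC mulrC powRrM -powRM ?powR_ge0//.
by apply: ge0_ler_powR; rewrite ?nnegrE ?(ltW q0) ?powR_ge0// mulr_ge0 ?powR_ge0.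
Qed.

End discrete_theorem.

Local Open Scope classical_set_scope.
Local Open Scope ring_scope.
Local Open Scope ereal_scope.

(** * Monotonicity of the integral, and Jensen for powers *)

Section integral_monotone.
Context d (T : measurableType d) (R : realType) (mu : {measure set T -> \bar R}).
Import HBNNSimple.

(** The integral of a nonnegative function is a supremum over the simple
    functions below it. As measurability does not enter, the Hardy-Littlewood
    maximal function and the Riesz potential can be integrated as they are. *)
Lemma ge0_le_integral_any (D : set T) (f g : T -> \bar R) :
  (forall x, D x -> 0 <= f x) -> (forall x, D x -> f x <= g x) ->
  \int[mu]_(x in D) f x <= \int[mu]_(x in D) g x.
Proof.
move=> f0 fg; rewrite (integral_mkcond D f) (integral_mkcond D g).
rewrite !ge0_integralTE; last 2 first.
- by apply: erestrict_ge0 => x Dx; exact: le_trans (f0 _ Dx) (fg _ Dx).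
- exact: erestrict_ge0.
apply: ge_ereal_sup => _ [h hf <-]; apply: ereal_sup_ubound; exists h => //= x.
exact: le_trans (hf x) (lee_restrict fg x).
Qed.

Lemma le_integral_any (D : set T) (f g : T -> \bar R) :
  (forall x, D x -> f x <= g x) ->
  \int[mu]_(x in D) f x <= \int[mu]_(x in D) g x.
Proof.
move=> fg; rewrite (integralE mu D f) (integralE mu D g); apply: leeB.
  apply: ge0_le_integral_any => x Dx; first exact: funepos_ge0.
  by rewrite !funeposE ge_max !le_max lexx fg// orbT.
apply: ge0_le_integral_any => x Dx; first exact: funeneg_ge0.
by rewrite !funenegE ge_max !le_max lexx leeN2 fg// orbT.
Qed.

End integral_monotone.

Section jensen.
Context d (T : measurableType d) (R : realType) (mu : {measure set T -> \bar R}).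

(** The convex function x^p lies above its tangent at c. *)
Lemma powR_tangent (p x c : R) : (1 < p -> 0 <= x -> 0 <= c ->
  p * (c `^ (p - 1) * x) <= x `^ p + (p - 1) * c `^ p)%R.
Proof.
move=> p1 x0 c0; have p0 := lt_trans ltr01 p1.
have pp0 : (0 < p - 1)%R by rewrite subr_gt0.
have := @conjugate_powR _ x (c `^ (p - 1))%R p (p / (p - 1))%R x0 (powR_ge0 _ _) p0
  (divr_gt0 p0 pp0).
rewrite -powRrM (_ : (p - 1) * (p / (p - 1)) = p)%R; last first.
  by field; rewrite subr_eq0 gt_eqF.
rewrite (_ : p^-1 + (p / (p - 1))^-1 = 1)%R; last first.
  by field; rewrite subr_eq0 !gt_eqF.
move=> /(_ erefl) h; rewrite [(_ * x)%R]mulrC.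
apply: (le_trans (ler_wpM2l (ltW p0) h)).
rewrite le_eqVlt; apply/orP; left; apply/eqP.
by field; rewrite subr_eq0 !gt_eqF.
Qed.

(** Integrate the tangent inequality at the mean c of f. When w vanishes on E
    the quotient is junk, but it is multiplied by zero. *)
Lemma jensen_powR (E : set T) (f w : T -> R) (p : R) : (1 < p)%R -> measurable E ->
  measurable_fun E f -> measurable_fun E w ->
  (forall x, 0 <= f x)%R -> (forall x, 0 <= w x)%R ->
  \int[mu]_(x in E) (w x)%:E < +oo -> \int[mu]_(x in E) (f x * w x)%:E < +oo ->
  ((fine (\int[mu]_(x in E) (f x * w x)%:E) / fine (\int[mu]_(x in E) (w x)%:E)) `^ p
    * fine (\int[mu]_(x in E) (w x)%:E))%:E <= \int[mu]_(x in E) (f x `^ p * w x)%:E.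
Proof.
move=> p1 mE mf mw f0 w0 woo fwoo; have p0 := lt_trans ltr01 p1.
have I0 : 0 <= \int[mu]_(x in E) (f x `^ p * w x)%:E.
  by apply: integral_ge0 => x _; rewrite lee_fin mulr_ge0 ?powR_ge0.
have W0 : 0 <= \int[mu]_(x in E) (w x)%:E.
  by apply: integral_ge0 => x _; rewrite lee_fin.
have F0 : 0 <= \int[mu]_(x in E) (f x * w x)%:E.
  by apply: integral_ge0 => x _; rewrite lee_fin mulr_ge0.
set W := \int[mu]_(x in E) (w x)%:E in W0 woo *.
set F := \int[mu]_(x in E) (f x * w x)%:E in F0 fwoo *.
have WE : W = (fine W)%:E by rewrite fineK// ge0_fin_numE.
have FE : F = (fine F)%:E by rewrite fineK// ge0_fin_numE.
have [S0|SN] := eqVneq (fine W) 0%R; first by rewrite S0 mulr0.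
have Sgt : (0 < fine W)%R by rewrite lt_neqAle eq_sym SN fine_ge0.
set c := (fine F / fine W)%R.
have c0 : (0 <= c)%R by rewrite divr_ge0 ?fine_ge0.
have mpw : measurable_fun E (fun x => (f x `^ p)%R).
  exact: measurableT_comp (measurable_powR p) mf.
have key : \int[mu]_(x in E) ((p * c `^ (p - 1)) * (f x * w x))%:E <=
    \int[mu]_(x in E) ((f x `^ p * w x)%:E + ((p - 1) * c `^ p * w x)%:E).
  apply: le_integral_any => x _; rewrite -EFinD lee_fin.
  have := powR_tangent p1 (f0 x) c0 => /(ler_wpM2r (w0 x)) h.
  rewrite -[(_ * w x + _)%R]mulrDl; apply: le_trans h.
  by rewrite !mulrA.
have e1 : (0 <= p * c `^ (p - 1))%R by rewrite mulr_ge0 ?powR_ge0// ltW.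
have e2 : (0 <= (p - 1) * c `^ p)%R by rewrite mulr_ge0 ?powR_ge0// subr_ge0 ltW.
move: key; rewrite ge0_integralD//; last 4 first.
- by move=> x _; rewrite lee_fin mulr_ge0 ?powR_ge0.
- by apply/measurable_EFinP; exact: measurable_funM.
- by move=> x _; rewrite lee_fin mulr_ge0.
- by apply/measurable_EFinP; exact: measurable_funM.
under eq_integral do rewrite EFinM.
rewrite ge0_integralZl_EFin//; last 2 first.
- by move=> x _; rewrite lee_fin mulr_ge0.
- by apply/measurable_EFinP; exact: measurable_funM.
under [X in _ <= _ + X -> _]eq_integral do rewrite EFinM.
rewrite ge0_integralZl_EFin//; last 2 first.
- by move=> x _; rewrite lee_fin.
- exact/measurable_EFinP.
rewrite -/F -/W FE WE -!EFinM.
have e3 : (p * c `^ (p - 1) * fine F = p * (c `^ p * fine W))%R.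
  by rewrite -(mulr_powRB1 c0 p0) {2}/c; field.
rewrite e3 -leeBlDr// -EFinB; apply: le_trans; rewrite lee_fin.
rewrite le_eqVlt; apply/orP; left; apply/eqP; rewrite [fine _%:E]/=.
by ring.
Qed.

End jensen.

(** * Atoms of a finite family of sets *)

Section atoms.
Context d (T : measurableType d) (R : realType) (mu : {measure set T -> \bar R}).
Variables (I : finType) (D : I -> set T).
Hypothesis mD : forall i, measurable (D i).

(** The sets D i to which x belongs; two points are in the same atom when they
    have the same pattern. Patterns that no point realises are excluded from
    the type of atoms, so that inclusion of the D i can be read off from the
    atoms, and the empty one because its atom can have infinite measure. *)
Definition pattern (x : T) : {set I} := finset (fun i => `[< D i x >]).

Definition atom : Type :=
  {A : {set I} | `[< exists x, pattern x = A >] && (A != finset.set0)}.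

HB.instance Definition _ := Finite.on atom.

Definition atom_set (A : atom) : set T := [set x | pattern x = val A].

Definition trace (i : I) : {set atom} := finset (fun A : atom => i \in val A).

Definition atom_mass (w : T -> R) (A : atom) : R :=
  fine (\int[mu]_(x in atom_set A) (w x)%:E).

Lemma in_pattern i x : (i \in pattern x) = `[< D i x >].
Proof. by rewrite inE. Qed.

Lemma atomP (A : atom) : (exists x, atom_set A x) /\ exists i, i \in val A.
Proof.
case: A => A /=; rewrite /atom_set/= => /andP[/asboolP h /finset.set0Pn].
by split.
Qed.

Lemma pattern_atom i x : D i x -> exists2 A : atom, A \in trace i & atom_set A x.
Proof.
move=> Dx.
have h : `[< exists y, pattern y = pattern x >] && (pattern x != finset.set0).
  apply/andP; split; first by apply/asboolP; exists x.
  by apply/finset.set0Pn; exists i; rewrite in_pattern; exact/asboolP.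
exists (exist _ (pattern x) h) => //.
by rewrite inE /= in_pattern; exact/asboolP.
Qed.

Lemma atom_sub A i : A \in trace i -> atom_set A `<=` D i.
Proof.
rewrite inE => iA x /= Ex; move: iA; rewrite -Ex in_pattern.
by move/asboolP.
Qed.

Lemma atom_setP A i x : atom_set A x -> (A \in trace i) = `[< D i x >].
Proof. by move=> /= Ex; rewrite inE -Ex in_pattern. Qed.

Lemma atom_uniq A B x : atom_set A x -> atom_set B x -> A = B.
Proof. by move=> /= Ax Bx; apply/val_inj; rewrite -Ax -Bx. Qed.

Lemma measurable_atom A : measurable (atom_set A).
Proof.
rewrite (_ : atom_set A = \bigcap_(i in [set: I]) (if i \in val A then D i else ~` D i)).
  by apply: fin_bigcap_measurable => // i _; case: ifP => // _; exact: measurableC.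
apply/seteqP; split => x /= h.
  move=> i _; rewrite -h in_pattern.
  by case: asboolP.
apply/finset.setP => i; rewrite in_pattern; have := h i Logic.I.
by case: ifP => _ /= ?; apply/asboolP.
Qed.

Lemma integral_trace (w : T -> \bar R) i : measurable_fun (D i) w ->
  (forall x, D i x -> 0 <= w x) ->
  \int[mu]_(x in D i) w x = \sum_(A in trace i) \int[mu]_(x in atom_set A) w x.
Proof.
move=> mw w0.
have DE : D i = \big[setU/set0]_(A <- enum (trace i)) atom_set A.
  rewrite -bigcup_seq; apply/seteqP; split => x.
    by move=> /pattern_atom[A Ai Ax]; exists A => //=; rewrite mem_enum.
  by case=> A /=; rewrite mem_enum => /atom_sub; exact.
rewrite {1}DE ge0_integral_bigsetU//.
- by rewrite big_enum.
- exact: measurable_atom.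
- exact: enum_uniq.
- apply/trivIsetP => A B _ _ /eqP AB; apply/seteqP; split => // x [Ax Bx].
  by apply: AB; exact: atom_uniq Ax Bx.
- by rewrite -DE.
- by rewrite -DE.
Qed.

Lemma atom_mass_ge0 (w : T -> R) A : (forall x, 0 <= w x)%R -> (0 <= atom_mass w A)%R.
Proof.
by move=> w0; apply: fine_ge0; apply: integral_ge0 => x _; rewrite lee_fin.
Qed.

Lemma atom_mass_fin (w : T -> R) A : measurable_fun setT w -> (forall x, 0 <= w x)%R ->
  (forall i, \int[mu]_(x in D i) (w x)%:E < +oo) ->
  (atom_mass w A)%:E = \int[mu]_(x in atom_set A) (w x)%:E.
Proof.
move=> mw w0 woo; have [_ [i iA]] := atomP A.
rewrite fineK// ge0_fin_numE; last by apply: integral_ge0 => x _; rewrite lee_fin.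
apply: le_lt_trans (woo i).
apply: ge0_subset_integral => //; first exact: measurable_atom.
- by apply: measurable_funTS; exact/measurable_EFinP.
- by move=> x _; rewrite lee_fin.
- by apply: atom_sub; rewrite inE.
Qed.

Lemma mass_trace (w : T -> R) i : measurable_fun setT w -> (forall x, 0 <= w x)%R ->
  (forall i, \int[mu]_(x in D i) (w x)%:E < +oo) ->
  (mass (atom_mass w) (trace i))%:E = \int[mu]_(x in D i) (w x)%:E.
Proof.
move=> mw w0 woo; rewrite integral_trace//; last 2 first.
- by apply: measurable_funTS; exact/measurable_EFinP.
- by move=> x _; rewrite lee_fin.
rewrite /mass -sumEFin; apply: eq_bigr => A _; exact: atom_mass_fin.
Qed.

Lemma sum_atoms_le (w : T -> \bar R) : measurable_fun setT w ->
  (forall x, 0 <= w x) ->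
  \sum_A \int[mu]_(x in atom_set A) w x <= \int[mu]_x w x.
Proof.
move=> mw w0.
rewrite -big_enum/= -ge0_integral_bigsetU//.
- apply: ge0_subset_integral => //.
  by apply: bigsetU_measurable => A _; exact: measurable_atom.
- exact: measurable_atom.
- exact: enum_uniq.
- apply/trivIsetP => A B _ _ /eqP AB; apply/seteqP; split => // x [Ax Bx].
  by apply: AB; exact: atom_uniq Ax Bx.
- exact: measurable_funTS.
Qed.

End atoms.

(** * Finite families of cubes *)

Lemma null_mul_integral d (T : measurableType d) (R : realType)
    (mu : {measure set T -> \bar R}) (E : set T) (f w : T -> R) : measurable E ->
  measurable_fun E f -> measurable_fun E w ->
  (forall x, 0 <= f x)%R -> (forall x, 0 <= w x)%R ->
  \int[mu]_(x in E) (w x)%:E = 0 -> \int[mu]_(x in E) (f x * w x)%:E = 0.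
Proof.
move=> mE mf mw f0 w0 W.
have mEw : measurable_fun E (EFin \o w) by exact/measurable_EFinP.
have mEfw : measurable_fun E (fun x => (f x * w x)%:E).
  by apply/measurable_EFinP; exact: measurable_funM.
have : \int[mu]_(x in E) `|(EFin \o w) x| = 0.
  by rewrite -[RHS]W; apply: eq_integral => x _ /=; rewrite ger0_norm.
move/(ae_eq_integral_abs mu mE mEw) => ae0.
have : \int[mu]_(x in E) `|(f x * w x)%:E| = 0.
  apply/(ae_eq_integral_abs mu mE mEfw).
  apply: filterS ae0 => x h Ex; have [->] := h Ex.
  by rewrite mulr0.
by move=> <-; apply: eq_integral => x _ /=; rewrite ger0_norm// mulr_ge0.
Qed.

Section cube_families.
Context {R : realType} {n : nat}.
Local Notation X := (Rn R n).
Implicit Types (u s w f : X -> R) (a : X) (r : R).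

Definition cube_mass w a r : R := fine (\int[leb]_(x in cube a r) (w x)%:E).

Definition cube_Apq u s (theta p q : R) a r : R :=
  ((r ^+ n) `^ (- theta) * cube_mass u a r `^ q^-1 * cube_mass s a r `^ (1 - p^-1))%R.

(** D i is a cube up to a null set. The cells of a dyadic grid are half-open in
    order to be disjoint, whereas the constants are suprema over closed cubes;
    the closed cube is recorded by its corner c i and side l i. *)
Record cube_family (I : finType) (D : I -> set X) (c : I -> X) (l : I -> R) : Prop :=
  CubeFamily {
    cf_pos : (0 < n)%N;
    cf_side : forall i, (0 < l i)%R;
    cf_meas : forall i, measurable (D i);
    cf_sub : forall i, D i `<=` cube (c i) (l i);
    cf_null : forall i, leb (cube (c i) (l i) `\` D i) = 0;
    cf_laminar : forall i j,
      [\/ D i `<=` D j, D j `<=` D i | D i `&` D j = set0];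
    cf_halving : forall i j, D i `<=` D j -> i != j ->
      (2 * l i ^+ n <= l j ^+ n)%R }.

Definition nonneg_measurable w := measurable_fun setT w /\ forall x, (0 <= w x)%R.

Variables (I : finType) (D : I -> set X) (c : I -> X) (l : I -> R).
Hypothesis cf : cube_family D c l.

Let mD i : measurable (D i). Proof. exact: cf_meas cf i. Qed.
Let l0 i : (0 < l i)%R. Proof. exact: cf_side cf i. Qed.
Let ln0 i : (0 < l i ^+ n)%R. Proof. by rewrite exprn_gt0. Qed.

Local Notation atom := (atom D).
Local Notation atom_mass := (@atom_mass _ X R leb I D).
Local Notation trace := (@trace _ X I D).

Lemma cube_integral w i : nonneg_measurable w ->
  \int[leb]_(x in cube (c i) (l i)) (w x)%:E = \int[leb]_(x in D i) (w x)%:E.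
Proof.
move=> [mw w0]; have mC := measurable_cube (c i) (l i).
have mN : measurable (cube (c i) (l i) `\` D i) by exact: measurableD.
rewrite (ge0_negligible_integral mN mC); last 3 first.
- by apply: measurable_funTS; exact/measurable_EFinP.
- by move=> x _; rewrite lee_fin.
- exact: cf_null cf i.
congr (integral _ _ _); rewrite setDD; apply/setIidPr; exact: cf_sub.
Qed.

Lemma leb_family i : leb (D i) = (l i ^+ n)%:E.
Proof.
have nm : nonneg_measurable (fun=> 1%R : R) by split=> [|x]; rewrite ?ler01.
have := cube_integral i nm; rewrite !integral_cst//; last exact: measurable_cube.
rewrite !mul1e => h; apply: etrans (leb_cube (c i) (l0 i)); exact: esym h.
Qed.

(** Equal cells with different indices would have to double their volume. *)
Lemma family_inj i j : D i = D j -> i = j.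
Proof.
move=> E; apply/eqP/negPn/negP => ij.
have h1 := cf_halving cf (i := i) (j := j); rewrite E in h1.
have h2 := cf_halving cf (i := j) (j := i); rewrite E in h2.
have := h1 (fun x h => h) ij; have := h2 (fun x h => h) _.
rewrite eq_sym ij => /(_ erefl); have := ln0 i; have := ln0 j; lra.
Qed.

Lemma trace_subset i j : (trace i \subset trace j) = `[< D i `<=` D j >].
Proof.
apply/fintype.subsetP/asboolP => [h x Dx|h A].
  by have [A Ai Ax] := pattern_atom Dx; exact: atom_sub (h _ Ai) _ Ax.
move=> Ai; have [[x Ax] _] := atomP A.
by rewrite (atom_setP j Ax); apply/asboolP/h; exact: (atom_sub Ai).
Qed.

Lemma trace_inj : injective trace.
Proof.
move=> i j E; apply: family_inj; apply/seteqP; split; apply/asboolP;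
  by rewrite -trace_subset E subxx.
Qed.

Definition traces : {set {set atom}} := finset.imset trace (mem [set: I]%SET).

Lemma tracesP Q : Q \in traces -> exists i, Q = trace i.
Proof. by move=> /imsetP[i _ ->]; exists i. Qed.

Definition leb_mass : atom -> R := atom_mass (fun=> 1%R).

Section weight_mass.
Variable w : X -> R.
Hypotheses (mw : nonneg_measurable w)
  (woo : forall i, \int[leb]_(x in D i) (w x)%:E < +oo).

Lemma mass_cube_mass i : mass (atom_mass w) (trace i) = cube_mass w (c i) (l i).
Proof.
have [m0 w0] := mw.
have := mass_trace mD i m0 w0 woo => /(congr1 fine) /= ->.
by rewrite /cube_mass cube_integral.
Qed.

End weight_mass.

Let nm1 : nonneg_measurable (fun=> 1%R : R).
Proof. by split=> [|x]; rewrite ?ler01. Qed.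

Let one_oo i : \int[leb]_(x in D i) (1%R)%:E < +oo :> \bar R.
Proof.
rewrite integral_cst// mul1e.
by rewrite [X in X < _]leb_family ltry.
Qed.

Lemma mass_leb_mass i : mass leb_mass (trace i) = (l i ^+ n)%R.
Proof.
rewrite /leb_mass mass_cube_mass//; rewrite /cube_mass integral_cst; last exact: measurable_cube.
by rewrite mul1e [X in fine X](leb_cube (c i) (l0 i)).
Qed.

Lemma tree_traces : tree leb_mass traces.
Proof.
split.
- move=> P Q /tracesP[i ->] /tracesP[j ->].
  case: (cf_laminar cf i j) => h.
  + by rewrite trace_subset; apply/or3P/Or31/asboolP.
  + by rewrite !trace_subset; apply/or3P/Or32/asboolP.
  + apply/or3P/Or33; rewrite disjoint_subset; apply/fintype.subsetP => A Ai.
    rewrite inE; apply/negP => Aj; have [[x Ax] _] := atomP A.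
    have : (D i `&` D j) x by split; [exact: atom_sub Ai _ Ax|exact: atom_sub Aj _ Ax].
    by rewrite h.
- by move=> A; apply: atom_mass_ge0 => x; rewrite ler01.
- by move=> Q /tracesP[i ->]; rewrite mass_leb_mass.
- move=> P Q /tracesP[i ->] /tracesP[j ->] ij; rewrite !mass_leb_mass.
  apply: (cf_halving cf).
    by apply/asboolP; rewrite -trace_subset; exact: proper_sub.
  by apply/eqP => E; move: ij; rewrite E fintype.properxx.
Qed.

Lemma jensen_atom f w (p : R) (A : atom) : (1 < p)%R ->
  nonneg_measurable f -> nonneg_measurable w ->
  (forall i, \int[leb]_(x in D i) (w x)%:E < +oo) ->
  (forall i, \int[leb]_(x in D i) (f x * w x)%:E < +oo) ->
  ((atom_mass (fun x => f x * w x)%R A / atom_mass w A) `^ p * atom_mass w A)%:E <=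
    \int[leb]_(x in atom_set A) (f x `^ p * w x)%:E.
Proof.
move=> p1 [mf f0] [mw w0] woo fwoo.
apply: jensen_powR => //; first exact: measurable_atom.
- exact: measurable_funTS.
- exact: measurable_funTS.
- by rewrite -(atom_mass_fin mD A mw w0 woo) ltry.
- have mfw : measurable_fun setT (fun x => f x * w x)%R by exact: measurable_funM.
  have fw0 x : (0 <= f x * w x)%R by rewrite mulr_ge0.
  by rewrite -(atom_mass_fin mD A mfw fw0 fwoo) ltry.
Qed.

Section pair.
Variables u s : X -> R.
Hypotheses (mu : nonneg_measurable u) (ms : nonneg_measurable s).
Hypotheses (uoo : forall i, \int[leb]_(x in D i) (u x)%:E < +oo)
  (soo : forall i, \int[leb]_(x in D i) (s x)%:E < +oo).
Variables (theta p q : R).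

Lemma tree_Apq_trace i : tree_Apq leb_mass (atom_mass u) (atom_mass s) theta p q (trace i) =
  cube_Apq u s theta p q (c i) (l i).
Proof. by rewrite /tree_Apq mass_leb_mass !mass_cube_mass. Qed.

Lemma density_trace i : density leb_mass (atom_mass s) (trace i) =
  (cube_mass s (c i) (l i) / l i ^+ n)%R.
Proof. by rewrite /density mass_leb_mass mass_cube_mass. Qed.

(** The atoms inherit the square root: by Jensen, the square of its average over
    an atom, times the volume of the atom, is at most the mass of s there. *)
Lemma packed_traces_sqrt (B : R) : (0 < q)%R -> (0 <= B)%R ->
  (forall i, cube_Apq u s theta p q (c i) (l i) `^ q * cube_mass s (c i) (l i) <=
    B `^ q * (l i ^+ n * (cube_mass (fun x => Num.sqrt (s x)) (c i) (l i) / l i ^+ n) `^ 2))%R ->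
  packed leb_mass (atom_mass u) (atom_mass s) traces theta p q (B * sparse_const R `^ q^-1).
Proof.
move=> q0 B0 H; have [ms' s0] := ms.
have nms : nonneg_measurable (fun x => Num.sqrt (s x)).
  split=> [|x]; last exact: sqrtr_ge0.
  exact: measurableT_comp (continuous_measurable_fun (@sqrt_continuous R)) ms'.
have [mh h0] := nms.
have sq_le x : (Num.sqrt (s x) <= 1 + s x)%R.
  by have := sqr_sqrtr (s0 x); have := sqrtr_ge0 (s x); nra.
have hoo i : \int[leb]_(x in D i) (Num.sqrt (s x))%:E < +oo.
  apply: (@le_lt_trans _ _ (\int[leb]_(x in D i) ((1%R)%:E + (s x)%:E))).
    by apply: le_integral_any => x _; rewrite -EFinD lee_fin.
  have ms1 : measurable_fun (D i) (EFin \o s).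
    by apply: measurable_funTS; apply/measurable_EFinP; exact: ms'.
  have s1 x : D i x -> 0 <= (EFin \o s) x by move=> _; rewrite lee_fin.
  have c1 : measurable_fun (D i) (fun=> (1%R)%:E : \bar R) by exact: measurable_cst.
  have c2 (x : X) : D i x -> 0 <= (1%R)%:E :> \bar R by move=> _; rewrite lee_fin.
  rewrite (ge0_integralD leb (mD i) c2 c1 s1 ms1).
  by apply: lte_add_pinfty; [exact: one_oo|exact: soo].
pose h (A : atom) := (atom_mass (fun x => Num.sqrt (s x)) A / leb_mass A)%R.
have mea (A : atom) : measurable (atom_set A) by exact: measurable_atom.
have mwA (A : atom) (w : X -> R) : measurable_fun setT w -> measurable_fun (atom_set A) w.
  by move=> ?; exact: measurable_funTS.
have fin1 (A : atom) : (leb_mass A)%:E = \int[leb]_(x in atom_set A) (1%R)%:E.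
  exact: (atom_mass_fin mD A nm1.1 nm1.2 one_oo).
have finh (A : atom) : (atom_mass (fun x => Num.sqrt (s x)) A)%:E =
    \int[leb]_(x in atom_set A) (Num.sqrt (s x))%:E.
  exact: (atom_mass_fin mD A mh h0 hoo).
have hm (A : atom) : (h A * leb_mass A = atom_mass (fun x => Num.sqrt (s x)) A)%R.
  rewrite /h; have [E|N] := eqVneq (leb_mass A) 0%R; last by rewrite divfK.
  rewrite E mulr0; apply/esym/EFin_inj; rewrite finh.
  under eq_integral do rewrite -(mulr1 (Num.sqrt _)).
  apply: (null_mul_integral (mea A) (mwA A _ mh) (mwA A _ nm1.1) h0 nm1.2).
  by rewrite -fin1 E.
apply: (packed_sqrt (h := h)) => //.
- exact: tree_traces.
- by move=> A; exact: atom_mass_ge0.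
- by move=> A; rewrite divr_ge0// atom_mass_ge0.
- move=> A; rewrite -lee_fin (atom_mass_fin mD A ms' s0 soo).
  have E1 : (fun x => Num.sqrt (s x) * 1)%R = (fun x => Num.sqrt (s x)).
    by apply/funext => x; rewrite mulr1.
  have hoo1 i : \int[leb]_(x in D i) (Num.sqrt (s x) * 1)%:E < +oo.
    by under eq_integral do rewrite mulr1.
  have := @jensen_atom (fun x => Num.sqrt (s x)) (fun=> 1%R) 2 A.
  rewrite E1 ltr1n => /(_ erefl nms nm1 one_oo hoo1) H2; apply: (le_trans H2).
  apply: le_integral_any => x _; rewrite mulr1 lee_fin.
  by rewrite powR_mulrn ?sqrtr_ge0// sqr_sqrtr.
- move=> S /tracesP[i ->]; rewrite tree_Apq_trace mass_leb_mass mass_cube_mass//.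
  apply: le_trans (H i) _; rewrite le_eqVlt; apply/orP; left; apply/eqP.
  congr (_ * (_ * _ `^ _))%R; rewrite /mean mass_leb_mass; congr (_ / _)%R.
  rewrite -mass_cube_mass//; apply: eq_bigr => A _; exact/esym/hm.
Qed.

Lemma le_avg_maximal w (Q : set X) x : is_cube Q -> Q x ->
  avg Q (fun y => `|w y|%:E) <= maximal w x.
Proof. by move=> cQ Qx; apply: ereal_sup_ubound; exists Q. Qed.

Lemma maximal_ge0 w t x : cube (c t) (l t) x -> 0 <= maximal w x.
Proof.
move=> Cx; have cC : is_cube (cube (c t) (l t)) by exists (c t), (l t).
apply: le_trans (le_avg_maximal w cC Cx).
by rewrite /avg mule_ge0 ?inve_ge0 ?measure_ge0// integral_ge0.
Qed.

(** The maximal function of the tree is constant on each atom, and it is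
    dominated there by the Hardy-Littlewood maximal function of s restricted to
    the top cube, as all cubes involved lie inside that cube. *)
Lemma packed_traces_max (A0 K : R) : (0 < q)%R -> (0 <= A0)%R -> (0 <= K)%R ->
  (forall i, cube_Apq u s theta p q (c i) (l i) <= A0)%R ->
  (forall i, \int[leb]_(x in cube (c i) (l i))
      maximal (fun y => s y * \1_(cube (c i) (l i)) y)%R x <=
    (K * cube_mass s (c i) (l i))%:E) ->
  packed leb_mass (atom_mass u) (atom_mass s) traces theta p q (A0 * (4 * K) `^ q^-1).
Proof.
move=> q0 A00 K0 HA HK; have [ms' s0] := ms.
apply: packed_maximal => //.
- exact: tree_traces.
- by move=> A; exact: atom_mass_ge0.
- by move=> S /tracesP[i ->]; rewrite tree_Apq_trace.
move=> T /tracesP[t ->]; rewrite mass_cube_mass//.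
set C := cube (c t) (l t); have mC : measurable C by exact: measurable_cube.
set rho := fun A : atom => sup_above (below traces (trace t)) (density leb_mass (atom_mass s)) [set A]%SET.
have rho_ge0 A : (0 <= rho A)%R by exact: sup_above_ge0.
have mea (A : atom) : measurable (atom_set A) by exact: measurable_atom.
have atomC A : A \in trace t -> atom_set A `<=` C.
  by move=> At x Ax; apply: (cf_sub cf); exact: (atom_sub At Ax).
have rho_att A : (0 < rho A)%R -> exists i, [/\ A \in trace i, D i `<=` D t &
    rho A = density leb_mass (atom_mass s) (trace i)].
  move=> /sup_above_attained[Q []]; rewrite inE => /andP[/tracesP[i ->] it] Ai E.
  exists i; rewrite /rho -E; split => //; first by rewrite -finset.sub1set.
  by apply/asboolP; rewrite -trace_subset.
pose phi x := (\sum_A rho A * \1_(atom_set A) x)%R.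
rewrite -lee_fin; apply: le_trans (HK t); rewrite -/C.
apply: (@le_trans _ _ (\int[leb]_(x in C) (phi x)%:E)).
  under eq_integral do rewrite -sumEFin.
  have mphi A : measurable_fun C (fun x => (rho A * \1_(atom_set A) x)%:E).
    apply: measurable_funTS; apply/measurable_EFinP; apply: measurable_funM.
      exact: measurable_cst.
    exact: measurable_indic (mea A).
  have phi0 A x : C x -> 0 <= (rho A * \1_(atom_set A) x)%:E.
    by move=> _; rewrite lee_fin mulr_ge0.
  rewrite (ge0_integral_sum leb mC mphi phi0).
  rewrite -sumEFin; apply: lee_sum => A _; rewrite -/(rho A).
  under eq_integral do rewrite EFinM.
  have mi : measurable_fun C (fun x => (\1_(atom_set A) x)%:E : \bar R).
    by apply: measurable_funTS; apply/measurable_EFinP; exact: measurable_indic (mea A).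
  rewrite (ge0_integralZl_EFin leb mC _ mi (rho_ge0 A)); last first.
    by move=> x _; rewrite lee_fin.
  rewrite (integral_indic leb mC (mea A)) EFinM.
  have [At|At] := boolP (A \in trace t).
    rewrite setIidl; last exact: atomC.
    rewrite (atom_mass_fin mD A nm1.1 nm1.2 one_oo) integral_cst//.
    by rewrite mul1e.
  have -> : rho A = 0%R.
    apply/eqP; rewrite eq_le rho_ge0 andbT leNgt; apply/negP => /rho_att[i [Ai it _]].
    by move/negP: At; apply; apply: (fintype.subsetP _ _ Ai); rewrite trace_subset; exact/asboolP.
  by rewrite !mul0e.
apply: le_integral_any => x Cx.
have [[A Ax]|nA] := pselect (exists A : atom, atom_set A x); last first.
  rewrite /phi big1 ?maximal_ge0 => [|A _]; first exact: maximal_ge0 Cx.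
  rewrite indicE memNset ?mulr0// => Ax; apply: nA; by exists A.
have -> : phi x = rho A.
  rewrite /phi (bigD1 A)//= indicE mem_set// mulr1 big1 ?addr0// => B BA.
  rewrite indicE memNset ?mulr0// => Bx; move/eqP: BA; apply.
  exact: atom_uniq Bx Ax.
have [r0|r0] := ltP 0%R (rho A); last first.
  by apply: (@le_trans _ _ 0); [rewrite lee_fin|exact: maximal_ge0 Cx].
have [i [Ai it ->]] := rho_att _ r0.
have cI : is_cube (cube (c i) (l i)) by exists (c i), (l i).
have Ix : cube (c i) (l i) x by apply: (cf_sub cf); exact: (atom_sub Ai Ax).
apply: le_trans (le_avg_maximal _ cI Ix).
rewrite density_trace /avg leb_cube// inver gt_eqF// mulrC EFinM lee_pmul2l ?lte_fin ?invr_gt0//.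
have mI : measurable (cube (c i) (l i)) by exact: measurable_cube.
rewrite /cube_mass cube_integral// fineK; last first.
  by rewrite ge0_fin_numE// integral_ge0// => y _; rewrite lee_fin.
have msC : measurable_fun setT (fun y => s y * \1_C y)%R.
  by apply: measurable_funM ms' _; exact: measurable_indic mC.
apply: (@le_trans _ _ (\int[leb]_(y in D i) `|s y * \1_C y|%:E)).
  apply: le_integral_any => y Dy; rewrite lee_fin indicE mem_set ?mulr1 ?ler_norm//.
  by apply: (cf_sub cf); exact: it.
have msC1 : measurable_fun (cube (c i) (l i)) (fun y => `|s y * \1_C y|%:E).
  apply: measurable_funTS; apply/measurable_EFinP.
  exact: measurableT_comp (@normr_measurable R setT) msC.
apply: (ge0_subset_integral leb (mD i) mI msC1); last exact: cf_sub.
by move=> y _; rewrite lee_fin.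
Qed.

End pair.

Section bound.
Variables u s f : X -> R.
Hypotheses (mu : nonneg_measurable u) (ms : nonneg_measurable s)
  (mf : nonneg_measurable f).
Hypotheses (uoo : forall i, \int[leb]_(x in D i) (u x)%:E < +oo)
  (soo : forall i, \int[leb]_(x in D i) (s x)%:E < +oo).
Variables (theta p q p1 q1 B1 B2 : R).
Hypotheses (t0 : (0 < theta)%R) (t1 : (theta < 1)%R) (p_gt1 : (1 < p)%R)
  (pq : (p < q)%R) (q1_gt1 : (1 < q1)%R) (qp1 : (q1 < p1)%R)
  (pp1 : (p^-1 + p1^-1 = 1)%R) (qq1 : (q^-1 + q1^-1 = 1)%R)
  (B10 : (0 <= B1)%R) (B20 : (0 <= B2)%R).
Hypothesis pk1 : packed leb_mass (atom_mass u) (atom_mass s) traces theta p q B1.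
Hypothesis pk2 : packed leb_mass (atom_mass s) (atom_mass u) traces theta q1 p1 B2.
Hypothesis fp_oo : \int[leb]_x (f x `^ p * s x)%:E < +oo.

Let fs x := (f x * s x)%R.

Let nmfs : nonneg_measurable fs.
Proof.
by split=> [|x]; [exact: measurable_funM mf.1 ms.1|rewrite mulr_ge0 ?mf.2 ?ms.2].
Qed.

Let mfp : measurable_fun setT (fun x => f x `^ p * s x)%R.
Proof.
by apply: measurable_funM ms.1; exact: measurableT_comp (measurable_powR p) mf.1.
Qed.

Let fp0 x : (0 <= f x `^ p * s x)%R.
Proof. by rewrite mulr_ge0 ?powR_ge0 ?ms.2. Qed.

(** f s <= s + f^p s, by comparing f with 1. *)
Lemma integral_fs_lty i : \int[leb]_(x in D i) (fs x)%:E < +oo.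
Proof.
apply: (@le_lt_trans _ _ (\int[leb]_(x in D i) ((s x)%:E + (f x `^ p * s x)%:E))).
  apply: le_integral_any => x _; rewrite -EFinD lee_fin /fs.
  have := ms.2 x => sx; have := mf.2 x => fx.
  rewrite -{2}[s x]mul1r -mulrDl ler_wpM2r//.
  have [f1|f1] := leP (f x) 1%R; first by rewrite ler_wpDr ?powR_ge0.
  by rewrite ler_wpDl// le1r_powR// ltW.
have ms1 : measurable_fun (D i) (EFin \o s).
  by apply: measurable_funTS; apply/measurable_EFinP; exact: ms.1.
have s1 x : D i x -> 0 <= (EFin \o s) x by move=> _; rewrite lee_fin ms.2.
have mfp1 : measurable_fun setT (fun x => (f x `^ p * s x)%:E).
  by apply/measurable_EFinP; exact: mfp.
have fp1 (E : set X) x : E x -> 0 <= (f x `^ p * s x)%:E by move=> _; rewrite lee_fin.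
rewrite (ge0_integralD leb (mD i) s1 ms1 (@fp1 (D i)) (measurable_funTS mfp1)).
apply: lte_add_pinfty; first exact: soo.
apply: le_lt_trans fp_oo.
exact: (ge0_subset_integral leb (mD i) measurableT mfp1 (@fp1 setT)).
Qed.

(** The s-average of f over an atom; integrals of f s over cells are unchanged
    when f is replaced by these averages. *)
Let fA (A : atom) := (atom_mass fs A / atom_mass s A)%R.

Let fA_mass A : (fA A * atom_mass s A = atom_mass fs A)%R.
Proof.
rewrite /fA; have [E|N] := eqVneq (atom_mass s A) 0%R; last by rewrite divfK.
rewrite E mulr0; apply/esym/EFin_inj.
rewrite (atom_mass_fin mD A nmfs.1 nmfs.2 integral_fs_lty).
apply: null_mul_integral => //.
- exact: measurable_atom.
- exact: measurable_funTS mf.1.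
- exact: measurable_funTS ms.1.
- exact: mf.2.
- exact: ms.2.
- by rewrite -(atom_mass_fin mD A ms.1 ms.2 soo) E.
Qed.

Let coef i := ((l i ^+ n) `^ (- theta) * fine (\int[leb]_(x in D i) (fs x)%:E))%R.

(** The dyadic operator and its norm only involve integrals over atoms, except
    for the norm of f, and this does not increase under averaging. *)
Lemma family_bound :
  \int[leb]_x ((\sum_i coef i * \1_(D i) x) `^ q * u x)%:E <=
  ((form_const theta p q p1 q1 * (B1 + B2)) `^ q *
    fine (\int[leb]_x (f x `^ p * s x)%:E) `^ (q / p))%:E.
Proof.
have p0 := lt_trans ltr01 p_gt1; have q0 := lt_trans p0 pq.
have mea (A : atom) : measurable (atom_set A) by exact: measurable_atom.
pose S (A : atom) := (\sum_(Q in traces | A \in Q) mass leb_mass Q `^ (- theta) *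
    mass (fun A => fA A * atom_mass s A) Q)%R.
have SE A : S A = (\sum_(i | A \in trace i) coef i)%R.
  rewrite /S /traces big_mkcondr/= big_imset/=; last by move=> i j _ _; exact: trace_inj.
  rewrite [RHS]big_mkcond; apply: eq_big => [i|i _]; first by rewrite inE.
  case: ifP => // _; rewrite mass_leb_mass /coef; congr (_ * _)%R.
  have := mass_trace mD i nmfs.1 nmfs.2 integral_fs_lty => /(congr1 fine)/= <-.
  by apply: eq_bigr => A' _; exact: fA_mass.
have ptw x : ((\sum_i coef i * \1_(D i) x) `^ q * u x =
    \sum_A S A `^ q * (u x * \1_(atom_set A) x))%R.
  have [[A Ax]|nA] := pselect (exists A : atom, atom_set A x); last first.
    rewrite [X in (X `^ q)%R]big1 => [|i _].
      rewrite powR0 ?gt_eqF// mul0r big1// => A _.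
      rewrite indicE memNset ?mulr0// => Ax; apply: nA; by exists A.
    rewrite indicE memNset ?mulr0// => Dx.
    by have [A _ Ax] := pattern_atom Dx; apply: nA; exists A.
  rewrite [RHS](bigD1 A)//= indicE mem_set// mulr1 [X in (_ + X)%R]big1 ?addr0 => [|B BA].
    congr (_ `^ q * _)%R; rewrite SE [RHS]big_mkcond; apply: eq_bigr => i _.
    rewrite (atom_setP i Ax) indicE; case: asboolP => h.
      by rewrite mem_set// mulr1.
    by rewrite memNset// mulr0.
  rewrite indicE memNset ?mulr0// => Bx; move/eqP: BA; apply.
  exact: atom_uniq Bx Ax.
have lhsE : \int[leb]_x ((\sum_i coef i * \1_(D i) x) `^ q * u x)%:E =
    (\sum_A S A `^ q * atom_mass u A)%:E.
  under eq_integral do rewrite ptw -sumEFin.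
  have mui (A : atom) : measurable_fun setT (fun x => u x * \1_(atom_set A) x)%R.
    by apply: measurable_funM mu.1 _; exact: measurable_indic (mea A).
  have ui0 (A : atom) x : setT x -> 0 <= (u x * \1_(atom_set A) x)%:E.
    by move=> _; rewrite lee_fin mulr_ge0 ?mu.2.
  have mSui (A : atom) : measurable_fun setT
      (fun x => (S A `^ q * (u x * \1_(atom_set A) x))%:E).
    by apply/measurable_EFinP; apply: measurable_funM (measurable_cst _) (mui A).
  have Sui0 (A : atom) x : setT x -> 0 <= (S A `^ q * (u x * \1_(atom_set A) x))%:E.
    by move=> _; rewrite lee_fin !mulr_ge0 ?powR_ge0 ?mu.2.
  rewrite (ge0_integral_sum leb measurableT mSui Sui0).
  rewrite -sumEFin; apply: eq_bigr => A _; rewrite EFinM.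
  rewrite (atom_mass_fin mD A mu.1 mu.2 uoo).
  under eq_integral do rewrite EFinM.
  have mui' : measurable_fun setT (fun x => (u x * \1_(atom_set A) x)%:E).
    by apply/measurable_EFinP; exact: mui.
  rewrite (ge0_integralZl_EFin leb measurableT (@ui0 A) mui' (powR_ge0 _ _)).
  congr (_ * _); rewrite [RHS]integral_mkcond; apply: eq_integral => x _.
  rewrite patchE indicE; case: ifPn => xA; first by rewrite mulr1.
  by rewrite mulr0.
rewrite lhsE lee_fin.
have u0 A : (0 <= atom_mass u A)%R by apply: atom_mass_ge0; exact: mu.2.
have s0 A : (0 <= atom_mass s A)%R by apply: atom_mass_ge0; exact: ms.2.
have fA0 A : (0 <= fA A)%R.
  by rewrite divr_ge0// atom_mass_ge0//; exact: nmfs.2.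
have K0 : (0 <= form_const theta p q p1 q1 * (B1 + B2))%R.
  apply: mulr_ge0; last exact: addr_ge0.
  by rewrite ltW// addr_gt0// mulr_gt0 ?half_const_gt0 ?testing_const_gt0.
have := operator_le tree_traces u0 s0 fA0 t0 t1 p_gt1 pq q1_gt1 qp1 pp1 qq1 B10 B20 pk1 pk2.
move=> H; apply: (le_trans H); rewrite ler_wpM2l ?powR_ge0//.
have I0 : 0 <= \int[leb]_x (f x `^ p * s x)%:E.
  by apply: integral_ge0 => x _; rewrite lee_fin.
apply: ge0_ler_powR; rewrite ?nnegrE ?fine_ge0// ?divr_ge0 ?(ltW p0) ?(ltW q0)//.
  by apply: sumr_ge0 => A _; rewrite mulr_ge0 ?powR_ge0.
rewrite -lee_fin fineK ?ge0_fin_numE//.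
have mfp1 : measurable_fun setT (fun x => (f x `^ p * s x)%:E).
  by apply/measurable_EFinP; exact: mfp.
have fp1 x : 0 <= (f x `^ p * s x)%:E by rewrite lee_fin.
apply: le_trans (sum_atoms_le leb mD mfp1 fp1).
rewrite -sumEFin; apply: lee_sum => A _.
exact: jensen_atom integral_fs_lty.
Qed.

End bound.

End cube_families.

(** * Two dyadic grids on the line *)

Section one_dimensional_grids.
Local Open Scope ring_scope.
Variable R : realType.
Implicit Types (x y : R) (k z : int) (e : bool).

(** The shift by a third of a side alternates in direction with the scale:
    s 2^(-k)/3 and -s 2^(-k-1)/3 differ by s 2^(-k-1), a whole number of sides
    of the finer grid, which makes the shifted grid nested. *)
Definition grid_sign k : int := (-1) ^ k.

Definition grid_shift e k : R := e%:R * (grid_sign k)%:~R / 3.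

(** Cells with index k have side 2^(-k), so that larger k are finer. *)
Definition cell_index e k x : int := Num.floor (2 ^ k * x - grid_shift e k).

Lemma grid_sign_cases k : grid_sign k = 1 \/ grid_sign k = -1.
Proof.
rewrite /grid_sign; case: k => k; rewrite /exprz -signr_odd.
  by case: (odd k); [right|left].
by case: (odd _); [right; rewrite invrN1|left; rewrite invr1].
Qed.

Lemma grid_signS k : grid_sign (k + 1) = - grid_sign k.
Proof. by rewrite /grid_sign exprzDr ?unitrN1// expr1z mulrN1. Qed.

Lemma cell_indexE e k x z : (cell_index e k x == z) =
  (z%:~R + grid_shift e k <= 2 ^ k * x < (z + 1)%:~R + grid_shift e k).
Proof. by rewrite /cell_index floor_eq lerBrDr ltrBlDr. Qed.

Lemma cell_index_coarsen e k x y : cell_index e (k + 1) x = cell_index e (k + 1) y ->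
  cell_index e k x = cell_index e k y.
Proof.
set z := cell_index e (k + 1) x => yz.
have : cell_index e (k + 1) x == z by [].
have : cell_index e (k + 1) y == z by rewrite yz.
set a := cell_index e k x; have : cell_index e k x == a by [].
rewrite !cell_indexE => ax yb xb; apply/esym/eqP; rewrite cell_indexE.
move: xb yb ax; rewrite /grid_shift grid_signS expfzDr ?pnatr_eq0// expr1z.
set s := grid_sign k; rewrite !intrD !mulrNz.
rewrite (mulrC _ 2) -!(mulrA 2).
set X := 2 ^ k * x; set Y := 2 ^ k * y.
move=> /andP[x1 x2] /andP[y1 y2] /andP[a1 a2].
(* With z the index on the finer grid, and a, s the index and the sign on the
   coarser one, the cell a consists of the two finer cells with indices
   2a + es and 2a + es + 1. *)
pose E : int := e; have EE : (E%:~R = e%:R :> R) by [].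
have zlo : (2 * a + E * s <= z).
  by rewrite -ltzD1 -(ltr_int R) !(intrD, intrM) EE ?mulr1z; lra.
have zhi : (z < 2 * a + E * s + 2).
  by rewrite -(ltr_int R) !(intrD, intrM) EE ?mulr1z; lra.
move: zlo zhi; rewrite -lezD1 -!(ler_int R) !(intrD, intrM) EE ?mulr1z => zlo zhi.
by apply/andP; split; lra.
Qed.

Lemma cell_index_coarsen_nat e k (j : nat) x y :
  cell_index e (k + j%:Z) x = cell_index e (k + j%:Z) y -> cell_index e k x = cell_index e k y.
Proof.
elim: j => [|j IH]; first by rewrite addr0.
by rewrite -addn1 PoszD addrA => /cell_index_coarsen.
Qed.

Lemma cell_index_coarsen_le e k k' x y : k <= k' ->
  cell_index e k' x = cell_index e k' y -> cell_index e k x = cell_index e k y.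
Proof.
move=> kk' H; apply: (@cell_index_coarsen_nat e k `|k' - k|%N).
by rewrite gez0_abs ?subr_ge0// subrKC.
Qed.

(** Otherwise the interval between x and y contains an endpoint of each of the
    two grids, and these are a third of a side apart from each other. *)
Lemma third_trick k x y : `|x - y| * 2 ^ k < 3^-1 ->
  exists e, cell_index e k x = cell_index e k y.
Proof.
wlog xy : x y / x <= y.
  move=> W H; have [h|h] := leP x y; first exact: W.
  have [||e E] := W y x; [exact: ltW|by rewrite distrC|by exists e].
have p0 : 0 < 2 ^ k :> R by rewrite exprz_gt0.
rewrite distrC ger0_norm ?subr_ge0// mulrC mulrBr => H.
have [E|N] := eqVneq (cell_index false k x) (cell_index false k y); first by exists false.
exists true.
have XY : 2 ^ k * x <= 2 ^ k * y by rewrite ler_pM2l.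
have cross e : cell_index e k x != cell_index e k y ->
    2 ^ k * x < (cell_index e k y)%:~R + grid_shift e k <= 2 ^ k * y.
  move=> ne; have := eqxx (cell_index e k y); rewrite {1}cell_indexE => /andP[h1 h2].
  rewrite h1 andbT ltNge; apply: contra ne => h3; rewrite cell_indexE.
  by rewrite h3/=; exact: le_lt_trans XY h2.
apply/eqP/negPn/negP => N'.
have := cross _ N; have := cross _ N'; rewrite /grid_shift mul0r mul0r addr0 mul1r.
set a := cell_index true k y; set b := cell_index false k y => /andP[a1 a2] /andP[b1 b2].
have : b - a = 0 \/ (b - a <= -1 \/ 1 <= b - a).
  have [h|h|->] := ltgtP a b; [right; right|right; left|left; rewrite subrr//].
    by rewrite lerBrDr -lezD1 addrC in h *.
  by rewrite lerBlDr; move: h; rewrite -lezD1; lra.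
case: (grid_sign_cases k) => E; rewrite E in a1 a2.
- case=> [/eqP|[]]; rewrite -?(ler_int R) -?(eqr_int R) intrB ?mulrNz.
  + by move=> /eqP; lra.
  + by lra.
  + by lra.
- rewrite mulrNz in a1 a2.
  case=> [/eqP|[]]; rewrite -?(ler_int R) -?(eqr_int R) intrB ?mulrNz.
  + by move=> /eqP; lra.
  + by lra.
  + by lra.
Qed.

End one_dimensional_grids.

(** * Shifted dyadic grids and the Riesz kernel *)

Section grids.
Context {R : realType} {n : nat}.
Local Notation X := (Rn R n).
Local Notation shift := {ffun 'I_n -> bool}.
Local Notation code := (int * {ffun 'I_n -> int})%type.
Implicit Types (t : shift) (k : int) (z : {ffun 'I_n -> int}) (v : code).

Definition grid_cell t v : set X :=
  [set x | forall i, cell_index (t i) v.1 (tnth x i) = v.2 i].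

Definition grid_side k : R := ((2 : R) ^ k)^-1%R.

Definition grid_corner t v : X :=
  [tuple (((v.2 i)%:~R + grid_shift R (t i) v.1) * grid_side v.1)%R | i < n].

Lemma grid_side_gt0 k : (0 < grid_side k)%R.
Proof. by rewrite invr_gt0 exprz_gt0. Qed.

Lemma grid_cellE t v : grid_cell t v = [set x : n.-tuple R | forall i,
  `[tnth (grid_corner t v) i, (tnth (grid_corner t v) i + grid_side v.1)%R[%classic (tnth x i)].
Proof.
have p0 : (0 < (2 : R) ^ v.1)%R by rewrite exprz_gt0.
have E x i : (cell_index (t i) v.1 (tnth x i) == v.2 i) =
    (tnth (grid_corner t v) i <= tnth x i < tnth (grid_corner t v) i + grid_side v.1)%R.
  rewrite cell_indexE tnth_mktuple /grid_side ler_pdivrMr// mulrC; congr (_ && _).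
  rewrite -{2}[(_ ^ _)^-1%R]mul1r -mulrDl ltr_pdivlMr// mulrC.
  by rewrite intrD addrAC.
apply/seteqP; split => x /= h i; first by rewrite in_itv/= -E; exact/eqP.
by apply/eqP; have := h i; rewrite in_itv/= E.
Qed.

Lemma measurable_grid_cell t v : measurable (grid_cell t v).
Proof.
apply: borel_measurable_Rn; rewrite grid_cellE.
have mA (i : 'I_n) : measurable `[tnth (grid_corner t v) i,
  (tnth (grid_corner t v) i + grid_side v.1)%R[%classic by [].
exact: (measurable_box mA).
Qed.

Lemma grid_cell_sub_cube t v : grid_cell t v `<=` cube (grid_corner t v) (grid_side v.1).
Proof.
rewrite grid_cellE => x /= h i; have := h i; rewrite in_itv/= => /andP[-> /ltW].
by [].
Qed.

Lemma grid_corner_in t v : grid_cell t v (grid_corner t v).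
Proof.
by rewrite grid_cellE => i; rewrite /= in_itv/= lexx ltrDl grid_side_gt0.
Qed.

(** The difference lies in the upper faces, which are boxes with one degenerate
    side. *)
Lemma grid_cell_null t v : leb (cube (grid_corner t v) (grid_side v.1) `\` grid_cell t v) = 0.
Proof.
set a := grid_corner t v; set r := grid_side v.1.
have r0 : (0 < r)%R by exact: grid_side_gt0.
pose lo i j := if j == i then (tnth a j + r)%R else tnth a j.
pose face i : set (n.-tuple R) := [set x | forall j, (lo i j <= tnth x j <= tnth a j + r)%R].
have le_lo i j : (lo i j <= tnth a j + r)%R.
  by rewrite /lo; case: ifP => // _; rewrite lerDl ltW.
have mface i : @measurable _ (n.-tuple R) (face i).
  have mA (j : 'I_n) : measurable `[lo i j, (tnth a j + r)%R]%classic by [].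
  rewrite (_ : face i = [set x | forall j, `[lo i j, (tnth a j + r)%R]%classic (tnth x j)]).
    exact: (measurable_box mA).
  by apply/seteqP; split => x /= h j; have := h j; rewrite in_itv.
have face0 i : leb (face i : set X) = 0.
  rewrite leb_borelE// (borel_leb_box (a := lo i) (b := fun j => tnth a j + r)%R)//.
  by rewrite (bigD1 i)//= /lo eqxx subrr mul0r.
have sub : cube a r `\` grid_cell t v `<=` \big[setU/set0]_(i < n) (face i : set X).
  rewrite grid_cellE => x [/= Cx nx].
  apply: contrapT => H; apply: nx => i; rewrite /= in_itv/=.
  have /andP[h1 h2] := Cx i; rewrite h1/= lt_neqAle h2 andbT; apply/eqP => E.
  apply: H; rewrite (bigD1 i)//=; left => j; rewrite /lo.
  by case: eqP => [->|_]; [rewrite -E lexx|exact: Cx].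
have mD : measurable (cube a r `\` grid_cell t v).
  by apply: measurableD; [exact: measurable_cube|exact: measurable_grid_cell].
apply: (measure_negligible mD); apply: negligibleS sub _.
elim/big_ind : _ => [||i _]; [exact: negligible_set0|exact: negligibleU|].
by apply/negligibleP; [exact: borel_measurable_Rn|exact: face0].
Qed.

Lemma grid_cell_nested t v w x : (v.1 <= w.1)%R -> grid_cell t v x -> grid_cell t w x ->
  grid_cell t w `<=` grid_cell t v.
Proof.
move=> vw vx wx y wy i; rewrite -(vx i).
by apply: (cell_index_coarsen_le vw); rewrite (wx i) (wy i).
Qed.

Lemma leb_grid_cell t v : leb (grid_cell t v) = (grid_side v.1 ^+ n)%:E.
Proof.
rewrite -(leb_cube (grid_corner t v) (grid_side_gt0 v.1)).
have mC := measurable_cube (grid_corner t v) (grid_side v.1).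
apply/esym; have E := measureDI leb mC (measurable_grid_cell t v).
apply: etrans E _; rewrite [X in X + _](grid_cell_null t v) add0e.
by congr (leb _); apply/setIidPr; exact: grid_cell_sub_cube.
Qed.

Lemma grid_side_lt k k' : (k < k')%R -> (2 * grid_side k' <= grid_side k)%R.
Proof.
move=> kk'; rewrite /grid_side.
have p0 m : (0 < (2 : R) ^ m)%R by rewrite exprz_gt0.
have : ((2 : R) ^ (k + 1) <= 2 ^ k')%R.
  by apply: (ler_weXz2l (ler1n R 2)); rewrite lezD1.
rewrite expfzDr ?pnatr_eq0// expr1z => h.
by rewrite ler_pdivrMr// mulrC ler_pdivlMr// mulrC.
Qed.

(** Otherwise the two cells coincide, hence have equal sides, and the index of
    a cell is determined by its side and any of its points. *)
Lemma grid_cell_finer t v w : (0 < n)%N -> grid_cell t v `<=` grid_cell t w -> v != w ->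
  (w.1 < v.1)%R.
Proof.
move=> n0 vw vNw; rewrite ltNge; apply/negP => le_vw.
have cv := grid_corner_in t v; have cw := vw _ cv.
have E : grid_cell t v = grid_cell t w.
  by apply/seteqP; split => //; exact: grid_cell_nested cv cw.
have E1 : v.1 = w.1.
  apply/eqP; rewrite eq_le le_vw/= leNgt; apply/negP => lt_vw.
  have : (grid_side v.1 ^+ n)%:E = (grid_side w.1 ^+ n)%:E by rewrite -(leb_grid_cell t) E leb_grid_cell.
  case=> /eqP; rewrite eqrXn2 -?lt0n//; [|exact/ltW/grid_side_gt0|exact/ltW/grid_side_gt0].
  have := grid_side_lt lt_vw; have := grid_side_gt0 w.1 => h1 h2 /eqP h3.
  by move: h2; rewrite h3 ger_pMl// leNgt ltr1n.
move/eqP: vNw; apply; case: v w E1 cv cw {vw le_vw E} => k z [k' z'] /= <- cv cw.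
by congr pair; apply/ffunP => i; rewrite -(cv i) -(cw i).
Qed.

Lemma grid_cell_family t (I : finType) (cd : I -> code) : (0 < n)%N -> injective cd ->
  cube_family (fun i => grid_cell t (cd i)) (fun i => grid_corner t (cd i))
    (fun i => grid_side (cd i).1).
Proof.
move=> n0 inj_cd; split => //.
- by move=> i; exact: grid_side_gt0.
- by move=> i; exact: measurable_grid_cell.
- by move=> i; exact: grid_cell_sub_cube.
- by move=> i; exact: grid_cell_null.
- move=> i j; have [[x [xi xj]]|H] := pselect (exists x, (grid_cell t (cd i) `&` grid_cell t (cd j)) x).
    have [h|h] := leP (cd i).1 (cd j).1; first by apply: Or32; exact: grid_cell_nested xi xj.
    by apply: Or31; exact: grid_cell_nested (ltW h) xj xi.
  by apply: Or33; apply/seteqP; split => // x xij; apply: H; exists x.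
- move=> i j ij iNj.
  have lt_ij : ((cd j).1 < (cd i).1)%R.
    by apply: (grid_cell_finer n0 ij); apply: contra iNj => /eqP/inj_cd ->.
  have := grid_side_lt lt_ij; have := grid_side_gt0 (cd i).1 => g0 h.
  have : ((2 * grid_side (cd i).1) ^+ n <= grid_side (cd j).1 ^+ n)%R.
    by rewrite lerXn2r ?nnegrE ?mulr_ge0 ?(ltW g0)// ltW// grid_side_gt0.
  apply: le_trans; rewrite exprMn ler_wpM2r ?exprn_ge0 ?(ltW g0)//.
  by rewrite -{1}(expr1 2) ler_weXn2l ?ler1n.
Qed.

(** Take the side to be twice the largest power of two up to 3d, which lies in
    (3d, 6d]: each coordinate then differs by less than a third of the side, and
    a grid is chosen for each coordinate separately. *)
Lemma kernel_cover (x y : X) : (0 < euclidean_dist x y)%R ->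
  exists t v, [/\ grid_cell t v x, grid_cell t v y & (grid_side v.1 <= 6 * euclidean_dist x y)%R].
Proof.
set d := euclidean_dist x y => d0.
have d30 : (0 < 3 * d)%R by rewrite mulr_gt0.
pose m : int := Num.floor (ln (3 * d) / ln 2)%R.
pose k : int := (- (m + 1))%R.
have sideE : grid_side k = (2 * dyad (3 * d))%R.
  rewrite /grid_side /k /dyad d30 -exprz_inv -/m.
  have : (2 `^ m%:~R = 2 ^ m :> R)%R by rewrite powR_intmul.
  move=> ->; rewrite exprz_inv invr_expz opprK expfzDr ?pnatr_eq0// expr1z.
  by rewrite mulrC.
have lo : (3 * d < grid_side k)%R by rewrite sideE dyad_gt.
have hi : (grid_side k <= 6 * d)%R.
  by rewrite sideE; have := dyad_le d30; lra.
have close i : exists e, cell_index e k (tnth x i) = cell_index e k (tnth y i).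
  apply: third_trick.
  have : (`|tnth x i - tnth y i| <= d)%R.
    rewrite -sqrtr_sqr /d /euclidean_dist ler_wsqrtr// (bigD1 i)//= lerDl.
    by apply: sumr_ge0 => j _; rewrite sqr_ge0.
  have p0 : (0 < (2 : R) ^ k)%R by rewrite exprz_gt0.
  move=> h; apply: (@le_lt_trans _ _ (d * 2 ^ k)%R).
    by rewrite ler_wpM2r// ltW.
  move: lo; rewrite /grid_side -[X in (_ < X)%R]mul1r ltr_pdivlMr// => lo.
  by rewrite -[X in (_ < X)%R]mul1r ltr_pdivlMr// mulrC mulrA.
exists [ffun i => sval (cid (close i))], (k, [ffun i => cell_index (sval (cid (close i))) k (tnth x i)]).
split => //= i; rewrite !ffunE//.
by have := svalP (cid (close i)) => ->.
Qed.

Definition kernel_coef (theta : R) v : R := ((grid_side v.1 ^+ n) `^ (- theta))%R.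

Definition nth_code (j : nat) : option code := pickle_inv j.

Lemma kernel_le (alpha : R) (x y : X) : (0 < n)%N -> (0 < euclidean_dist x y)%R ->
  (alpha < n%:R)%R ->
  exists t v, [/\ grid_cell t v x, grid_cell t v y &
    ((euclidean_dist x y `^ (n%:R - alpha))^-1 <=
     6 `^ (n%:R - alpha) * kernel_coef (1 - alpha / n%:R) v)%R].
Proof.
move=> n0 d0 an; have [t [v [vx vy h]]] := kernel_cover d0.
exists t, v; split => //; have b0 : (0 < n%:R - alpha)%R by rewrite subr_gt0.
have g0 := grid_side_gt0 v.1.
have -> : kernel_coef (1 - alpha / n%:R) v = (grid_side v.1 `^ (n%:R - alpha))^-1%R.
  rewrite /kernel_coef -powR_mulrn ?(ltW g0)// -powRrM -powRN; congr (_ `^ _)%R.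
  by field; rewrite pnatr_eq0 -lt0n.
rewrite ler_pdivlMr ?powR_gt0// mulrC ler_pdivrMr ?powR_gt0//.
rewrite -powRM ?(ltW d0)//; apply: ge0_ler_powR; rewrite ?nnegrE ?(ltW b0) ?(ltW g0)//.
by rewrite mulr_ge0// ltW.
Qed.

Definition kernel_term theta (h : X -> R) (x : X) j t : \bar R :=
  if nth_code j is Some v then
    (kernel_coef theta v * \1_(grid_cell t v) x)%:E * \int[leb]_(y in grid_cell t v) (h y)%:E
  else 0.

(** Interchanges the integral and the sum over cells. At distance zero the
    kernel is a quotient by zero, that is zero. *)
Lemma riesz_le (alpha : R) (h : X -> R) (x : X) : (0 < n)%N -> (alpha < n%:R)%R ->
  measurable_fun setT h -> (forall y, 0 <= h y)%R ->
  riesz alpha h x <= (6 `^ (n%:R - alpha))%:E *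
    \sum_(0 <= j <oo) \sum_t kernel_term (1 - alpha / n%:R) h x j t.
Proof.
move=> n0 an mh h0; set theta := (1 - alpha / n%:R)%R.
pose K (j : nat) (t : shift) (y : X) : \bar R := if nth_code j is Some v then
    ((kernel_coef theta v * \1_(grid_cell t v) x) * (h y * \1_(grid_cell t v) y))%:E else 0.
have gc0 v : (0 <= kernel_coef theta v)%R by exact: powR_ge0.
have K0 j t y : 0 <= K j t y.
  by rewrite /K; case: (nth_code j) => // v; rewrite lee_fin !mulr_ge0.
have mK j t : measurable_fun setT (K j t).
  rewrite /K; case: (nth_code j) => [v|]; last exact: measurable_cst.
  apply/measurable_EFinP; apply: measurable_funM; first exact: measurable_cst.
  exact: measurable_funM mh (measurable_indic (measurable_grid_cell t v)).
have intK j t : \int[leb]_y K j t y = kernel_term theta h x j t.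
  rewrite /K /kernel_term; case: (nth_code j) => [v|]; last exact: integral0.
  under eq_integral do rewrite EFinM.
  have hi0 y : setT y -> 0 <= (h y * \1_(grid_cell t v) y)%:E.
    by move=> _; rewrite lee_fin mulr_ge0.
  have mhi : measurable_fun setT (fun y => (h y * \1_(grid_cell t v) y)%:E).
    apply/measurable_EFinP.
    exact: measurable_funM mh (measurable_indic (measurable_grid_cell t v)).
  have c0 : (0 <= kernel_coef theta v * \1_(grid_cell t v) x)%R by rewrite mulr_ge0.
  rewrite (ge0_integralZl_EFin leb measurableT hi0 mhi c0).
  congr (_ * _); rewrite [RHS]integral_mkcond; apply: eq_integral => y _.
  rewrite patchE indicE; case: ifPn => yA; first by rewrite mulr1.
  by rewrite mulr0.
have Ks0 j y : 0 <= \sum_t K j t y by apply: sume_ge0 => t _.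
have mKs j : measurable_fun setT (fun y => \sum_t K j t y).
  exact: emeasurable_sum (mK j).
have -> : \sum_(0 <= j <oo) \sum_t kernel_term theta h x j t =
    \int[leb]_y (\sum_(0 <= j <oo) \sum_t K j t y).
  rewrite (integral_nneseries leb measurableT mKs (fun j y _ => Ks0 j y)).
  apply: eq_eseriesr => j _.
  rewrite (ge0_integral_sum leb measurableT (mK j) (fun t y _ => K0 j t y)).
  by apply: eq_bigr => t _; rewrite intK.
have ser0 y : setT y -> 0 <= \sum_(0 <= j <oo) \sum_t K j t y.
  by move=> _; apply: nneseries_ge0 => j _ _; exact: Ks0.
have mser : measurable_fun setT (fun y => \sum_(0 <= j <oo) \sum_t K j t y).
  exact: (@ge0_emeasurable_sum _ X R setT (fun j y => \sum_t K j t y) xpredT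
    (fun j y _ _ => Ks0 j y) (fun j _ => mKs j)).
rewrite -(ge0_integralZl_EFin leb measurableT ser0 mser (powR_ge0 _ _)).
rewrite /riesz; apply: le_integral_any => y _.
have b0 : (0 < n%:R - alpha)%R by rewrite subr_gt0.
have rhs0 : 0 <= (6 `^ (n%:R - alpha))%:E * \sum_(0 <= j <oo) \sum_t K j t y.
  by rewrite mule_ge0 ?lee_fin ?powR_ge0// nneseries_ge0.
have [d0|d0] := ltP 0%R (euclidean_dist x y); last first.
  have -> : euclidean_dist x y = 0%R.
    by apply/eqP; rewrite eq_le d0 /euclidean_dist sqrtr_ge0.
  by rewrite powR0 ?gt_eqF// invr0 mulr0.
have [t [v [vx vy kle]]] := kernel_le n0 d0 an.
have gv : nth_code (pickle v) = Some v by exact: pickleK_inv.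
apply: (@le_trans _ _ ((6 `^ (n%:R - alpha))%:E * K (pickle v) t y)).
  rewrite /K gv !indicE !mem_set// !mulr1 -EFinM lee_fin mulrA mulrC.
  by rewrite ler_wpM2r.
rewrite lee_wpmul2l ?lee_fin ?powR_ge0//.
apply: (@le_trans _ _ (\sum_t K (pickle v) t y)).
  by rewrite (bigD1 t)//= leeDl// sume_ge0.
apply: (@le_trans _ _ (\sum_(0 <= j < (pickle v).+1) \sum_t K j t y)).
  by rewrite big_nat_recr//= leeDr// sume_ge0.
exact: nneseries_lim_ge.
Qed.

End grids.

(** * Passage to the Riesz potential *)

Lemma le_poweR (R : realType) (x y : \bar R) (q : R) : (0 <= q)%R -> 0 <= x ->
  x <= y -> x `^ q <= y `^ q.
Proof.
move=> q0 x0 xy; apply: gt0_ler_poweR => //.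
  by rewrite in_itv/= x0 leey.
by rewrite in_itv/= (le_trans x0 xy) leey.
Qed.

(** Monotone convergence for the q-th powers of the partial sums. Where u
    vanishes, the product is zero even if the series diverges; elsewhere a
    finite limit bounds the partial sums, hence the series. *)
Lemma pow_series_bound d (T : measurableType d) (R : realType)
    (mu : {measure set T -> \bar R}) (A : nat -> T -> R) (u : T -> R) (q M : R) :
  (0 < q)%R -> (forall j, measurable_fun setT (A j)) ->
  (forall j x, 0 <= A j x)%R -> measurable_fun setT u -> (forall x, 0 <= u x)%R ->
  (forall N, \int[mu]_x ((\sum_(0 <= j < N) A j x) `^ q * u x)%:E <= M%:E) ->
  \int[mu]_x ((\sum_(0 <= j <oo) (A j x)%:E) `^ q * (u x)%:E) <= M%:E.
Proof.
move=> q0 mA A0 mu0 u0 H.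
pose S N x := (\sum_(0 <= j < N) A j x)%R.
have S0 N x : (0 <= S N x)%R by apply: sumr_ge0.
pose g N x := ((S N x) `^ q * u x)%:E.
have mS N : measurable_fun setT (S N) by apply: measurable_sum.
have mg N : measurable_fun setT (g N).
  apply/measurable_EFinP; apply: measurable_funM => //.
  exact: measurableT_comp (measurable_powR q) (mS N).
have g0 N x : 0 <= g N x by rewrite lee_fin mulr_ge0 ?powR_ge0.
have ndS x : {homo S^~ x : a b / (a <= b)%N >-> (a <= b)%R}.
  move=> a b ab; rewrite /S (big_cat_nat (leq0n a) ab)/= lerDl.
  by apply: sumr_ge0.
have ndg x : nondecreasing_seq (g^~ x).
  move=> a b ab; rewrite lee_fin ler_wpM2r//.
  by apply: ge0_ler_powR; rewrite ?nnegrE ?(ltW q0)//; exact: ndS.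
have lim_le : \int[mu]_x limn (g^~ x) <= M%:E.
  rewrite monotone_convergence//.
  apply: lime_le; last by apply: nearW => N; exact: H.
  apply: ereal_nondecreasing_is_cvgn => a b ab; apply: ge0_le_integral_any => x _ //.
  exact: ndg.
apply: le_trans lim_le; apply: le_integral_any => x _.
have cvg_g : cvgn (g^~ x) by apply: ereal_nondecreasing_is_cvgn; exact: ndg.
have g_le N : g N x <= limn (g^~ x).
  apply: lime_ge => //; near=> k; apply: ndg; near: k; exact: nbhs_infty_ge.
have [u00|uN] := eqVneq (u x) 0%R.
  by rewrite u00 mule0; apply: le_trans (g0 0%N x) (g_le 0%N).
have ux : (0 < u x)%R by rewrite lt_neqAle eq_sym uN u0.
have := le_trans (g0 0%N x) (g_le 0%N).
case E : (limn (g^~ x)) => [r| |] // r0; last exact: leey.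
have Sr N : (S N x <= (r / u x) `^ q^-1)%R.
  have := g_le N; rewrite E lee_fin -ler_pdivlMr// => h.
  have -> : S N x = ((S N x) `^ q `^ q^-1)%R.
    by rewrite -powRrM mulfV ?gt_eqF// powRr1.
  apply: ge0_ler_powR => //; rewrite ?nnegrE ?invr_ge0 ?(ltW q0) ?powR_ge0//.
  by rewrite divr_ge0 ?(ltW ux).
have ser : \sum_(0 <= j <oo) (A j x)%:E <= ((r / u x) `^ q^-1)%:E.
  apply: lime_le; first by apply: is_cvg_nneseries => j _ _; rewrite lee_fin.
  by apply: nearW => N; rewrite sumEFin lee_fin; exact: Sr.
have ser0 : 0 <= \sum_(0 <= j <oo) (A j x)%:E.
  by apply: nneseries_ge0 => j _ _; rewrite lee_fin.
have ru : (0 <= r / u x)%R by rewrite divr_ge0// ltW.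
have := le_poweR (ltW q0) ser0 ser.
rewrite poweR_EFin -powRrM mulVf ?gt_eqF// powRr1// => h.
have u0' : 0 <= (u x)%:E by rewrite lee_fin ltW.
apply: (le_trans (lee_wpmul2r u0' h)).
by rewrite -EFinM divfK ?gt_eqF.
Unshelve. all: by end_near. Qed.

(** Both sides are compared with the largest term. *)
Lemma sum_powR_le (R : realType) (I : finType) (F : I -> R) (q : R) : (0 < q)%R ->
  (forall i, 0 <= F i)%R ->
  ((\sum_i F i) `^ q <= #|I|%:R `^ q * \sum_i F i `^ q)%R.
Proof.
move=> q0 F0; have [i0 _|none] := pickP I; last first.
  rewrite big_pred0 => [|i]; last exact: none.
  by rewrite powR0 ?gt_eqF// mulr_ge0 ?powR_ge0// sumr_ge0// => i _; exact: powR_ge0.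
pose m := [arg max_(i > i0) F i]%O.
have mmax i : (F i <= F m)%R by rewrite /m; case: arg_maxP => // j _; exact.
have le1 : (\sum_i F i <= #|I|%:R * F m)%R.
  by rewrite (le_trans (ler_sum _ (fun i _ => mmax i)))// sumr_const mulr_natl.
apply: (@le_trans _ _ ((#|I|%:R * F m) `^ q)%R).
  by apply: ge0_ler_powR; rewrite ?nnegrE ?(ltW q0) ?mulr_ge0 ?sumr_ge0.
rewrite powRM// ler_wpM2l ?powR_ge0// (bigD1 m)//= lerDl.
by apply: sumr_ge0 => i _; exact: powR_ge0.
Qed.

Section riesz_bound.
Context {R : realType} {n : nat}.
Local Notation X := (Rn R n).
Local Notation shift := {ffun 'I_n -> bool}.
Local Notation code := (int * {ffun 'I_n -> int})%type.

(** Packing with one constant for all finite families of cubes, which is what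
    the sup over all cubes in the A-infinity constants provides. *)
Definition all_packed (u s : X -> R) (theta p q B : R) :=
  forall (I : finType) (D : I -> set X) (c : I -> X) (l : I -> R),
    cube_family D c l ->
    packed (@leb_mass R n I D) (@atom_mass _ X R leb I D u) (@atom_mass _ X R leb I D s)
      (traces D) theta p q B.

(** The number of grids appears once from raising a sum over grids to the
    power q, and with exponent 1/q from adding up the bounds for the grids. *)
Definition riesz_const (alpha p q p1 q1 : R) : R :=
  (6 `^ (n%:R - alpha) * (#|{: shift}|%:R * #|{: shift}|%:R `^ q^-1 *
    form_const (1 - alpha / n%:R) p q p1 q1))%R.

Variables (alpha p q p1 q1 : R) (u s : X -> R).
Hypotheses (alpha_gt0 : (0 < alpha)%R) (alpha_ltn : (alpha < n%:R)%R).
Hypotheses (p_gt1 : (1 < p)%R) (pq : (p < q)%R) (q1_gt1 : (1 < q1)%R)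
  (qp1 : (q1 < p1)%R) (pp1 : (p^-1 + p1^-1 = 1)%R) (qq1 : (q^-1 + q1^-1 = 1)%R).
Hypotheses (wu : is_weight u) (ws : is_weight s).
Let theta : R := (1 - alpha / n%:R)%R.

Let n0 : (0 < n)%N.
Proof. by rewrite -(ltr0n R); exact: lt_trans alpha_ltn. Qed.

Let p0 : (0 < p)%R. Proof. exact: lt_trans p_gt1. Qed.
Let q0 : (0 < q)%R. Proof. exact: lt_trans pq. Qed.

Let theta0 : (0 < theta)%R.
Proof. by rewrite subr_gt0 ltr_pdivrMr ?ltr0n// mul1r. Qed.

Let theta1 : (theta < 1)%R.
Proof. by rewrite ltrBlDr ltrDl divr_gt0 ?ltr0n. Qed.

Let nmu : nonneg_measurable u. Proof. by case: wu. Qed.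
Let nms : nonneg_measurable s. Proof. by case: ws. Qed.

Let weight_grid_cell (w : X -> R) t (v : code) : is_weight w ->
  \int[leb]_(x in grid_cell t v) (w x)%:E < +oo.
Proof.
move=> [mw w0 woo].
have cQ : is_cube (cube (grid_corner t v : X) (grid_side v.1)).
  by exists (grid_corner t v), (grid_side v.1); split => //; exact: grid_side_gt0.
apply: le_lt_trans (woo _ cQ); apply: ge0_subset_integral.
- exact: measurable_grid_cell.
- exact: measurable_cube.
- by apply: measurable_funTS; exact/measurable_EFinP.
- by move=> x _; rewrite lee_fin.
- exact: grid_cell_sub_cube.
Qed.

Variables (B1 B2 : R).
Hypotheses (B10 : (0 <= B1)%R) (B20 : (0 <= B2)%R).
Hypotheses (pk1 : all_packed u s theta p q B1)
  (pk2 : all_packed s u theta q1 p1 B2).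

Variable f : X -> R.
Hypotheses (mf : nonneg_measurable f)
  (foo : \int[leb]_x (f x `^ p * s x)%:E < +oo).

(** The cells among the first N natural numbers, in an enumeration of all cells
    that skips the numbers coding nothing. *)
Let code_idx N := {j : 'I_N | isSome (nth_code (n := n) (val j))}.

Let dflt : code := (0%R, [ffun => 0%R]).
Let cd N (i : code_idx N) : code := odflt dflt (nth_code (val (val i))).

Let cdE N (i : code_idx N) : nth_code (val (val i)) = Some (cd i).
Proof. by rewrite /cd; have := valP i; case: (nth_code _). Qed.

Let cd_inj N : injective (@cd N).
Proof.
move=> i j E; apply/val_inj/val_inj.
have := @pickle_invK code (val (val i)); have := @pickle_invK code (val (val j)).
rewrite -[pickle_inv (val (val i))]/(nth_code _) -[pickle_inv (val (val j))]/(nth_code _).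
by rewrite !cdE /= E => -> ->.
Qed.

Let fs x := (f x * s x)%R.

Let F t v := fine (\int[leb]_(x in grid_cell t v) (fs x)%:E).

Let term j t (x : X) : R :=
  if nth_code j is Some v then (kernel_coef theta v * F t v * \1_(grid_cell t v) x)%R else 0%R.

Let fam N t := @grid_cell_family R n t _ _ n0 (@cd_inj N).

Let fs_lty t v : \int[leb]_(x in grid_cell t v) (fs x)%:E < +oo.
Proof.
pose cdu (i : unit) : code := v.
have inj : injective cdu by case; case.
have H := @grid_cell_family R n t _ _ n0 inj.
exact: (integral_fs_lty H nms mf (fun i => weight_grid_cell t (cdu i) ws) p_gt1 foo tt).
Qed.

Let term_ge0 j t x : (0 <= term j t x)%R.
Proof.
rewrite /term; case: (nth_code j) => // v; rewrite !mulr_ge0 ?powR_ge0// fine_ge0//.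
by apply: integral_ge0 => y _; rewrite lee_fin mulr_ge0 ?mf.2 ?nms.2.
Qed.

Let mterm j t : measurable_fun setT (term j t).
Proof.
rewrite /term; case: (nth_code j) => [v|]; last exact: measurable_cst.
apply: measurable_funM; first exact: measurable_cst.
exact: measurable_indic (measurable_grid_cell t v).
Qed.

Let kernel_termE x j t : kernel_term theta fs x j t = (term j t x)%:E.
Proof.
rewrite /kernel_term /term; case: (nth_code j) => // v.
have -> : \int[leb]_(y in grid_cell t v) (fs y)%:E = (F t v)%:E.
  rewrite fineK// ge0_fin_numE//; apply: integral_ge0 => y _.
  by rewrite lee_fin mulr_ge0 ?mf.2 ?nms.2.
by rewrite -EFinM mulrAC.
Qed.

Let IF := fine (\int[leb]_x (f x `^ p * s x)%:E).

Let bound1 : R := ((form_const theta p q p1 q1 * (B1 + B2)) `^ q * IF `^ (q / p))%R.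

Let partial_bound N t :
  \int[leb]_x ((\sum_(0 <= j < N) term j t x) `^ q * u x)%:E <= bound1%:E.
Proof.
have := family_bound (fam N t) nmu nms mf (fun i => weight_grid_cell t (cd i) wu)
  (fun i => weight_grid_cell t (cd i) ws) theta0 theta1 p_gt1 pq q1_gt1 qp1 pp1 qq1 B10 B20
  (pk1 (fam N t)) (pk2 (fam N t)) foo.
apply: le_trans; apply: le_integral_any => x _.
rewrite le_eqVlt; apply/orP; left; apply/eqP; congr (_ `^ _ * _)%:E%R.
rewrite big_mkord (bigID (fun j : 'I_N => isSome (nth_code (n := n) (val j))))/=.
rewrite [X in (_ + X)%R]big1 ?addr0; last first.
  by move=> j; rewrite /term; case: (nth_code _).
rewrite (reindex_omap (fun i : code_idx N => val i) insub)/=; last first.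
  by move=> j hj; rewrite insubT.
apply: eq_big => [i|i _]; first by rewrite (valP i) valK eqxx.
by rewrite /term cdE /kernel_coef.
Qed.

(** Truncating the series over the cells leaves, for each grid, a finite family
    of cubes, to which [family_bound] applies uniformly. *)
Lemma riesz_norm_le : Lnorm_weight q u (riesz alpha fs) <=
  (riesz_const alpha p q p1 q1 * (B1 + B2))%:E * Lnorm_weight p s (EFin \o f).
Proof.
pose A j x : R := (\sum_t term j t x)%R.
set K6 := (6 `^ (n%:R - alpha) : R)%R; set c := #|{: shift}|%:R : R.
have K60 : (0 <= K6)%R by exact: powR_ge0.
have A0 j x : (0 <= A j x)%R by apply: sumr_ge0.
have mA j : measurable_fun setT (A j) by apply: measurable_sum.
have rle x : riesz alpha fs x <= K6%:E * \sum_(0 <= j <oo) (A j x)%:E.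
  have fs0 y : (0 <= fs y)%R by rewrite mulr_ge0 ?mf.2 ?nms.2.
  have mfs : measurable_fun setT fs by exact: measurable_funM mf.1 nms.1.
  have := riesz_le x n0 alpha_ltn mfs fs0; rewrite -/theta.
  have -> : \sum_(0 <= j <oo) \sum_t kernel_term theta fs x j t =
      \sum_(0 <= j <oo) (A j x)%:E.
    apply: eq_eseriesr => j _; rewrite -sumEFin.
    by apply: eq_bigr => t _; rewrite kernel_termE.
  by [].
have r0 x : 0 <= riesz alpha fs x.
  apply: integral_ge0 => y _; rewrite lee_fin divr_ge0 ?powR_ge0//.
  by rewrite mulr_ge0 ?mf.2 ?nms.2.
have IF0 : (0 <= IF)%R.
  by apply: fine_ge0; apply: integral_ge0 => x _; rewrite lee_fin mulr_ge0 ?powR_ge0 ?nms.2.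
have b0 : (0 <= bound1)%R by rewrite mulr_ge0 ?powR_ge0.
have c0 : (0 <= c)%R by exact: ler0n.
have series_bound : \int[leb]_x ((\sum_(0 <= j <oo) (A j x)%:E) `^ q * (u x)%:E) <=
    (c `^ q * (c * bound1))%:E.
  apply: pow_series_bound => //; [exact: nmu.1|exact: nmu.2|move=> N].
  apply: (@le_trans _ _ (\int[leb]_x (\sum_t
      (c `^ q * ((\sum_(0 <= j < N) term j t x) `^ q * u x))%:E))).
    apply: le_integral_any => x _; rewrite sumEFin lee_fin -big_distrr/=.
    rewrite -big_distrl/= mulrA ler_wpM2r ?nmu.2//.
    rewrite exchange_big/=; apply: sum_powR_le => // t.
    by apply: sumr_ge0.
  have mt t : measurable_fun setT (fun x => (\sum_(0 <= j < N) term j t x) `^ q * u x)%R.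
    apply: measurable_funM nmu.1; apply: measurableT_comp (measurable_powR q) _.
    exact: measurable_sum.
  have t0 t x : (0 <= (\sum_(0 <= j < N) term j t x) `^ q * u x)%R.
    by rewrite mulr_ge0 ?powR_ge0 ?nmu.2.
  have mt1 t : measurable_fun setT
      (fun x => ((\sum_(0 <= j < N) term j t x) `^ q * u x)%:E).
    by apply/measurable_EFinP; exact: mt.
  have mt2 t : measurable_fun setT
      (fun x => (c `^ q * ((\sum_(0 <= j < N) term j t x) `^ q * u x))%:E).
    by apply/measurable_EFinP; exact: measurable_funM (measurable_cst _) (mt t).
  have t02 t x : setT x ->
      0 <= (c `^ q * ((\sum_(0 <= j < N) term j t x) `^ q * u x))%:E.
    by move=> _; rewrite lee_fin mulr_ge0 ?powR_ge0.
  rewrite (ge0_integral_sum leb measurableT mt2 t02).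
  apply: (@le_trans _ _ (\sum_(t : shift) (c `^ q * bound1)%:E)).
    apply: lee_sum => t _; under eq_integral do rewrite EFinM.
    have t01 x : setT x -> 0 <= ((\sum_(0 <= j < N) term j t x) `^ q * u x)%:E.
      by move=> _; rewrite lee_fin.
    rewrite (ge0_integralZl_EFin leb measurableT t01 (mt1 t) (powR_ge0 _ _)).
    by rewrite EFinM lee_wpmul2l ?lee_fin ?powR_ge0.
  rewrite sumEFin lee_fin sumr_const -[(_ *+ _)%R]mulr_natl le_eqVlt.
  by apply/orP; left; apply/eqP; rewrite /c mulrCA.
have series0 x : 0 <= \sum_(0 <= j <oo) (A j x)%:E.
  by apply: nneseries_ge0 => j _ _; rewrite lee_fin.
have int_bound : \int[leb]_x (`|riesz alpha fs x| `^ q * (u x)%:E) <=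
    (K6 `^ q * (c `^ q * (c * bound1)))%:E.
  apply: (@le_trans _ _ (\int[leb]_x ((K6 `^ q)%:E *
      ((\sum_(0 <= j <oo) (A j x)%:E) `^ q * (u x)%:E)))).
    apply: le_integral_any => x _; rewrite muleA lee_wpmul2r ?lee_fin ?nmu.2//.
    rewrite -poweR_EFin -poweRM//; apply: le_poweR; rewrite ?(ltW q0) ?abse_ge0//.
    by rewrite gee0_abs// rle.
  have mser : measurable_fun setT (fun x => \sum_(0 <= j <oo) (A j x)%:E).
    apply: (@ge0_emeasurable_sum _ X R setT (fun j x => (A j x)%:E) xpredT).
      by move=> k x _ _; rewrite lee_fin.
    by move=> k _; apply/measurable_EFinP; exact: mA.
  have mu1 : measurable_fun setT (EFin \o u).
    by apply/measurable_EFinP; exact: nmu.1.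
  have mp : measurable_fun setT
      (fun x => (\sum_(0 <= j <oo) (A j x)%:E) `^ q * (u x)%:E).
    exact: emeasurable_funM (measurableT_comp (measurable_poweR q) mser) mu1.
  have p00 x : setT x -> 0 <= (\sum_(0 <= j <oo) (A j x)%:E) `^ q * (u x)%:E.
    by move=> _; rewrite mule_ge0 ?poweR_ge0 ?lee_fin ?nmu.2.
  rewrite (ge0_integralZl_EFin leb measurableT p00 mp (powR_ge0 _ _)).
  by rewrite EFinM lee_wpmul2l ?lee_fin ?powR_ge0.
have LfE : Lnorm_weight p s (EFin \o f) = (IF `^ p^-1)%:E.
  rewrite /Lnorm_weight -poweR_EFin /IF fineK; last first.
    by rewrite ge0_fin_numE//; apply: integral_ge0 => x _; rewrite lee_fin mulr_ge0 ?powR_ge0 ?nms.2.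
  have -> : \int[leb]_x (`|(EFin \o f) x| `^ p * (s x)%:E) =
      \int[leb]_x (f x `^ p * s x)%:E.
    by apply: eq_integral => x _ /=; rewrite ger0_norm ?mf.2// EFinM.
  by [].
rewrite LfE -EFinM /Lnorm_weight.
have int0 : 0 <= \int[leb]_x (`|riesz alpha fs x| `^ q * (u x)%:E).
  by apply: integral_ge0 => x _; rewrite mule_ge0 ?poweR_ge0 ?lee_fin ?nmu.2.
have qi0 : (0 <= q^-1)%R by rewrite invr_ge0 ltW.
apply: (le_trans (le_poweR qi0 int0 int_bound)).
rewrite poweR_EFin lee_fin le_eqVlt; apply/orP; left; apply/eqP.
have FC0 : (0 <= form_const theta p q p1 q1)%R.
  by rewrite ltW// addr_gt0// mulr_gt0 ?half_const_gt0 ?testing_const_gt0.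
have powK (x : R) : (0 <= x)%R -> ((x `^ q) `^ q^-1 = x)%R.
  by move=> x0; rewrite -powRrM mulfV ?gt_eqF// powRr1.
have CB : (0 <= form_const theta p q p1 q1 * (B1 + B2))%R.
  exact: mulr_ge0 FC0 (addr_ge0 B10 B20).
have p10 := powR_ge0 K6 q; have p20 := powR_ge0 c q.
have p30 := mulr_ge0 c0 b0; have p40 := mulr_ge0 p20 p30.
rewrite (powRM _ p10 p40) (powRM _ p20 p30) (powRM _ c0 b0) /bound1.
rewrite (powRM _ (powR_ge0 _ _) (powR_ge0 _ _)) !powK// -[((IF `^ _) `^ _)%R]powRrM.
rewrite (_ : (q / p / q = p^-1)%R); last by field; rewrite !gt_eqF.
by rewrite /riesz_const -/theta -/K6 -/c !mulrA.
Qed.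

End riesz_bound.

(** * A-infinity constants imply packing *)

Section constants_to_packing.
Context {R : realType} {n : nat}.
Local Notation X := (Rn R n).
Implicit Types (u s w : X -> R) (a : X) (r alpha theta p q B : R).

Lemma conj_exp_inv p : (1 < p)%R -> ((conj_exp p)^-1 = 1 - p^-1)%R.
Proof.
move=> p1; have p0 := lt_trans ltr01 p1; rewrite /conj_exp.
by field; rewrite subr_eq0 !gt_eqF.
Qed.

Lemma weight_cube w a r : is_weight w -> (0 < r)%R ->
  \int[leb]_(x in cube a r) (w x)%:E = (cube_mass w a r)%:E.
Proof.
move=> [mw w0 woo] r0; rewrite /cube_mass fineK// ge0_fin_numE.
  by apply: woo; exists a, r.
by apply: integral_ge0 => x _; rewrite lee_fin.
Qed.

Lemma cube_mass_ge0 w a r : (forall x, 0 <= w x)%R -> (0 <= cube_mass w a r)%R.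
Proof.
by move=> w0; apply: fine_ge0; apply: integral_ge0 => x _; rewrite lee_fin.
Qed.

Lemma inve_leb_cube a r : (0 < r)%R -> (leb (cube a r))^-1 = ((r ^+ n)^-1)%:E.
Proof. by move=> r0; rewrite leb_cube// inver gt_eqF// exprn_gt0. Qed.

Lemma avg_cubeE w a r : is_weight w -> (0 < r)%R ->
  avg (cube a r) (EFin \o w) = (cube_mass w a r / r ^+ n)%:E.
Proof.
by move=> ww r0; rewrite /avg inve_leb_cube// weight_cube// -EFinM mulrC.
Qed.

Lemma cube_Apq_ge0 u s theta p q a r : (0 <= cube_Apq u s theta p q a r)%R.
Proof. by rewrite !mulr_ge0 ?powR_ge0. Qed.

(** The exponent of |Q| is alpha/n + 1/q - 1/p - 1/q - 1/p' = -theta. *)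
Lemma Apq_cubeE alpha p q u s a r : is_weight u -> is_weight s -> (0 < r)%R ->
  (0 < n)%N -> (1 < p)%R ->
  Apq alpha p q u s (cube a r) = (cube_Apq u s (1 - alpha / n%:R) p q a r)%:E.
Proof.
move=> wu ws r0 n0 p1.
have L0 : (0 < r ^+ n)%R by rewrite exprn_gt0.
have U0 : (0 <= cube_mass u a r)%R by apply: cube_mass_ge0; case: wu.
have S0 : (0 <= cube_mass s a r)%R by apply: cube_mass_ge0; case: ws.
rewrite /Apq leb_cube// !avg_cubeE// !poweR_EFin -!EFinM conj_exp_inv//.
congr EFin; rewrite /cube_Apq; move: (r ^+ n)%R L0 => L L0.
have Li : (0 <= L^-1)%R by rewrite invr_ge0 ltW.
rewrite !powRM// -(powR_inv1 (ltW L0)) -!powRrM !mulN1r.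
set U := (cube_mass u a r `^ _)%R; set S := (cube_mass s a r `^ _)%R.
have -> : (L `^ (- (1 - alpha / n%:R)) = L `^ (alpha / n%:R + q^-1 - p^-1) *
    L `^ (- q^-1) * L `^ (- (1 - p^-1)))%R.
  by rewrite -!powRD ?(gt_eqF L0) ?implybT//; congr (_ `^ _)%R; ring.
by ring.
Qed.

Lemma cube_Apq_sym u s theta p q p1 q1 a r : (p^-1 + p1^-1 = 1)%R ->
  (q^-1 + q1^-1 = 1)%R ->
  cube_Apq s u theta q1 p1 a r = cube_Apq u s theta p q a r.
Proof.
move=> pp1 qq1; rewrite /cube_Apq.
have -> : (1 - p^-1 = p1^-1)%R by rewrite -pp1 addrAC subrr add0r.
have -> : (1 - q1^-1 = q^-1)%R by rewrite -qq1 addrK.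
exact: mulrAC.
Qed.

Lemma le_sup_cube (F : set X -> \bar R) a r : (0 < r)%R ->
  F (cube a r) <= sup_cube F.
Proof.
move=> r0; apply: ereal_sup_ubound; exists (cube a r) => //.
by exists a, r.
Qed.

Lemma sup_cube_ge0 (F : set X -> \bar R) : (forall Q, 0 <= F Q) -> 0 <= sup_cube F.
Proof.
move=> F0; apply: (le_trans (F0 (cube ([tuple of nseq n (0:R)%R] : X) 1%R))).
exact: le_sup_cube.
Qed.

Lemma sqrt_weight w : is_weight w -> is_weight (fun x => Num.sqrt (w x)).
Proof.
move=> [mw w0 woo]; split => [|x|Q [a [r [r0 ->]]]]; last first.
- have mC := measurable_cube a r.
  have mw1 : measurable_fun (cube a r) (EFin \o w).
    by apply: measurable_funTS; apply/measurable_EFinP; exact: mw.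
  have w1 x : cube a r x -> 0 <= (EFin \o w) x by move=> _; rewrite lee_fin.
  have c1 : measurable_fun (cube a r) (fun=> (1%R)%:E : \bar R) by exact: measurable_cst.
  have c2 x : cube a r x -> 0 <= (1%R)%:E :> \bar R by move=> _; rewrite lee_fin.
  apply: (@le_lt_trans _ _ (\int[leb]_(x in cube a r) ((1%R)%:E + (EFin \o w) x))).
    apply: le_integral_any => x _; rewrite -EFinD lee_fin.
    by have := sqr_sqrtr (w0 x); have := sqrtr_ge0 (w x); nra.
  rewrite (ge0_integralD leb mC c2 c1 w1 mw1).
  apply: lte_add_pinfty; last by apply: woo; exists a, r.
  by rewrite integral_cst// mul1e [X in X < _](leb_cube a r0) ltry.
- exact: sqrtr_ge0.
- exact: measurableT_comp (continuous_measurable_fun (@sqrt_continuous R)) mw.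
Qed.

Lemma cube_mass_sqrt_eq0 w a r : is_weight w -> (0 < r)%R ->
  cube_mass (fun x => Num.sqrt (w x)) a r = 0%R -> cube_mass w a r = 0%R.
Proof.
move=> ww r0 H0; have [mh h0 _] := sqrt_weight ww; have [_ w0 _] := ww.
have : \int[leb]_(x in cube a r) (Num.sqrt (w x) * Num.sqrt (w x))%:E = 0.
  apply: (null_mul_integral (measurable_cube a r) _ _ h0 h0).
  - exact: measurable_funTS mh.
  - exact: measurable_funTS mh.
  - by rewrite weight_cube ?H0//; exact: sqrt_weight.
have -> : \int[leb]_(x in cube a r) (Num.sqrt (w x) * Num.sqrt (w x))%:E =
    (cube_mass w a r)%:E.
  rewrite -weight_cube//; apply: eq_integral => x _.
  by rewrite -expr2 sqr_sqrtr.
by case.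
Qed.

(** Let h be the mean of sqrt w. From log t <= t - 1 at t = sqrt w / h follows
    log w <= 2 log h + 2 (sqrt w / h - 1), and the last term has mean zero. *)
Lemma avg_lne_le w a r : is_weight w -> (0 < r)%R ->
  (0 < cube_mass (fun x => Num.sqrt (w x)) a r)%R ->
  avg (cube a r) (fun x => lne (w x)%:E) <=
    (2 * ln (cube_mass (fun x => Num.sqrt (w x)) a r / r ^+ n))%:E.
Proof.
move=> ww r0 H0; have [mw w0 _] := ww.
have wh := sqrt_weight ww; have [mh h0 hoo] := wh.
have L0 : (0 < r ^+ n)%R by rewrite exprn_gt0.
set H := cube_mass _ a r in H0 *; set h := (H / r ^+ n)%R.
have hp : (0 < h)%R by rewrite divr_gt0.
have mC := measurable_cube a r.
pose k : R := (2 * ln h - 2)%R.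
have ptw x : lne (w x)%:E <= ((2 / h) * Num.sqrt (w x))%:E + k%:E.
  have [wx|wx] := ltP 0%R (w x); last first.
    by rewrite le0_lneNy ?lee_fin// leNye.
  rewrite lne_EFin// -EFinD lee_fin.
  have sx : (0 < Num.sqrt (w x))%R by rewrite sqrtr_gt0.
  have -> : ln (w x) = (2 * ln (Num.sqrt (w x)))%R.
    rewrite -{1}(sqr_sqrtr (w0 x)) expr2 lnM ?posrE//; ring.
  have : (ln (Num.sqrt (w x) / h) <= Num.sqrt (w x) / h - 1)%R.
    have := @le_ln1Dx R (Num.sqrt (w x) / h - 1)%R.
    rewrite addrCA subrr addr0; apply.
    by rewrite ltrBrDr addNr divr_gt0.
  rewrite ln_div ?posrE// /k; move: (Num.sqrt _) (ln h) => z y.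
  rewrite (_ : 2 / h * z = 2 * (z / h))%R; last by ring.
  by move: (z / h)%R (ln z) => *; lra.
have mg : measurable_fun (cube a r) (fun x => ((2 / h) * Num.sqrt (w x))%:E).
  apply: measurable_funTS; apply/measurable_EFinP.
  exact: measurable_funM (measurable_cst _) mh.
have c20 : (0 <= 2 / h)%R by rewrite divr_ge0// ltW.
have g0 x : cube a r x -> 0 <= ((2 / h) * Num.sqrt (w x))%:E.
  by move=> _; rewrite lee_fin mulr_ge0.
have mh1 : measurable_fun (cube a r) (fun x => (Num.sqrt (w x))%:E).
  by apply: measurable_funTS; apply/measurable_EFinP; exact: mh.
have h1 x : cube a r x -> 0 <= (Num.sqrt (w x))%:E by move=> _; rewrite lee_fin.
have gE : \int[leb]_(x in cube a r) ((2 / h) * Num.sqrt (w x))%:E = (2 * r ^+ n)%:E.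
  under eq_integral do rewrite EFinM.
  rewrite (ge0_integralZl_EFin leb mC h1 mh1 c20) weight_cube// -EFinM.
  congr EFin; rewrite -/H /h; field.
  by rewrite !gt_eqF.
have intg : leb.-integrable (cube a r) (fun x => ((2 / h) * Num.sqrt (w x))%:E).
  apply/integrableP; split; first exact: mg.
  have -> : \int[leb]_(x in cube a r) `|((2 / h) * Num.sqrt (w x))%:E| = (2 * r ^+ n)%:E.
    by rewrite -gE; apply: eq_integral => x _; rewrite gee0_abs// lee_fin mulr_ge0.
  exact: ltry.
have intk : leb.-integrable (cube a r) (fun=> k%:E).
  apply/integrableP; split; first exact: measurable_cst.
  have -> : \int[leb]_(x in cube a r) `|k%:E| = (`|k| * r ^+ n)%:E.
    by rewrite integral_cst// [X in _ * X](leb_cube a r0).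
  exact: ltry.
have le1 : \int[leb]_(x in cube a r) lne (w x)%:E <= (2 * ln h * r ^+ n)%:E.
  apply: (@le_trans _ _ (\int[leb]_(x in cube a r)
      (((2 / h) * Num.sqrt (w x))%:E + k%:E))).
    by apply: le_integral_any => x _; exact: ptw.
  rewrite (integralD mC intg intk) gE integral_cst// [X in _ + _ * X](leb_cube a r0).
  rewrite -EFinM -EFinD lee_fin /k le_eqVlt; apply/orP; left; apply/eqP; ring.
rewrite /avg inve_leb_cube//.
have Li : 0 <= ((r ^+ n)^-1)%:E :> \bar R by rewrite lee_fin invr_ge0 ltW.
apply: (le_trans (lee_wpmul2l Li le1)).
rewrite -EFinM lee_fin le_eqVlt; apply/orP; left; apply/eqP; field.
by rewrite gt_eqF.
Qed.

(** By [avg_lne_le] the exponential constant of s on Q is at least the mean of s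
    divided by the square of the mean of sqrt s; so A^q times the mean of s is
    at most B^q times that square. If sqrt s has mean zero, so has s. *)
Lemma sqrt_bound_of_Aexp u s alpha p q B a r : is_weight u -> is_weight s ->
  (0 < n)%N -> (1 < p)%R -> (0 < q)%R -> (0 < r)%R -> (0 <= B)%R ->
  Apq alpha p q u s (cube a r) * Aexp s (cube a r) `^ q^-1 <= B%:E ->
  (cube_Apq u s (1 - alpha / n%:R) p q a r `^ q * cube_mass s a r <=
    B `^ q * (r ^+ n * (cube_mass (fun x => Num.sqrt (s x)) a r / r ^+ n) `^ 2))%R.
Proof.
move=> wu ws n0 p1 q0 r0 B0; rewrite Apq_cubeE//.
have [_ s0 _] := ws; have L0 : (0 < r ^+ n)%R by rewrite exprn_gt0.
have S0 : (0 <= cube_mass s a r)%R by exact: cube_mass_ge0.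
set A := cube_Apq _ _ _ _ _ _ _; have A0 : (0 <= A)%R by exact: cube_Apq_ge0.
have [SE|SN] := eqVneq (cube_mass s a r) 0%R.
  by move=> _; rewrite SE mulr0 !mulr_ge0 ?powR_ge0// ltW.
have Sgt : (0 < cube_mass s a r)%R by rewrite lt_neqAle eq_sym SN.
have Hgt : (0 < cube_mass (fun x => Num.sqrt (s x)) a r)%R.
  rewrite lt_neqAle eq_sym cube_mass_ge0 ?andbT; last by move=> x; exact: sqrtr_ge0.
  by apply: contra SN => /eqP /(cube_mass_sqrt_eq0 ws r0) ->.
have avg_le := avg_lne_le ws r0 Hgt.
set h := (cube_mass _ a r / r ^+ n)%R in avg_le *; have hp : (0 < h)%R by rewrite divr_gt0.
have Aexp_ge : ((cube_mass s a r / r ^+ n) * (h ^+ 2)^-1)%:E <= Aexp s (cube a r).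
  rewrite /Aexp avg_cubeE// EFinM lee_wpmul2l ?lee_fin ?divr_ge0 ?(ltW L0)//.
  have <- : expeR (- (2 * ln h)%:E) = ((h ^+ 2)^-1)%:E.
    rewrite -EFinN /= -mulrN mulrC; congr EFin.
    rewrite -[in RHS](@lnK _ h) ?posrE// -expRM_natr -expRN.
    by congr expR; ring.
  by rewrite lee_expeR leeN2.
have c0 : (0 <= (cube_mass s a r / r ^+ n) * (h ^+ 2)^-1)%R.
  by rewrite mulr_ge0 ?invr_ge0 ?sqr_ge0// divr_ge0// ltW.
have qi : (0 <= q^-1)%R by rewrite invr_ge0 ltW.
have c1 : 0 <= ((cube_mass s a r / r ^+ n) * (h ^+ 2)^-1)%:E :> \bar R by rewrite lee_fin.
have := le_poweR qi c1 Aexp_ge; rewrite poweR_EFin => h1 h2.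
have A1 : 0 <= A%:E :> \bar R by rewrite lee_fin.
have := le_trans (lee_wpmul2l A1 h1) h2; rewrite -EFinM lee_fin => h3.
have : ((A * ((cube_mass s a r / r ^+ n) * (h ^+ 2)^-1) `^ q^-1) `^ q <= B `^ q)%R.
  by apply: ge0_ler_powR; rewrite ?nnegrE ?(ltW q0) ?mulr_ge0 ?powR_ge0.
rewrite (powRM _ A0 (powR_ge0 _ _)) -powRrM mulVf ?gt_eqF// (powRr1 c0) => h4.
rewrite powR_mulrn ?(ltW hp)//.
have h2p : (0 < h ^+ 2)%R by rewrite exprn_gt0.
have -> : (A `^ q * cube_mass s a r = (A `^ q * (cube_mass s a r / r ^+ n / h ^+ 2)) *
    (r ^+ n * h ^+ 2))%R.
  by field; rewrite !gt_eqF.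
by rewrite ler_wpM2r// mulr_ge0//; exact: ltW.
Qed.

Lemma integral_maximal_ge0 (w : X -> R) a r : (0 < r)%R ->
  0 <= \int[leb]_(x in cube a r) maximal w x.
Proof.
move=> r0; apply: integral_ge0 => x Qx.
apply: (@le_trans _ _ (avg (cube a r) (fun y => `|w y|%:E))).
  by rewrite /avg mule_ge0 ?inve_ge0 ?measure_ge0// integral_ge0.
apply: ereal_sup_ubound; exists (cube a r) => //; split => //.
by exists a, r.
Qed.

Lemma AM_const_ge0 w : is_weight w -> 0 <= AM_const w.
Proof.
move=> [_ w0 _]; have a : X := [tuple of nseq n (0:R)%R].
apply: le_trans (le_sup_cube _ a ltr01); rewrite mule_ge0//.
  by rewrite inve_ge0; apply: integral_ge0 => x _; rewrite lee_fin.
exact: integral_maximal_ge0.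
Qed.

(** The inverse of a zero mass is +oo, so in that case the hypothesis forces the
    integral of the maximal function to vanish. *)
Lemma maximal_bound_of_AM s K a r : is_weight s -> (0 < r)%R -> (0 <= K)%R ->
  (\int[leb]_(x in cube a r) (s x)%:E)^-1 *
    \int[leb]_(x in cube a r) maximal (fun y => s y * \1_(cube a r) y)%R x <= K%:E ->
  \int[leb]_(x in cube a r) maximal (fun y => s y * \1_(cube a r) y)%R x <=
    (K * cube_mass s a r)%:E.
Proof.
move=> ws r0 K0; rewrite weight_cube//.
set Y := \int[leb]_(x in _) _.
have [_ s0 _] := ws; have S0 : (0 <= cube_mass s a r)%R by exact: cube_mass_ge0.
have Y0 : 0 <= Y by exact: integral_maximal_ge0.
rewrite inver; case: eqP => [SE|/eqP SN].
  have [->|YN] := eqVneq Y 0; first by move=> _; rewrite lee_fin mulr_ge0.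
  have Ygt : 0 < Y by rewrite lt_neqAle eq_sym YN.
  by rewrite gt0_mulye// leye_eq.
have Sgt : (0 < cube_mass s a r)%R by rewrite lt_neqAle eq_sym SN.
have S1 : 0 <= (cube_mass s a r)%:E :> \bar R by rewrite lee_fin.
move=> /(lee_wpmul2l S1); rewrite muleA -EFinM mulfV// mul1e -EFinM.
by rewrite mulrC.
Qed.

Lemma all_packed_exp u s alpha p q B : is_weight u -> is_weight s ->
  (0 < n)%N -> (1 < p)%R -> (0 < q)%R -> (0 <= B)%R ->
  sup_cube (fun Q => Apq alpha p q u s Q * Aexp s Q `^ q^-1) <= B%:E ->
  all_packed u s (1 - alpha / n%:R) p q (B * sparse_const R `^ q^-1)%R.
Proof.
move=> wu ws n0 p1 q0 B0 H I D c l cf.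
have woo (w : X -> R) i : is_weight w -> \int[leb]_(x in D i) (w x)%:E < +oo.
  move=> ww; have [mw w0 _] := ww.
  rewrite -(cube_integral cf); last by split.
  by rewrite weight_cube ?ltry//; exact: cf_side cf i.
have nm (w : X -> R) : is_weight w -> nonneg_measurable w by case.
apply: (packed_traces_sqrt cf (nm _ wu) (nm _ ws) (fun i => woo _ i wu)
  (fun i => woo _ i ws) q0 B0) => i.
have li := cf_side cf i.
apply: sqrt_bound_of_Aexp => //.
exact: le_trans (le_sup_cube (fun Q => Apq alpha p q u s Q * Aexp s Q `^ q^-1) _ li) H.
Qed.

Lemma all_packed_max u s alpha p q A0 K : is_weight u -> is_weight s ->
  (0 < n)%N -> (1 < p)%R -> (0 < q)%R -> (0 <= A0)%R -> (0 <= K)%R ->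
  (forall a r, (0 < r)%R -> cube_Apq u s (1 - alpha / n%:R) p q a r <= A0)%R ->
  AM_const s <= K%:E ->
  all_packed u s (1 - alpha / n%:R) p q (A0 * (4 * K) `^ q^-1)%R.
Proof.
move=> wu ws n0 p1 q0 A00 K0 HA HK I D c l cf.
have woo (w : X -> R) i : is_weight w -> \int[leb]_(x in D i) (w x)%:E < +oo.
  move=> ww; have [mw w0 _] := ww.
  rewrite -(cube_integral cf); last by split.
  by rewrite weight_cube ?ltry//; exact: cf_side cf i.
have nm (w : X -> R) : is_weight w -> nonneg_measurable w by case.
apply: (packed_traces_max cf (nm _ wu) (nm _ ws) (fun i => woo _ i wu)
  (fun i => woo _ i ws) q0 A00 K0) => i; have li := cf_side cf i.
  exact: HA.
apply: maximal_bound_of_AM => //.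
exact: le_trans (le_sup_cube (fun Q => (\int[leb]_(x in Q) (s x)%:E)^-1
    * \int[leb]_(x in Q) maximal (fun y => s y * \1_Q y)%R x) _ li) HK.
Qed.

End constants_to_packing.

(** * The two bounds *)

Unset Implicit Arguments.
Set Strict Implicit.

Theorem theorem2p3 (R : realType) (n : nat) (alpha p q : R)
    (alpha_gt0 : (0 < alpha)%R) (alpha_ltn : (alpha < n%:R)%R)
    (p_gt1 : (1 < p)%R) (p_ltq : (p < q)%R) :
  exists c : R, (0 < c)%R /\
    forall u sigma : Rn R n -> R,
      is_weight u -> is_weight sigma ->
      Apq_const alpha p q u sigma < +oo ->
      Ainfty u -> Ainfty sigma ->
      opnorm p sigma q u (fun f => riesz alpha (fun y => f y * sigma y)%R)
        <= c%:E *
           (sup_cube (fun Q => Apq alpha p q u sigma Q * Aexp sigma Q `^ q^-1)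
            + sup_cube (fun Q =>
                Apq alpha (conj_exp q) (conj_exp p) sigma u Q
                * Aexp u Q `^ (conj_exp p)^-1))
      /\
      opnorm p sigma q u (fun f => riesz alpha (fun y => f y * sigma y)%R)
        <= c%:E *
           (Apq_const alpha p q u sigma
            * (AM_const u `^ (conj_exp p)^-1 + AM_const sigma `^ q^-1)).
Proof.
have p0 : (0 < p)%R := lt_trans ltr01 p_gt1.
have q_gt1 : (1 < q)%R := lt_trans p_gt1 p_ltq.
have q0 : (0 < q)%R := lt_trans ltr01 q_gt1.
have n0 : (0 < n)%N by rewrite -(ltr0n R); exact: lt_trans alpha_ltn.
have p1i := conj_exp_inv p_gt1; have q1i := conj_exp_inv q_gt1.
have conj_gt1 (x : R) : (1 < x)%R -> (1 < conj_exp x)%R.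
  by move=> x1; rewrite /conj_exp ltr_pdivlMr ?subr_gt0// mul1r ltrBlDr ltrDl.
have p1_gt1 := conj_gt1 _ p_gt1; have q1_gt1 := conj_gt1 _ q_gt1.
have p10 := lt_trans ltr01 p1_gt1; have q10 := lt_trans ltr01 q1_gt1.
set p1 := conj_exp p in p1i p1_gt1 p10 *; set q1 := conj_exp q in q1i q1_gt1 q10 *.
have pp1 : (p^-1 + p1^-1 = 1)%R by rewrite p1i addrC subrK.
have qq1 : (q^-1 + q1^-1 = 1)%R by rewrite q1i addrC subrK.
have qp1 : (q1 < p1)%R.
  rewrite -ltf_pV2 ?posrE// p1i q1i ltrD2l ltrN2 ltf_pV2 ?posrE//.
pose c0 := @riesz_const R n alpha p q p1 q1.
pose e1 := (sparse_const R `^ q^-1 + sparse_const R `^ p1^-1)%R.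
pose e2 := (4 `^ q^-1 + 4 `^ p1^-1 : R)%R.
have c00 : (0 < c0)%R.
  have card0 : (0 < #|{: {ffun 'I_n -> bool}}|%:R :> R)%R.
    by rewrite ltr0n card_ffun card_bool card_ord expn_gt0.
  have theta0 : (0 < 1 - alpha / n%:R)%R.
    by rewrite subr_gt0 ltr_pdivrMr ?ltr0n// mul1r.
  have theta1 : (1 - alpha / n%:R < 1)%R.
    by rewrite ltrBlDr ltrDl divr_gt0 ?ltr0n.
  have form0 : (0 < form_const (1 - alpha / n%:R) p q p1 q1)%R.
    by rewrite addr_gt0// mulr_gt0 ?half_const_gt0 ?testing_const_gt0.
  by rewrite mulr_gt0 ?powR_gt0// mulr_gt0// mulr_gt0// powR_gt0.
have e10 : (0 <= e1)%R by rewrite addr_ge0 ?powR_ge0.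
have e20 : (0 < e2)%R by rewrite addr_gt0 ?powR_gt0.
exists (c0 * (e1 + e2))%R; split; first by rewrite mulr_gt0// ltr_wpDl.
move=> u sigma wu ws Aoo _ _.
have opnorm_le (B1 B2 C : R) : (0 <= B1)%R -> (0 <= B2)%R ->
    all_packed u sigma (1 - alpha / n%:R) p q B1 ->
    all_packed sigma u (1 - alpha / n%:R) q1 p1 B2 -> (c0 * (B1 + B2) <= C)%R ->
    opnorm p sigma q u (fun f => riesz alpha (fun y => f y * sigma y)%R) <= C%:E.
  move=> B10 B20 pk1 pk2 cC; apply: ereal_inf_lbound; split.
    by rewrite lee_fin (le_trans _ cC)// mulr_ge0 ?addr_ge0// ltW.
  move=> f mf f0 foo; have nmf : nonneg_measurable f by split.
  have fpoo : \int[leb]_x (f x `^ p * sigma x)%:E < +oo.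
    move: foo; rewrite /Lnorm_weight => /lty_poweRy; rewrite invr_eq0 gt_eqF// => /(_ erefl).
    have -> // : \int[leb]_x (`|(EFin \o f) x| `^ p * (sigma x)%:E) =
        \int[leb]_x (f x `^ p * sigma x)%:E.
    by apply: eq_integral => x _ /=; rewrite ger0_norm// EFinM.
  have := riesz_norm_le alpha_gt0 alpha_ltn p_gt1 p_ltq q1_gt1 qp1 pp1 qq1 wu ws
    B10 B20 pk1 pk2 nmf fpoo.
  move=> h; apply: (le_trans h); apply: lee_wpmul2r; first exact: poweR_ge0.
  by rewrite lee_fin.
clearbody c0.
have Apq0 a b v w Q : 0 <= Apq alpha a b v w Q :> \bar R.
  by rewrite /Apq !mule_ge0 ?poweR_ge0.
set E1 := sup_cube _; set E2 := sup_cube _.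
have E10 : 0 <= E1.
  by apply: sup_cube_ge0 => Q; rewrite mule_ge0 ?poweR_ge0.
have E20 : 0 <= E2.
  by apply: sup_cube_ge0 => Q; rewrite mule_ge0 ?poweR_ge0.
have cgt : (0 < c0 * (e1 + e2))%R by rewrite mulr_gt0// ltr_wpDl.
(* The coefficient is wasteful, c0 * (e1 + e2) instead of c0 * e1, so that one
   constant serves both bounds. *)
have first_bound : opnorm p sigma q u (fun f => riesz alpha (fun y => f y * sigma y)%R)
    <= (c0 * (e1 + e2))%:E * (E1 + E2).
  have [Eoo|Eoo] := eqVneq (E1 + E2) +oo.
    by rewrite Eoo gt0_muley ?lte_fin// leey.
  have E12 : E1 + E2 \is a fin_num by rewrite ge0_fin_numE ?adde_ge0// ltey.
  have [E1f E2f] : E1 \is a fin_num /\ E2 \is a fin_num.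
    by move: E12; rewrite fin_numD => /andP[].
  have r1 : (0 <= fine E1)%R by exact: fine_ge0.
  have r2 : (0 <= fine E2)%R by exact: fine_ge0.
  rewrite -(fineK E1f) -(fineK E2f) -EFinD -EFinM.
  apply: (opnorm_le (fine E1 * sparse_const R `^ q^-1)%R
    (fine E2 * sparse_const R `^ p1^-1)%R).
  - by rewrite mulr_ge0 ?powR_ge0.
  - by rewrite mulr_ge0 ?powR_ge0.
  - by apply: all_packed_exp => //; rewrite fineK.
  - by apply: all_packed_exp => //; rewrite fineK.
  rewrite -[leRHS]mulrA ler_pM2l//.
  have ineq (x y z v w : R) : (0 <= x -> 0 <= y -> 0 < z -> 0 <= v -> 0 <= w ->
      x * v + y * w <= (v + w + z) * (x + y))%R.
    move=> x0 y0 z0 v0 w0.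
    rewrite [leRHS](_ : _ = x * v + y * w + (x * w + y * v + z * (x + y)))%R; last by ring.
    by rewrite lerDl !addr_ge0// mulr_ge0 ?addr_ge0// ltW.
  by apply: ineq => //; exact: powR_ge0.
split; first exact: first_bound.
set A := Apq_const alpha p q u sigma in Aoo *.
have A0 : 0 <= A by apply: sup_cube_ge0.
have ApqA a r : (0 < r)%R -> (cube_Apq u sigma (1 - alpha / n%:R) p q a r)%:E <= A.
  by move=> r0; rewrite -Apq_cubeE//; exact: le_sup_cube.
have Afin : A \is a fin_num by rewrite ge0_fin_numE.
(* If A = 0 the second right-hand side is zero even when the other factor is
   infinite; then the first right-hand side is zero as well. *)
have [AE|AN] := eqVneq A 0.
  have cA0 a r : (0 < r)%R -> cube_Apq u sigma (1 - alpha / n%:R) p q a r = 0%R.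
    move=> r0; apply/eqP; rewrite eq_le cube_Apq_ge0 andbT -lee_fin.
    by rewrite (le_trans (ApqA a r r0))// AE.
  have E1E : E1 = 0.
    apply/eqP; rewrite eq_le E10 andbT; apply: ge_ereal_sup => _ [Q [a [r [r0 ->]]] <-].
    by rewrite Apq_cubeE// cA0// mul0e.
  have E2E : E2 = 0.
    apply/eqP; rewrite eq_le E20 andbT; apply: ge_ereal_sup => _ [Q [a [r [r0 ->]]] <-].
    by rewrite Apq_cubeE// (cube_Apq_sym _ _ _ _ _ pp1 qq1) cA0// mul0e.
  by move: first_bound; rewrite E1E E2E AE adde0 mule0 mul0e mule0.
have Agt : 0 < A by rewrite lt_neqAle eq_sym AN.
set M1 := AM_const u; set M2 := AM_const sigma.
have M10 : 0 <= M1 by exact: AM_const_ge0.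
have M20 : 0 <= M2 by exact: AM_const_ge0.
have [Moo|Moo] := eqVneq (M1 `^ p1^-1 + M2 `^ q^-1) +oo.
  by rewrite Moo gt0_muley// gt0_muley ?lte_fin// leey.
have : M1 `^ p1^-1 + M2 `^ q^-1 \is a fin_num.
  by rewrite ge0_fin_numE ?adde_ge0 ?poweR_ge0// ltey.
rewrite fin_numD => /andP[M1f M2f].
have p1n : (p1^-1 != 0)%R by rewrite invr_eq0 gt_eqF.
have qn : (q^-1 != 0)%R by rewrite invr_eq0 gt_eqF.
have M1fin : M1 \is a fin_num.
  rewrite (ge0_fin_numE M10); apply: (lty_poweRy p1n).
  by rewrite -(ge0_fin_numE (poweR_ge0 _ _)).
have M2fin : M2 \is a fin_num.
  rewrite (ge0_fin_numE M20); apply: (lty_poweRy qn).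
  by rewrite -(ge0_fin_numE (poweR_ge0 _ _)).
have a0 : (0 <= fine A)%R := fine_ge0 A0.
have m10 : (0 <= fine M1)%R := fine_ge0 M10.
have m20 : (0 <= fine M2)%R := fine_ge0 M20.
have eq_le_fine (x : \bar R) : x \is a fin_num -> x <= (fine x)%:E.
  by move=> xf; rewrite fineK.
have fineE (c : R) (x y z : \bar R) (r r' : R) : x \is a fin_num ->
    y \is a fin_num -> z \is a fin_num ->
    c%:E * (x * (y `^ r + z `^ r')) =
    (c * (fine x * (fine y `^ r + fine z `^ r')))%:E.
  by move: x y z => [x| |] [y| |] [z| |] //= _ _ _; rewrite !poweR_EFin -EFinD -!EFinM.
rewrite (fineE _ _ _ _ _ _ Afin M1fin M2fin).
apply: (opnorm_le (fine A * (4 * fine M2) `^ q^-1)%R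
  (fine A * (4 * fine M1) `^ p1^-1)%R).
- exact: mulr_ge0 a0 (powR_ge0 _ _).
- exact: mulr_ge0 a0 (powR_ge0 _ _).
- apply: (all_packed_max wu ws n0 p_gt1 q0 a0 m20).
    by move=> a r r0; rewrite -lee_fin (fineK Afin); exact: ApqA.
  exact: eq_le_fine M2fin.
- apply: (all_packed_max ws wu n0 q1_gt1 p10 a0 m10).
    move=> a r r0; rewrite (cube_Apq_sym _ _ _ _ _ pp1 qq1) -lee_fin (fineK Afin).
    exact: ApqA.
  exact: eq_le_fine M1fin.
have ineq (x y1 y2 : R) : (0 <= x -> 0 <= y1 -> 0 <= y2 ->
    c0 * (x * (4 * y2) `^ q^-1 + x * (4 * y1) `^ p1^-1) <=
    c0 * (e1 + e2) * (x * (y1 `^ p1^-1 + y2 `^ q^-1)))%R.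
  move=> x0 y10 y20.
  rewrite -[leRHS]mulrA ler_pM2l// !powRM// /e2.
  have v0 : (0 <= 4 `^ q^-1 :> R)%R := powR_ge0 _ _.
  have w0 : (0 <= 4 `^ p1^-1 :> R)%R := powR_ge0 _ _.
  have z10 := powR_ge0 y1 p1^-1; have z20 := powR_ge0 y2 q^-1.
  move: (4 `^ q^-1)%R (4 `^ p1^-1)%R (y1 `^ _)%R (y2 `^ _)%R v0 w0 z10 z20.
  move=> v w z1 z2 v0 w0 z10 z20.
  rewrite [leRHS](_ : _ = x * (v * z2) + x * (w * z1) +
    (x * (v * z1) + x * (w * z2) + e1 * (x * (z1 + z2))))%R; last by ring.
  by rewrite lerDl !addr_ge0// !mulr_ge0// addr_ge0.
exact: ineq a0 m10 m20.
Qed.
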